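(* Let $T = t_1\cdots t_n$ be a string of length $n$ over an integer alphabet $\Sigma=\{1,\dots,\sigma\}$, and let $I$ be any set of $b$ indices in $\{1,\dots,n\}$. There is a randomized algorithm that, with high probability, constructs the sparse suffix array of $T$ for the index set $I$ in $O(n\log^2 b)$ time in the worst case, using $O(b)$ words of working space.
   Context: For $1\le i\le n$, $T_i = t_i\cdots t_n$ denotes the $i$-th suffix of $T$. The sparse suffix array of $T$ for an index set $I$ is the list of the indices in $I$ ordered so that the corresponding suffixes $T_i$, $i\in I$, appear in lexicographic order. ''With high probability'' means with probability at least $1-n^{-c}$ for some constant $c>0$. The model is the word RAM; the text $T$ is read-only input and the space bound counts the additional words of memory used. *)

(* Defs.v *)
From mathcomp Require Import all_boot.
Set Implicit Arguments. Unset Strict Implicit. Unset Printing Implicit Defensive.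

Fixpoint lexlt (s t : seq nat) : bool :=
  match s, t with
  | [::], [::] => false
  | [::], _ :: _ => true
  | _ :: _, [::] => false
  | a :: s', c :: t' => (a < c) || ((a == c) && lexlt s' t')
  end.

(* T_i = t_i ... t_n for 1 <= i <= n (T is stored 0-based as a seq). *)
Definition suffix (T : seq nat) (i : nat) : seq nat := drop i.-1 T.

(* sa is the sparse suffix array of T for the index set I (given as a
   duplicate-free list): the indices of I listed so that the corresponding
   suffixes appear in lexicographic order. *)
Definition is_sparse_suffix_array (T : seq nat) (I sa : seq nat) : bool :=
  perm_eq sa I && sorted (fun i j => lexlt (suffix T i) (suffix T j)) sa.

(* Registers are indexed by nat and hold w-bit words (values < 2^w);
   arithmetic is modulo 2^w.  Operands name registers directly; Load/Store
   are indirect.  ReadT/ReadI read the read-only input (the text T,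
   1-based, and the list of indices I, 0-based); Rand draws a uniformly
   random word; Out appends a word to the (write-only) output. *)
Inductive instr :=
| Const of nat & nat
| Add of nat & nat & nat
| Sub of nat & nat & nat
| Mul of nat & nat & nat
| Div of nat & nat & nat        (* r[d] := r[a] / r[b]  (0 if r[b] = 0) *)
| Lt of nat & nat & nat
| LoadInd of nat & nat
| Store of nat & nat
| ReadT of nat & nat
| ReadI of nat & nat
| Rand of nat
| Jz of nat & nat
| Jmp of nat
| Out of nat
| Halt.

Record state := St {
  pc : nat; regs : nat -> nat; rpos : nat; outp : seq nat;
  maxaddr : nat;
  halted : bool }.

Definition upd (f : nat -> nat) (a v : nat) : nat -> nat :=
  fun x => if x == a then v else f x.

Section Machine.
Variables (w : nat) (P : seq instr) (T I : seq nat) (tape : nat -> nat).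
Local Notation W := (2 ^ w).

Definition readT (i : nat) : nat :=
  if (0 < i) && (i <= size T) then nth 0 T i.-1 else 0.
Definition readI (i : nat) : nat := nth 0 I i.

Definition step (s : state) : state :=
  let: St p r q o m h := s in
  if h then s else
  let nx d v ms := St p.+1 (upd r d v) q o (foldr maxn m (d :: ms)) false in
  match nth Halt P p with
  | Const d k => nx d (k %% W) [::]
  | Add d a b => nx d ((r a + r b) %% W) [:: a; b]
  | Sub d a b => nx d ((r a + (W - r b)) %% W) [:: a; b]
  | Mul d a b => nx d ((r a * r b) %% W) [:: a; b]
  | Div d a b => nx d (r a %/ r b) [:: a; b]
  | Lt d a b => nx d (r a < r b) [:: a; b]
  | LoadInd d a => nx d (r (r a)) [:: a; r a]
  | Store a x => St p.+1 (upd r (r a) (r x)) q o (foldr maxn m [:: a; x; r a]) false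
  | ReadT d a => nx d (readT (r a) %% W) [:: a]
  | ReadI d a => nx d (readI (r a) %% W) [:: a]
  | Rand d => St p.+1 (upd r d (tape q %% W)) q.+1 o (maxn m d) false
  | Jz a l => St (if r a == 0 then l else p.+1) r q o (maxn m a) false
  | Jmp l => St l r q o m false
  | Out a => St p.+1 r q (rcons o (r a)) (maxn m a) false
  | Halt => St p r q o m true
  end.

Definition init : state :=
  St 0 (upd (upd (fun _ => 0) 0 (size T)) 1 (size I)) 0 [::] 1 false.

Definition run (t : nat) : state := iter t step init.
End Machine.

(* The random tape: a finite sequence of L uniformly random w-bit words. *)
Definition tape_of (L W : nat) (r : {ffun 'I_L -> 'I_W}) (i : nat) : nat :=
  if insub i is Some j then val (r j) else 0.

(* "log b" in the asymptotic bound, with the usual convention log x >= 1. *)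
Definition lg (b : nat) : nat := (trunc_log 2 b).+1.

(* Main.v *)
Require Import Defs.
From mathcomp Require Import all_boot all_algebra.
From mathcomp Require Import qpoly qfpoly zify ring.
Set Implicit Arguments. Unset Strict Implicit. Unset Printing Implicit Defensive.
Import GRing.Theory.

(** Substrings are compared by fingerprints: each letter is hashed to [0, 4^j) by
    multiply-shift, where 32^j <= n < 32^(j+1), and the hashed string is evaluated
    as a polynomial at a random point of the field F_p[X]/(X^3 - X - c), p being
    the first prime >= 4^j, so that p^2 <= n and p can be found by trial division.
    One fingerprint confuses two given substrings with probability O(2^-j); with
    17 independent copies a union bound over the at most (n+1)^3 triples
    (position, position, length) leaves O(1/2^j), a power of 1/n.

    Prefix fingerprints are stored at the multiples of a stride s ~ n/b, which
    takes O(b) words and O(n) time.  Two suffixes are compared by binary search on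
    the number of common blocks of length s, a fingerprint of any substring being
    completed from the preceding sample in O(s) steps, and then by at most s
    letters: O(s log b) time.  Heapsort performs O(b log b) comparisons, which
    gives O(n log^2 b) in total.  Since n may be 2^w - 1, a word cannot address
    more than n + 1 cells, so the heap holds only b/4 + 1 indices and four rounds
    each extract the next smallest ones.  Texts shorter than a constant are compared
    letter by letter. *)

(** * Primes *)

(** A polynomial fingerprint errs with probability about n over the size of the field, so the field
    must exceed n by a power of n. Yet a product of residues must fit in a word, which may have
    little more than log n bits, and p must be found in O(n) steps; both ask for p^2 <= n. A cubic
    extension reconciles these demands: p^3 >= 64^j against n < 32^(j+1). Its modulus exists for
    every p because x^3 - x is not injective on F_p. Letters may be as large as 2^w - 1, and
    reducing them modulo p would identify fixed pairs of letters whatever is drawn; a random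
    multiply-shift avoids this, and distinct hash values below p stay distinct in F_p. The tape
    influences only the answers of comparisons. Every loop has a bound that holds for any answers,
    so time and space are established for an arbitrary comparison relation, and only correctness
    needs a tape on which that relation is the order of the suffixes. Probabilities are counts of
    word tuples with denominators cleared. *)

Lemma expn2_le_bin m : 2 ^ m <= 'C(m + m, m).
Proof.
elim: m => // m IH.
have E : 'C(m + m.+1, m) = 'C(m + m.+1, m.+1).
  by rewrite -[in RHS]bin_sub ?addnK // leq_addl.
rewrite addSn binS E addnn expnS mul2n leq_double.
by apply: leq_trans IH _; rewrite addnS binS leq_addl.
Qed.

(** By Legendre's formula the exponent of p is the sum over k of the integer quotients 2m / p^k - 2
    (m / p^k). Each term is 0 or 1 and vanishes once p^k > 2m, so the exponent is at most log_p
    (2m). *)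
Lemma logn_bin_le p m : prime p -> 0 < m -> p ^ logn p 'C(m + m, m) <= m + m.
Proof.
move=> pp m0; have p1 := prime_gt1 pp.
have e1 : logn p (m + m)`! = logn p 'C(m + m, m) + (logn p m`! + logn p m`!).
  rewrite -(@bin_fact (m + m) m) ?leq_addr // addnK.
  by rewrite !lognM ?muln_gt0 ?fact_gt0 // bin_gt0 leq_addr.
(* Legendre's sum is lengthened by zero terms so that the sums for [m] and [m + m] run over the same
   range. *)
have ext q : logn p q`! = \sum_(1 <= k < (m + q).+1) q %/ p ^ k.
  rewrite logn_fact // (@big_cat_nat _ _ _ q.+1 1 (m + q).+1) //=; last by rewrite ltnS leq_addl.
  rewrite [X in _ = _ + X]big1_seq ?addn0 // => k; rewrite mem_index_iota => /andP[_ /andP[hk _]].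
  by rewrite divn_small // (leq_trans hk) // ltnW // ltn_expl.
rewrite logn_fact // ext in e1.
set t := trunc_log p (m + m).
suff h : logn p 'C(m + m, m) <= t.
  apply: leq_trans (trunc_logP p1 _); last by rewrite addn_gt0 m0.
  by rewrite leq_exp2l.
have h1 : \sum_(1 <= k < (m + m).+1) (m + m) %/ p ^ k <=
    \sum_(1 <= k < (m + m).+1) ((m %/ p ^ k + m %/ p ^ k) + (k <= t)).
  apply: leq_sum => k _; rewrite /t.
  have pk : 0 < p ^ k by rewrite expn_gt0; lia.
  case: (leqP k) => hk.
    have d1 := divn_eq m (p ^ k); have d2 := ltn_pmod m pk.
    rewrite -ltnS ltn_divLR // {1 2}d1; nia.
  rewrite divn_small // (leq_trans (trunc_log_ltn _ p1)) // leq_exp2l //; lia.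
have h2 : \sum_(1 <= k < (m + m).+1) (k <= t : nat) <= t.
  elim: (m + m) => [|N IH]; first by rewrite big_nil.
  have -> : \sum_(1 <= k < N.+2) (k <= t : nat) = minn N.+1 t; last exact: geq_minr.
  elim: N.+1 => [|M IHM]; first by rewrite big_nil min0n.
  rewrite big_nat_recr //= IHM; lia.
rewrite !big_split /= in h1.
move: h1 h2 e1; lia.
Qed.

(** If no prime factor of the central binomial coefficient exceeded M, there would be at most M of
    them, each contributing a prime power of at most 2m. The coefficient would then be at most
    (2m)^M, but it is at least 2^m. *)
Lemma prime_in_range M m : 0 < m -> (m + m) ^ M < 2 ^ m -> exists2 p, prime p & M < p <= m + m.
Proof.
move=> m0 h.
set B := 'C(m + m, m); have B0 : 0 < B by rewrite bin_gt0 leq_addr.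
have pB p : p \in primes B -> p <= m + m.
  rewrite mem_primes => /and3P[pp _ pd].
  have := dvdn_trans pd (dvdn_mulr (m`! * (m + m - m)`!) (dvdnn B)).
  rewrite bin_fact ?leq_addr // => hp.
  rewrite leqNgt; apply/negP => hlt.
  have : logn p (m + m)`! = 0.
    rewrite logn_fact // big1_seq // => k; rewrite mem_index_iota => /andP[_ hk].
    rewrite divn_small // (leq_trans hlt) // -{1}(expn1 p) leq_exp2l ?prime_gt1 //; lia.
  by move/eqP; rewrite -leqn0 leqNgt logn_gt0 mem_primes pp fact_gt0 hp.
case: (boolP (all (fun p => p <= M) (primes B))) => [/allP hall|/allPn[p hp hM]]; last first.
  exists p; last by rewrite ltnNge hM pB.
  by move: hp; rewrite mem_primes => /and3P[].
have : B <= (m + m) ^ M.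
  rewrite (prod_prime_decomp B0) prime_decompE big_map /=.
  apply: leq_trans (_ : (m + m) ^ size (primes B) <= _).
    have gen s : {subset s <= primes B} -> \prod_(p <- s) p ^ logn p B <= (m + m) ^ size s.
      elim: s => [|p s IH] hs /=; first by rewrite big_nil.
      rewrite big_cons expnS; apply: leq_mul.
        apply: logn_bin_le => //; have := hs p (mem_head _ _).
        by rewrite mem_primes => /and3P[].
      by apply: IH => q hq; apply: hs; rewrite inE hq orbT.
    exact: gen.
  rewrite leq_exp2l; last lia.
  rewrite -[M in _ <= M](size_iota 1 M); apply: uniq_leq_size; first exact: primes_uniq.
  move=> p hp; rewrite mem_iota; have := hall p hp.
  by move: hp; rewrite mem_primes => /and3P[/prime_gt0 ? _ _]; lia.
by have := expn2_le_bin m; rewrite -/B; lia.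
Qed.

(* Far weaker than Bertrand's postulate, but enough to find a prime between
   n^(2/5) and n^(1/2). *)
Lemma prime_between j : 40 <= j -> exists2 p, prime p & 4 ^ j <= p /\ p * p <= 32 ^ j.
Proof.
move=> hj; set h := j %/ 2.
have hh : 2 * h <= j by rewrite /h; lia.
have big : 2 * j + h < 2 ^ h.-1.
  have h7 : 7 <= h by rewrite /h; lia.
  have : forall k, 5 * (k + 7) + 2 < 2 ^ (k + 6).
    by elim=> [|k] //; rewrite (addSn k 6) (addSn k 7) expnS; move: (2 ^ (k + 6)) => X; lia.
  move=> /(_ (h - 7)); rewrite subnK // (_ : h - 7 + 6 = h.-1); last lia.
  by apply: leq_trans; rewrite /h; lia.
(* With m = 2^(2j+h-1) and M = 4^j the hypothesis (2m)^M < 2^m reads 2j + h < 2^(h-1), and p <= 2m =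
   2^(2j+h) gives p^2 <= 2^(4j+2h) <= 32^j because 2h <= j. *)
have [||p pp hp] := @prime_in_range (2 ^ (2 * j)) (2 ^ (2 * j + h.-1)).
- by rewrite expn_gt0.
- rewrite addnn -mul2n -expnS (_ : (2 * j + h.-1).+1 = 2 * j + h); last by rewrite /h; lia.
  by rewrite -expnM ltn_exp2l // expnD mulnC ltn_pmul2l ?expn_gt0.
exists p => //; split; first by rewrite (expnM 2 2 j) in hp; apply: ltnW; case/andP: hp.
have {hp} : p <= 2 ^ (2 * j + h).
  case/andP: hp => _; rewrite addnn -mul2n -expnS; congr (_ <= 2 ^ _); rewrite /h; lia.
move=> hp; apply: leq_trans (leq_mul hp hp) _.
by rewrite -expnD -(expnM 2 5 j) leq_exp2l //; lia.
Qed.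

(** * Fingerprints *)

Section Fp.
Variable p : nat.
Hypothesis pp : prime p.
Local Open Scope ring_scope.

Lemma Fp_nat_eq x y : (x%:R == y%:R :> 'F_p) = (x == y %[mod p])%N.
Proof. by rewrite -(inj_eq val_inj) /= !val_Fp_nat. Qed.

(** X^3 - X - c has no root in F_p. The intermediate reduction mirrors the test run by the machine,
    where an unreduced cube could overflow. *)
Definition cubic_rootfree (c : nat) :=
  forall x, (x < p -> ((x * x) %% p * x) %% p != (x + c) %% p)%N.

(** The map x |-> x^3 - x sends both 0 and 1 to 0, so on the finite set F_p it is not injective,
    hence not surjective; any missed value serves as c. *)
Lemma exists_rootfree : exists2 c, (c < p)%N & cubic_rootfree c.
Proof.
pose f (x : 'F_p) : 'F_p := x ^+ 3 - x.
have [c hc] : exists c, forall x, f x != c.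
  case: (boolP [exists c, [forall x, f x != c]]) => [/existsP[c /forallP h]|]; first by exists c.
  rewrite negb_exists => /forallP h.
  have h2 y : exists x, f x == y.
    by have := h y; rewrite negb_forall => /existsP[x]; rewrite negbK => hx; exists x.
  (* A section of [f] on a finite type is a two-sided inverse, which would make [f] injective and
     identify 0 with 1. *)
  pose g y := xchoose (h2 y).
  have gK : cancel g f by move=> y; apply/eqP; exact: (xchooseP (h2 y)).
  have := can_inj (canF_sym gK) (x1 := 0) (x2 := 1); rewrite /f !expr1n subrr expr0n subr0 => /(_ erefl).
  by move/eqP; rewrite eq_sym oner_eq0.
exists (val c); first by rewrite -[X in (_ < X)%N](Fp_cast pp) ltn_ord.
move=> x hx; apply: contra (hc x%:R); rewrite modnMml => /eqP E.
rewrite /f subr_eq addrC -natrX -[c]natr_Zp -natrD Fp_nat_eq.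
by rewrite !expnS expn0 muln1 mulnA E.
Qed.

(** A cubic without a root is irreducible, so F_p[X]/(X^3 - X - c) is a field in which 1, th, th^2
    are independent over F_p. What follows uses only the three facts listed, so the quotient
    construction stays local to this proof. *)
Lemma ext_field c : cubic_rootfree c ->
  exists (L : fieldType) (th : L), [/\ p%:R = 0 :> L, th ^+ 3 = th + c%:R &
    forall a0 a1 a2 b0 b1 b2 : nat,
      [&& a0 < p, a1 < p, a2 < p, b0 < p, b1 < p & b2 < p]%N ->
      a0%:R + a1%:R * th + a2%:R * th ^+ 2 = b0%:R + b1%:R * th + b2%:R * th ^+ 2 ->
      [/\ a0 = b0, a1 = b1 & a2 = b2]].
Proof.
move=> hc.
pose h : {poly 'F_p} := 'X^3 - ('X + (c%:R)%:P).
have sq : (size (- ('X + (c%:R)%:P) : {poly 'F_p}) <= 2)%N.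
  by rewrite size_polyN (leq_trans (size_polyD _ _)) // size_polyX size_polyC; case: eqP.
have sh : size h = 4 by rewrite /h size_polyDl size_polyXn ?(leq_ltn_trans sq).
have mh : h \is monic.
  by rewrite monicE /h lead_coefDl ?lead_coefXn // size_polyXn (leq_ltn_trans sq).
have ih : irreducible_poly h.
  apply: cubic_irreducible; rewrite ?sh // => x; apply/negP; rewrite /root /h !hornerE.
  move=> /eqP E.
  have hx : (val x < p)%N by rewrite -[X in (_ < X)%N](Fp_cast pp) ltn_ord.
  have := hc _ hx; rewrite modnMml => /negP; apply.
  rewrite -Fp_nat_eq natrD !natrM !natr_Zp -subr_eq0; apply/eqP.
  by rewrite -[RHS]E; ring.
pose hI : monic_irreducible_poly h := (ih, mh).
pose L : fieldType := {poly %/ h with hI}.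
pose em : {poly 'F_p} -> L := fun q => in_qpoly h q.
have emD u v : em (u + v) = em u + em v by exact: in_qpolyD.
have emM u v : em (u * v) = em u * em v by exact: in_qpolyM.
have em1 : em 1 = 1 by exact: in_qpoly1.
have em0 : em 0 = 0 by exact: in_qpoly0.
have emn k : em (k%:R)%:P = k%:R.
  elim: k => [|k IH]; first by rewrite mulr0n polyC0 em0.
  by rewrite !mulrS polyCD emD IH em1.
have hmk : mk_monic h = h by rewrite /mk_monic sh mh.
exists L, (em 'X); split.
- rewrite -emn (_ : p%:R = 0 :> 'F_p) ?em0 //; exact: pchar_Fp_0.
- rewrite -emn -emD !exprS expr0 mulr1 -!emM.
  have -> : 'X * ('X * 'X) = h + ('X + (c%:R)%:P) by rewrite /h subrK -!expr2 -exprS.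
  rewrite emD (_ : em h = 0) ?add0r //.
  by apply: val_inj; rewrite /= hmk; exact: Pdiv.RingMonic.rmodpp.
- move=> a0 a1 a2 b0 b1 b2 /and5P[ha0 ha1 ha2 hb0 /andP[hb1 hb2]].
  pose q (u0 u1 u2 : nat) : {poly 'F_p} := (u0%:R)%:P + (u1%:R)%:P * 'X + (u2%:R)%:P * 'X^2.
  have lift u0 u1 u2 : u0%:R + u1%:R * em 'X + u2%:R * em 'X ^+ 2 = em (q u0 u1 u2).
    have e2 : em 'X^2 = em 'X ^+ 2 by rewrite !expr2 emM.
    by rewrite /q 2!emD (emM _ 'X) (emM _ 'X^2) !emn e2.
  have sz u0 u1 u2 : (size (q u0 u1 u2) < size (mk_monic h))%N.
    rewrite hmk sh ltnS.
    have -> : q u0 u1 u2 = Poly [:: u0%:R; u1%:R; u2%:R] :> {poly 'F_p}.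
      by rewrite /= !cons_poly_def /q; ring.
    exact: size_Poly.
  rewrite !lift => /(congr1 val); rewrite /= !Pdiv.CommonRing.rmodp_small // => E.
  have co i := congr1 (fun q : {poly 'F_p} => q`_i) E.
  have := co 0; have := co 1; have := co 2%N; rewrite /= !coefD !coefCM !coefC !coefX !coefXn /=.
  rewrite !(mulr0, mulr1, addr0, add0r) => /eqP e2 /eqP e1 /eqP e0.
  move: e0 e1 e2; rewrite !Fp_nat_eq !modn_small // => /eqP-> /eqP-> /eqP->; split => //.
Qed.
End Fp.

(** * Fingerprints as triples of residues *)

Definition tri := (nat * nat * nat)%type.

Section Hash.
Variables (p c : nat).
Definition mm (x y : nat) := (x * y) %% p.
Definition ad (x y : nat) := (x + y) %% p.

(* Product in F_p[X]/(X^3 - X - c). *)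
Definition mul3 (a b : tri) : tri :=
  let: (a0, a1, a2) := a in let: (b0, b1, b2) := b in
  let d3 := ad (mm a1 b2) (mm a2 b1) in
  let d4 := mm a2 b2 in
  (ad (mm a0 b0) (mm c d3),
   ad (ad (mm a0 b1) (mm a1 b0)) (ad d3 (mm c d4)),
   ad (ad (mm a0 b2) (mm a1 b1)) (ad (mm a2 b0) d4)).

Definition add3 (a b : tri) : tri :=
  let: (a0, a1, a2) := a in let: (b0, b1, b2) := b in (ad a0 b0, ad a1 b1, ad a2 b2).

Variables (W D r : nat) (g : tri).
Definition hl (x : nat) : nat := ((r * x) %% W) %/ D.

Definition stp (acc : tri) (x : nat) : tri :=
  let: (m0, m1, m2) := mul3 acc g in (ad m0 (hl x), m1, m2).

(* Horner's rule, with the coefficients hashed by [hl]. *)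
Definition phi (s : seq nat) : tri := foldl stp (0, 0, 0) s.
Definition pw (k : nat) : tri := iter k (fun a => mul3 a g) (1, 0, 0).

(** The fingerprint of the l letters after position a is [phi (take (a + l) T)] minus
    [phi (take a T)] times g^l. Equality of two such differences is written with the negative terms
    moved across, so that no subtraction modulo p occurs. *)
Definition teq (T : seq nat) (a b l : nat) : bool :=
  add3 (phi (take (a + l) T)) (mul3 (phi (take b T)) (pw l)) ==
  add3 (phi (take (b + l) T)) (mul3 (phi (take a T)) (pw l)).

Definition wf3 (a : tri) : bool := let: (a0, a1, a2) := a in [&& a0 < p, a1 < p & a2 < p].

Hypothesis pp : prime p.
Hypothesis wfg : wf3 g.

Let p0 : 0 < p. Proof. exact: prime_gt0. Qed.

Lemma wf_mul3 a b : wf3 (mul3 a b).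
Proof. by case: a => [[? ?] ?]; case: b => [[? ?] ?]; rewrite /= !ltn_mod p0. Qed.

Lemma wf_add3 a b : wf3 (add3 a b).
Proof. by case: a => [[? ?] ?]; case: b => [[? ?] ?]; rewrite /= !ltn_mod p0. Qed.

Lemma wf_stp a x : wf3 (stp a x).
Proof.
rewrite /stp; have := wf_mul3 a g; case: (mul3 a g) => [[m0 m1] m2] /and3P[_ h1 h2].
by rewrite /= h1 h2 ltn_mod p0.
Qed.

Lemma wf_phi s : wf3 (phi s).
Proof.
by elim/last_ind: s => [|s x IH]; rewrite /phi ?foldl_rcons ?wf_stp //= p0.
Qed.

Lemma wf_pw k : wf3 (pw k).
Proof. by case: k => [|k]; rewrite /= ?wf_mul3 // p0 prime_gt1. Qed.

Section Field.
Local Open Scope ring_scope.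
Variables (L : fieldType) (th : L).
Hypothesis pL : p%:R = 0 :> L.
Hypothesis th3 : th ^+ 3 = th + c%:R.
Hypothesis inj : forall a0 a1 a2 b0 b1 b2 : nat,
      [&& a0 < p, a1 < p, a2 < p, b0 < p, b1 < p & b2 < p]%N ->
      a0%:R + a1%:R * th + a2%:R * th ^+ 2 = b0%:R + b1%:R * th + b2%:R * th ^+ 2 ->
      [/\ a0 = b0, a1 = b1 & a2 = b2].

Definition val3 (a : tri) : L := let: (a0, a1, a2) := a in a0%:R + a1%:R * th + a2%:R * th ^+ 2.

Lemma modp_natr (x : nat) : (x %% p)%N%:R = x%:R :> L.
Proof. by rewrite {2}(divn_eq x p) natrD natrM pL mulr0 add0r. Qed.

Lemma val_mm x y : (mm x y)%:R = x%:R * y%:R :> L.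
Proof. by rewrite /mm modp_natr natrM. Qed.
Lemma val_ad x y : (ad x y)%:R = x%:R + y%:R :> L.
Proof. by rewrite /ad modp_natr natrD. Qed.

Lemma val_mul3 a b : val3 (mul3 a b) = val3 a * val3 b.
Proof.
case: a => [[a0 a1] a2]; case: b => [[b0 b1] b2]; rewrite /= !(val_mm, val_ad).
(* Once c is replaced by th^3 - th, the reduction rules built into [mul3] become a polynomial
   identity in th. *)
have -> : c%:R = th ^+ 3 - th by rewrite th3 addrC addKr.
ring.
Qed.

Lemma val_add3 a b : val3 (add3 a b) = val3 a + val3 b.
Proof.
case: a => [[a0 a1] a2]; case: b => [[b0 b1] b2]; rewrite /= !val_ad; ring.
Qed.

Lemma val3_inj a b : wf3 a -> wf3 b -> val3 a = val3 b -> a = b.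
Proof.
case: a => [[a0 a1] a2]; case: b => [[b0 b1] b2] /= /and3P[h0 h1 h2] h H.
by have [|-> -> ->] := inj _ H; first rewrite h0 h1 h2 h.
Qed.

Let ga := val3 g.

Lemma val_stp a x : val3 (stp a x) = val3 a * ga + (hl x)%:R.
Proof.
rewrite -val_mul3 /stp; case: (mul3 a g) => [[m0 m1] m2]; rewrite /= val_ad; ring.
Qed.

Lemma val_pw k : val3 (pw k) = ga ^+ k.
Proof.
elim: k => [|k IH]; first by rewrite /= expr0 !mul0r !addr0.
by rewrite exprSr -IH -val_mul3.
Qed.

(** Horner's rule makes the first letter the leading coefficient, hence [rev]. *)
Definition hpol (s : seq nat) : {poly L} := Poly (rev [seq (hl x)%:R | x <- s]).

Lemma hpol_rcons s x : hpol (rcons s x) = hpol s * 'X + (hl x)%:R%:P.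
Proof. by rewrite /hpol map_rcons rev_rcons /= cons_poly_def. Qed.

Lemma val_phi s : val3 (phi s) = (hpol s).[ga].
Proof.
elim/last_ind: s => [|s x IH]; first by rewrite /= horner0 !mul0r !addr0.
by rewrite hpol_rcons /phi foldl_rcons val_stp -/(phi s) IH !hornerE.
Qed.

Lemma hpol_cat u v : hpol (u ++ v) = hpol u * 'X^(size v) + hpol v.
Proof.
elim/last_ind: v => [|v x IH]; first by rewrite cats0 /hpol /= expr0 mulr1 addr0.
by rewrite -rcons_cat !hpol_rcons IH size_rcons exprS; ring.
Qed.

(** The contributions of the prefixes [take a T] and [take b T] occur on both sides of the test and
    cancel, so that it depends on the two substrings only. *)
Lemma teq_hpol T a b l : (a + l <= size T)%N -> (b + l <= size T)%N ->
  teq T a b l = ((hpol (take l (drop a T)) - hpol (take l (drop b T))).[ga] == 0).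
Proof.
move=> ha hb.
have sza : size (take l (drop a T)) = l by rewrite size_takel // size_drop; lia.
have szb : size (take l (drop b T)) = l by rewrite size_takel // size_drop; lia.
rewrite /teq !takeD hornerD hornerN subr_eq0.
set A := take l (drop a T) in sza *; set B := take l (drop b T) in szb *.
transitivity (val3 (add3 (phi (take a T ++ A)) (mul3 (phi (take b T)) (pw l))) ==
  val3 (add3 (phi (take b T ++ B)) (mul3 (phi (take a T)) (pw l)))).
  by apply/eqP/eqP => [->|/val3_inj] // -> //; exact: wf_add3.
rewrite !val_add3 !val_mul3 !val_phi !hpol_cat sza szb val_pw !hornerD !hornerM !hornerXn.
move: (ga ^+ l) (hpol (take a T)).[ga] (hpol (take b T)).[ga] (hpol A).[ga] (hpol B).[ga] => z u v x y.
apply/eqP/eqP => [H|->]; last by ring.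
have -> : x = (u * z + x + v * z) - (u * z + v * z) by ring.
by rewrite H; ring.
Qed.

Lemma hpol_neq u v : size u = size v -> all (fun x => hl x < p)%N u -> all (fun x => hl x < p)%N v ->
  map hl u != map hl v -> hpol u - hpol v != 0.
Proof.
move=> suv hu hv; apply: contra; rewrite subr_eq0 => /eqP E.
have E2 : rev [seq (hl x)%:R | x <- u] = rev [seq (hl x)%:R | x <- v] :> seq L.
  apply: (@eq_from_nth _ 0); first by rewrite !size_rev !size_map.
  by move=> i _; have := congr1 (fun P : {poly L} => P`_i) E; rewrite /hpol !coef_Poly.
have {E2}/(congr1 rev) := E2; rewrite !revK => E2.
apply/eqP; apply: (@eq_from_nth _ 0%N); first by rewrite !size_map.
move=> i; rewrite size_map => hi.
have := congr1 (fun s : seq L => s`_i) E2.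
rewrite !(nth_map 0%N) -?suv // => E3.
have hxu := allP hu _ (mem_nth 0%N hi).
have hiv : (i < size v)%N by rewrite -suv.
have hxv := allP hv _ (mem_nth 0%N hiv).
have [||-> //] := @inj (hl (nth 0%N u i)) 0%N 0%N (hl (nth 0%N v i)) 0%N 0%N.
  by rewrite hxu hxv p0.
by rewrite E3.
Qed.

Lemma size_hpol u : (size (hpol u) <= size u)%N.
Proof. by apply: leq_trans (size_Poly _) _; rewrite size_rev size_map. Qed.
End Field.
End Hash.

(** * Counting the multipliers on which two letters collide *)

Lemma card_le_code (A : finType) (S : A -> bool) (f : A -> nat) N :
  (forall a b, S a -> S b -> f a = f b -> a = b) -> (forall a, S a -> f a < N) ->
  #|[pred a | S a]| <= N.
Proof.
move=> fi fN; rewrite cardE -(size_map f) -[N in _ <= N](size_iota 0).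
apply: uniq_leq_size.
  by rewrite map_inj_in_uniq ?enum_uniq // => a b; rewrite !mem_enum; exact: fi.
by move=> x /mapP[a]; rewrite mem_enum mem_iota => /fN h ->.
Qed.

Lemma eq_code B a1 e1 a2 e2 : e1 < B -> e2 < B -> a1 * B + e1 = a2 * B + e2 -> a1 = a2 /\ e1 = e2.
Proof.
move=> h1 h2 E; have B0 : 0 < B by lia.
have := congr1 (fun x => x %/ B) E; rewrite !divnMDl // !divn_small // !addn0 => E1.
by move: E; rewrite E1 => /addnI.
Qed.

(** The two sides differ by 2 (b - a) d = 2^(t+1) o (b - a); the power of two cancels against W, and
    the odd o is invertible modulo 2^k. *)
Lemma mod_cancel d D o t W k a b : odd o -> d = 2 ^ t * o -> W = 2 ^ t.+1 * 2 ^ k ->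
  a <= b -> (a + a + 1) * d + D = (b + b + 1) * d + D %[mod W] -> a = b %[mod 2 ^ k].
Proof.
move=> odo Ed eW hab /eqP; rewrite eqn_modDr eq_sym eqn_mod_dvd; last first.
  by rewrite leq_mul2r !leq_add ?orbT.
rewrite -mulnBl (_ : b + b + 1 - (a + a + 1) = 2 * (b - a)); last lia.
rewrite Ed mulnCA !mulnA -[2 ^ t * 2]mulnC -expnS -mulnA eW dvdn_pmul2l ?expn_gt0 //.
rewrite Gauss_dvdl; last by rewrite coprimeXl // coprime2n.
by move=> h; apply/eqP; rewrite eq_sym eqn_mod_dvd.
Qed.

Section Letter.
Variables (w l : nat).
Hypothesis lw : l <= w.
Let W := 2 ^ w.
Let D := 2 ^ (w - l).
Let h (r x : nat) := hl W D ((r + r + 1) %% W) x.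

(** The signed distance of the two products modulo W, shifted by D. Equal hashes mean equal
    quotients by D, so the residues differ by less than D and the shifted distance is positive and
    below 2D. *)
Definition hq r x d := ((r + r + 1) * (x + d)) %% W + D - ((r + r + 1) * x) %% W.

Lemma hl_window r x d : h r x = h r (x + d) ->
  0 < hq r x d < D + D /\ hq r x d = (r + r + 1) * d + D %[mod W].
Proof.
rewrite /h /hl !modnMml /hq; set v := (_ * (x + d)) %% W; set u := _ %% W => E.
have D0 : 0 < D by rewrite expn_gt0.
have hu := ltn_pmod u D0; have hv := ltn_pmod v D0.
have eu := divn_eq u D; have evv := divn_eq v D.
split; first by rewrite E in eu; lia.
apply/eqP; rewrite -(eqn_modDl u) subnKC; last by rewrite E in eu; lia.
rewrite /u /v modnDml modnDml; apply/eqP; congr (_ %% W).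
by rewrite mulnDr addnA.
Qed.

Lemma dvd_exp2 a b : a <= b -> 2 ^ a %| 2 ^ b. Proof. exact: dvdn_exp2l. Qed.

(** Write d = 2^t o with o odd. If D divides d, a collision forces [hq] to equal D, so that W
    divides (2r + 1) d, hence d, which is impossible. Otherwise [hq] is a multiple of 2^t below 2D,
    which leaves at most 2D / 2^t values; each fixes r modulo 2^(w-t-1) and leaves 2^(t+1) choices
    of r, 4D in all. *)
Lemma letter_bad_lt x d : 0 < d < W ->
  #|[pred r : 'I_W | h r x == h r (x + d)]| <= 4 * D.
Proof.
case/andP=> d0 dW; have D0 : 0 < D by rewrite expn_gt0.
have W0 : 0 < W by rewrite expn_gt0.
have DW : D %| W by apply: dvd_exp2; lia.
have [o odo Ed] : exists2 o, odd o & d = 2 ^ logn 2 d * o.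
  exists (d %/ 2 ^ logn 2 d); last by rewrite mulnC divnK ?pfactor_dvdnn.
  have [m cm E] := pfactor_coprime (isT : prime 2) d0.
  by rewrite {1}E mulnK ?expn_gt0 //; move: cm; rewrite coprime2n.
set t := logn 2 d in Ed.
have modsub a b m : m %| W -> a = b %[mod W] -> a = b %[mod m].
  by move=> hm H; rewrite -(modn_dvdm a hm) H modn_dvdm.
case: (leqP (w - l) t) => ht.
  rewrite leqNgt; apply/negP => /ltnW/(leq_trans _) H.
  have /card_gt0P[r] : 0 < #|[pred r : 'I_W | h r x == h r (x + d)]|.
    by rewrite lt0n; apply/eqP => E; move: H; rewrite E => /(_ 1); lia.
  rewrite inE => /eqP/hl_window; set q := hq _ _ _ => -[hq0 Eq].
  have hDd : D %| d by rewrite Ed dvdn_mulr // dvd_exp2.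
  have : D %| q.
    rewrite /dvdn (modsub _ _ _ DW Eq) -/(dvdn _ _).
    by apply/eqP; apply/eqP; rewrite -/(D %| _) dvdn_addr // dvdn_mull.
  case/dvdnP => k Ek; have k1 : k = 1 by move: hq0; rewrite Ek; case: k {Ek} => [|[|k]] //; rewrite !mulSn; lia.
  move: Eq; rewrite Ek k1 mul1n => /eqP.
  rewrite -{1}[D]add0n eqn_modDr mod0n eq_sym => hWd.
  have : W %| d.
    rewrite -(@Gauss_dvdr _ (r + r + 1)) //.
    rewrite /W coprimeXl // coprime2n; lia.
  by move/(dvdn_leq d0); rewrite leqNgt dW.
set A := 2 ^ (w - l - t).+1; set B := 2 ^ t.+1; set C := 2 ^ (w - t.+1).
have eD : D + D = 2 ^ t * A by rewrite addnn -mul2n -expnS -expnD; congr (2 ^ _); lia.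
have eW : W = B * C by rewrite -expnD; congr (2 ^ _); lia.
have eAB : A * B = 4 * D.
  by rewrite -expnD (_ : 4 = 2 ^ 2) // -expnD; congr (2 ^ _); lia.
have A0 : 0 < A by rewrite expn_gt0.
have B0 : 0 < B by rewrite expn_gt0.
have C0 : 0 < C by rewrite expn_gt0.
have tW : 2 ^ t %| W by apply: dvd_exp2; lia.
have dvq r : h r x = h r (x + d) -> 2 ^ t %| hq r x d.
  move=> /hl_window[_ Eq]; rewrite /dvdn (modsub _ _ _ tW Eq) -/(dvdn _ _).
  apply/eqP; apply/eqP; rewrite -/(2 ^ t %| _) dvdn_add //.
    by rewrite dvdn_mull // Ed dvdn_mulr.
  by rewrite dvd_exp2 // ltnW.
(* The code of r is its window value divided by 2^t, together with the top t + 1 bits of r. *)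
rewrite -eAB; apply: (@card_le_code _ _ (fun r : 'I_W => hq r x d %/ 2 ^ t * B + r %/ C)).
- move=> r1 r2 /eqP h1 /eqP h2.
  have e1 (r : 'I_W) : r %/ C < B by rewrite ltn_divLR // -eW.
  move/(eq_code (e1 r1) (e1 r2)) => [Eq Er]; apply: val_inj => /=.
  have {}Eq : hq r1 x d = hq r2 x d by rewrite -(divnK (dvq _ h1)) Eq divnK // dvq.
  have [_ H1] := hl_window h1; have [_ H2] := hl_window h2.
  have key (a b : nat) : a <= b -> (a + a + 1) * d + D = (b + b + 1) * d + D %[mod W] -> a = b %[mod C].
    by apply: (mod_cancel odo Ed eW).
  have Em : r1 = r2 %[mod C].
    by case: (leqP r1 r2) => h12; [|symmetry]; apply: key; rewrite -?H1 -?H2 ?Eq // ltnW.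
  by rewrite (divn_eq r1 C) (divn_eq r2 C) Er Em.
- move=> r /eqP hr; have [/andP[_ hq1] _] := hl_window hr.
  have e1 : r %/ C < B by rewrite ltn_divLR // -eW.
  have : hq r x d %/ 2 ^ t < A by rewrite ltn_divLR ?expn_gt0 // mulnC -eD.
  move=> e2; apply: leq_trans (_ : (hq r x d %/ 2 ^ t).+1 * B <= _); first by rewrite mulSn; lia.
  by rewrite leq_mul2r e2 orbT.
Qed.

Lemma letter_bad x y : x < W -> y < W -> x != y ->
  #|[pred r : 'I_W | h r x == h r y]| <= 4 * D.
Proof.
move=> hx hy; case: (ltngtP x y) => // hxy _.
  have := @letter_bad_lt x (y - x); rewrite subnKC; last exact: ltnW.
  by apply; lia.
have := @letter_bad_lt y (x - y); rewrite subnKC; last exact: ltnW.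
move=> H; apply: leq_trans (H _); last lia.
by apply/eq_leq/eq_card => r; rewrite !inE eq_sym.
Qed.
End Letter.

Lemma card_pair (A B : finType) (P : A -> B -> bool) :
  #|[pred x : A * B | P x.1 x.2]| = \sum_(a : A) #|[pred b | P a b]|.
Proof.
rewrite -sum1_card -(pair_big_dep predT (fun a b => P a b) (fun _ _ => 1)) /=.
by apply: eq_bigr => a _; rewrite sum1_card.
Qed.

(** * Roots of the difference polynomial and the error of one copy *)

Section Count.
Variables (p c w l n : nat).
Let W := 2 ^ w.
Let D := 2 ^ (w - l).
(** At most B words share a residue modulo p; this replaces uniformity of the residues, which fails
    since p need not divide W. *)
Let B := (W %/ p).+1.
Hypothesis pp : prime p.
Hypothesis hc : cubic_rootfree p c.
Hypothesis lw : l <= w.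
Hypothesis lp : 2 ^ l <= p.

Notation word3 := ('I_W * 'I_W * 'I_W)%type.
Notation word4 := ('I_W * word3)%type.

Definition odd_word (r : nat) := (r + r + 1) %% W.
Definition red3 (a b d : nat) : tri := (a %% p, b %% p, d %% p).

Definition teqw (T : seq nat) (a b len : nat) (x0 x1 x2 x3 : nat) : bool :=
  teq p c W D (odd_word x0) (red3 x1 x2 x3) T a b len.

Let p0 : 0 < p. Proof. exact: prime_gt0. Qed.

Lemma hl_lt r x : hl W D r x < p.
Proof.
apply: leq_trans lp; rewrite /hl ltn_divLR ?expn_gt0 //.
rewrite -expnD subnKC // ltn_mod expn_gt0 //.
Qed.

(** A nonzero Q has fewer than [size Q] roots, distinct residue triples give distinct points of L,
    and each residue triple comes from at most B^3 word triples. The code of a word triple is the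
    index of its root followed by its three quotients by p. *)
Lemma poly_bad (L : fieldType) (th : L) (Q : {poly L}) :
  (forall a0 a1 a2 b0 b1 b2 : nat,
      [&& a0 < p, a1 < p, a2 < p, b0 < p, b1 < p & b2 < p] ->
      (a0%:R + a1%:R * th + a2%:R * th ^+ 2 = b0%:R + b1%:R * th + b2%:R * th ^+ 2)%R ->
      [/\ a0 = b0, a1 = b1 & a2 = b2]) ->
  (Q != 0)%R ->
  #|[pred g : word3 | root Q (val3 th (red3 g.1.1 g.1.2 g.2))]| <= size Q * B ^ 3.
Proof.
move=> inj Q0; pose V (g : word3) := val3 th (red3 g.1.1 g.1.2 g.2).
pose rs := undup [seq V g | g <- enum [pred g | root Q (V g)]].
have hrs : size rs <= size Q.
  apply: ltnW; apply: max_poly_roots => //; last exact: undup_uniq.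
  by apply/allP => x; rewrite mem_undup => /mapP[g]; rewrite mem_enum => hg ->.
have inrs g : root Q (V g) -> V g \in rs.
  by move=> hg; rewrite mem_undup map_f // mem_enum.
have qB (x : 'I_W) : x %/ p < B by rewrite ltnS leq_div2r // ltnW.
pose f (g : word3) := index (V g) rs * B ^ 3 + ((g.1.1 %/ p * B + g.1.2 %/ p) * B + g.2 %/ p).
have tail (g : word3) : (g.1.1 %/ p * B + g.1.2 %/ p) * B + g.2 %/ p < B ^ 3.
  have h : forall a b N, a < N -> b < B -> a * B + b < N * B.
    move=> a b N h1 h2; apply: leq_trans (_ : a.+1 * B <= _); first by rewrite mulSn; lia.
    by rewrite leq_mul2r h1 orbT.
  by rewrite !expnSr expn0 mul1n; exact: (h _ _ _ (h _ _ _ (qB _) (qB _)) (qB _)).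
apply: leq_trans (_ : size rs * B ^ 3 <= _); last by rewrite leq_mul2r hrs orbT.
apply: (@card_le_code _ _ f).
- move=> g g' hg hg' /(eq_code (tail g) (tail g')) [E1 E2].
  have [E3 E4] := eq_code (qB _) (qB _) E2.
  have [E5 E6] := eq_code (qB _) (qB _) E3.
  have EV : V g = V g' by rewrite -(nth_index 0%R (inrs _ hg)) E1 nth_index // inrs.
  have wfr x y z : wf3 p (red3 x y z) by rewrite /= !ltn_mod p0.
  have := val3_inj inj (wfr _ _ _) (wfr _ _ _) EV.
  case: g {hg E1 E2 EV} E3 E4 E5 E6 => [[a b] d]; case: g' {hg'} => [[a' b'] d'] /= _ E4 E5 E6 [e1 e2 e3].
  congr (_, _, _); apply: val_inj => /=.
  + by rewrite (divn_eq a p) E5 e1 -divn_eq.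
  + by rewrite (divn_eq b p) E6 e2 -divn_eq.
  + by rewrite (divn_eq d p) E4 e3 -divn_eq.
- move=> g hg; rewrite /f; have := tail g; have := inrs g hg; rewrite -index_mem => h1 h2.
  apply: leq_trans (_ : (index (V g) rs).+1 * B ^ 3 <= _); first by rewrite mulSn addnC ltn_add2r.
  by rewrite leq_mul2r h1 orbT.
Qed.

(** Fix a position where the substrings differ. Either the multiplier merges these two letters,
    which happens for at most 4 D multipliers, the evaluation point being free; or the difference
    polynomial is nonzero and the evaluation point is one of its roots. *)
Lemma copy_bad (T : seq nat) a b len :
  all (fun x => x < W) T -> a + len <= size T -> b + len <= size T ->
  take len (drop a T) != take len (drop b T) ->
  #|[pred x : word4 | teqw T a b len x.1 x.2.1.1 x.2.1.2 x.2.2]|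
    <= 4 * D * W ^ 3 + W * (size T * B ^ 3).
Proof.
move=> hT ha hb; set u := take len (drop a T); set v := take len (drop b T) => huv.
have su : size u = len by rewrite size_takel // size_drop; lia.
have sv : size v = len by rewrite size_takel // size_drop; lia.
have [i hi huvi] : exists2 i, i < len & nth 0 u i != nth 0 v i.
  case: (boolP (all (fun i => nth 0 u i == nth 0 v i) (iota 0 len))) => [/allP H|].
    case/eqP: huv; apply: (@eq_from_nth _ 0); first by rewrite su sv.
    by move=> i hi; apply/eqP/H; rewrite mem_iota -su.
  by case/allPn => i; rewrite mem_iota => hi h; exists i.
have uT : nth 0 u i < W.
  have hm : nth 0 u i \in u by rewrite mem_nth ?su.
  exact: (allP hT _ (mem_drop (mem_take hm))).
have vT : nth 0 v i < W.
  have hm : nth 0 v i \in v by rewrite mem_nth ?sv.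
  exact: (allP hT _ (mem_drop (mem_take hm))).
pose coll (r : 'I_W) := hl W D (odd_word r) (nth 0 u i) == hl W D (odd_word r) (nth 0 v i).
rewrite (card_pair (fun (x : 'I_W) (y : word3) => teqw T a b len x y.1.1 y.1.2 y.2)).
have [L [th [pL th3 inj]]] := ext_field pp hc.
have bound (r : 'I_W) : #|[pred y : word3 | teqw T a b len r y.1.1 y.1.2 y.2]| <=
    coll r * W ^ 3 + size T * B ^ 3.
  case: (boolP (coll r)) => hcoll; rewrite ?mul1n ?mul0n.
    apply: leq_trans (leq_addr _ _); apply: leq_trans (max_card _) _.
    by rewrite !card_prod card_ord !expnS expn0 muln1 mulnA.
  have wfr x y z : wf3 p (red3 x y z) by rewrite /= !ltn_mod p0.
  set Q := (hpol W D (odd_word r) L u - hpol W D (odd_word r) L v)%R.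
  have Q0 : (Q != 0)%R.
    apply: (hpol_neq pp inj); first by rewrite su sv.
    + by apply/allP => x _; exact: hl_lt.
    + by apply/allP => x _; exact: hl_lt.
    + apply: contra hcoll => /eqP E; rewrite /coll.
      have := congr1 (fun s => nth 0 s i) E; rewrite !(nth_map 0) ?su ?sv // => ->; exact: eqxx.
  have sQ : size Q <= size T.
    apply: leq_trans (size_polyD _ _) _; rewrite size_polyN geq_max.
    by rewrite !(leq_trans (size_hpol _ _ _ _ _)) // ?su ?sv; lia.
  apply: leq_trans (_ : size Q * B ^ 3 <= _); last by rewrite leq_mul2r sQ orbT.
  apply: leq_trans (poly_bad inj Q0); apply: subset_leq_card; apply/subsetP => y.
  by rewrite !inE /teqw (teq_hpol _ _ _ pp (wfr _ _ _) pL th3 inj).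
apply: leq_trans (leq_sum _ (fun r _ => bound r)) _.
rewrite big_split /= sum_nat_const card_ord leq_add2r -big_distrl /= leq_mul2r.
have -> : \sum_(r : 'I_W) coll r = #|[pred r | coll r]|.
  by rewrite -sum1_card [RHS]big_mkcond; apply: eq_bigr => r _; rewrite inE; case: (coll r).
by rewrite letter_bad ?orbT.
Qed.
End Count.

(* One copy errs with probability at most 2^9 / 2^j, and there are at most
   2^(15(j+1)) triples (position, position, length); 17 copies suffice when
   j >= 169. *)
Definition kappa := 17.

Notation word4 W := ('I_W * ('I_W * 'I_W * 'I_W))%type.

(** * Independent copies and the union bound *)

Section Copies.
Variables (W : nat) (P : nat -> nat -> nat -> nat -> bool).

Definition copyP (t : nat -> nat) (c : nat) : bool :=
  P (t (4 * c)) (t (4 * c + 1)) (t (4 * c + 2)) (t (4 * c + 3)).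

Lemma tape_of_lt (L V : nat) (r : {ffun 'I_L -> 'I_V}) i (h : i < L) : tape_of r i = r (Ordinal h).
Proof. by rewrite /tape_of insubT. Qed.

(** Independence as a product count: a tape splits injectively into its first four words and the
    rest. The probability bound Y / X is carried as an inequality between integers, and the words
    beyond the first 4 k are free. *)
Lemma copies_bad k L X Y : 4 * k <= L ->
  #|[pred x : word4 W | P x.1 x.2.1.1 x.2.1.2 x.2.2]| * X <= Y * W ^ 4 ->
  #|[pred r : {ffun 'I_L -> 'I_W} | all (copyP (tape_of r)) (iota 0 k)]| * X ^ k <= Y ^ k * W ^ L.
Proof.
move=> hkL hP; elim: k L hkL => [|k IH] L hkL.
  rewrite !expn0 muln1 mul1n; apply: leq_trans (max_card _) _.
  by rewrite card_ffun !card_ord.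
have [L' EL] : exists L', L = 4 + L' by exists (L - 4); rewrite mulnS in hkL; lia.
subst L.
have hL' : 4 * k <= L' by rewrite mulnS in hkL; lia.
have {}IH := IH L' hL'.
pose sh (r : {ffun 'I_(4 + L') -> 'I_W}) : {ffun 'I_L' -> 'I_W} := [ffun i => r (rshift 4 i)].
pose hd (r : {ffun 'I_(4 + L') -> 'I_W}) : word4 W :=
  let g i := r (lshift L' (inord i : 'I_4)) in (g 0, (g 1, g 2, g 3)).
have hdE (r : {ffun 'I_(4 + L') -> 'I_W}) i : i < 4 -> tape_of r i = r (lshift L' (inord i)) :> nat.
  move=> hi; have h : i < 4 + L' by lia.
  by rewrite (tape_of_lt r h); congr (val (r _)); apply: val_inj; rewrite /= inordK.
have shE (r : {ffun 'I_(4 + L') -> 'I_W}) i : tape_of (sh r) i = tape_of r (4 + i).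
  case: (ltnP i L') => hi.
    have h : 4 + i < 4 + L' by lia.
    rewrite (tape_of_lt (sh r) hi) (tape_of_lt r h) ffunE; congr (val (r _)); exact: val_inj.
  by rewrite /tape_of !insubF //; apply/negbTE; rewrite -leqNgt //; lia.
set S1 := [pred x : word4 W | _] in hP.
set S2 := [pred r | all (copyP (tape_of r)) (iota 0 k)] in IH.
set S := [pred r | _].
have inj : injective (fun r => (hd r, sh r)).
  move=> r r' [E0 E1 E2 E3 E4]; apply/ffunP => i.
  case: (split_ordP i) => j ->; last by move/ffunP: E4 => /(_ j); rewrite !ffunE.
  have -> : j = inord j by apply: val_inj; rewrite /= inordK.
  by case: j => [[|[|[|[|j]]]] hj].
have : #|S| <= #|[pred x : word4 W * {ffun 'I_L' -> 'I_W} | S1 x.1 && S2 x.2]|.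
  rewrite -(card_image inj); apply: subset_leq_card; apply/subsetP => y /imageP[r hr ->].
  move: hr; rewrite !inE /= => /andP[h0 h1]; apply/andP; split.
    by move: h0; rewrite /copyP muln0 !add0n !hdE.
  rewrite (iotaDl 1 0 k : iota 1 k = _) all_map in h1.
  apply: sub_all h1 => c /=; rewrite /copyP !shE.
  by rewrite mulnDr muln1 !addnA.
have -> : #|[pred x : word4 W * {ffun 'I_L' -> 'I_W} | S1 x.1 && S2 x.2]| = #|S1| * #|S2|.
  rewrite -[RHS](@cardX _ _ S1 S2); apply: eq_card => x; by rewrite !inE.
move=> hS; rewrite (expnS X) (expnS Y) (expnD W 4).
apply: leq_trans (_ : (#|S1| * X) * (#|S2| * X ^ k) <= _).
  by rewrite mulnACA leq_mul2r hS orbT.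
apply: leq_trans (leq_mul hP IH) _.
by rewrite mulnACA.
Qed.
End Copies.

Section Prob.
Variables (p c w j : nat) (T : seq nat).
Let n := size T.
Let W := 2 ^ w.
Let D := 2 ^ (w - 2 * j).
Hypothesis pp : prime p.
Hypothesis hc : cubic_rootfree p c.
Hypothesis nW : n < W.
Hypothesis Mp : 4 ^ j <= p.
Hypothesis p2 : p * p <= 32 ^ j.
Hypothesis jn : 32 ^ j <= n.
Hypothesis nj : n < 32 ^ j.+1.
Hypothesis TW : all (fun x => x < W) T.

Let M22 : 4 ^ j = 2 ^ (2 * j). Proof. by rewrite (expnM 2 2 j). Qed.

Lemma lw2 : 2 * j <= w.
Proof.
have h : 4 ^ j < W.
  apply: leq_ltn_trans nW; apply: leq_trans jn.
  have -> : 32 ^ j = 4 ^ j * 8 ^ j by rewrite -expnMn.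
  by rewrite leq_pmulr // expn_gt0.
by move: h; rewrite M22 /W ltn_exp2l // => /ltnW.
Qed.

Lemma copy_bad_num a b len : a + len <= n -> b + len <= n ->
  take len (drop a T) != take len (drop b T) ->
  #|[pred x : word4 W | teqw p c w (2 * j) T a b len x.1 x.2.1.1 x.2.1.2 x.2.2]| * 2 ^ j
    <= 2 ^ 9 * W ^ 4.
Proof.
move=> ha hb hne.
have lp : 2 ^ (2 * j) <= p by rewrite -M22.
apply: leq_trans (_ : (4 * D * W ^ 3 + W * (n * (W %/ p).+1 ^ 3)) * 2 ^ j <= _).
  by rewrite leq_mul2r (copy_bad pp hc lw2 lp TW ha hb hne) orbT.
have p0 : 0 < p by rewrite prime_gt0.
have hD : D * 4 ^ j = W by rewrite M22 /D -expnD subnK // lw2.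
have h24 : 2 ^ j <= 4 ^ j by case: (j) => // k; rewrite leq_exp2r.
have e1 : 4 * D * W ^ 3 * 2 ^ j <= 4 * W ^ 4.
  apply: leq_trans (_ : 4 * D * W ^ 3 * 4 ^ j <= _); first by rewrite leq_mul2l h24 orbT.
  by rewrite (expnS W 3) -{2}hD; move: (W ^ 3) (4 ^ j) => V X; lia.
have pW : p <= W.
  apply: leq_trans (ltnW nW); apply: leq_trans jn; apply: leq_trans p2; exact: leq_pmulr.
have hB : (W %/ p).+1 * p <= 2 * W.
  by rewrite mulSn mul2n -addnn leq_add // leq_trunc_div.
(* The factor 256 is 32 * 8: n <= 32 * 32^j, and ((W / p + 1) p)^3 <= 8 W^3 while p^3 >= 64^j = 2^j
   * 32^j. Together with the 4 from the letters this stays below 2^9. *)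
have e2 : W * (n * (W %/ p).+1 ^ 3) * 2 ^ j <= 256 * W ^ 4.
  set B := (W %/ p).+1 in hB *.
  have h64 : 2 ^ j * 32 ^ j <= p ^ 3.
    by rewrite -expnMn (_ : 2 * 32 = 4 ^ 3) // -expnM mulnC expnM leq_exp2r.
  have hn : n <= 32 * 32 ^ j by rewrite -expnS ltnW.
  have x0 : 0 < 32 ^ j by rewrite expn_gt0.
  rewrite -(leq_pmul2r x0) -(mulnA _ (2 ^ j)) -(mulnA W) -(mulnA n).
  apply: leq_trans (_ : W * (32 * 32 ^ j * (B ^ 3 * p ^ 3)) <= _).
    by rewrite leq_mul2l; apply/orP; right; apply: (leq_mul hn); rewrite leq_mul2l h64 orbT.
  rewrite -expnMn.
  apply: leq_trans (_ : W * (32 * 32 ^ j * (2 * W) ^ 3) <= _).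
    by rewrite !leq_mul2l leq_exp2r // hB !orbT.
  rewrite expnMn (expnS W 3) (_ : 2 ^ 3 = 8) //; move: (W ^ 3) (32 ^ j) => u v; lia.
rewrite mulnDl; apply: leq_trans (leq_add e1 e2) _.
by rewrite -mulnDl leq_mul2r orbC.
Qed.

Variable L : nat.
Hypothesis kL : 4 * kappa <= L.

Definition copies_eq (t : nat -> nat) (a b len : nat) : bool :=
  all (copyP (teqw p c w (2 * j) T a b len) t) (iota 0 kappa).

(** Only false positives are excluded, since equal substrings pass every copy on any tape
    ([teq_same]). Quantifying over ordinals makes the property boolean, so that bad tapes can be
    counted. *)
Definition good_tape (t : nat -> nat) : bool :=
  [forall a : 'I_n, forall b : 'I_n, forall len : 'I_n.+1,
     (a + len <= n) && (b + len <= n) ==> copies_eq t a b len ==>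
     (take len (drop a T) == take len (drop b T))].

Lemma bad_tapes : 169 <= j ->
  #|[pred r : {ffun 'I_L -> 'I_W} | ~~ good_tape (tape_of r)]| * 2 ^ j.+1 <= W ^ L.
Proof.
move=> hj.
pose bad (x : 'I_n * 'I_n * 'I_n.+1) := [pred r : {ffun 'I_L -> 'I_W} |
   [&& x.1.1 + x.2 <= n, x.1.2 + x.2 <= n,
    take x.2 (drop x.1.1 T) != take x.2 (drop x.1.2 T) & copies_eq (tape_of r) x.1.1 x.1.2 x.2]].
have h1 : #|[pred r : {ffun 'I_L -> 'I_W} | ~~ good_tape (tape_of r)]| <= \sum_x #|bad x|.
  pose lhs := [pred r : {ffun 'I_L -> 'I_W} | [exists x, bad x r]].
  apply: leq_trans (_ : #|lhs| <= _).
    apply: subset_leq_card; apply/subsetP => r; rewrite !inE.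
    case/forallPn => a /forallPn[b /forallPn[len]]; rewrite !negb_imply.
    case/and3P => /andP[h1 h2] h3 h4; apply/existsP; exists (a, b, len) => /=.
    by rewrite h1 h2 h4.
  have -> : \sum_x #|bad x| = \sum_x \sum_r (bad x r : nat).
    apply: eq_bigr => x _; rewrite -sum1_card big_mkcond; apply: eq_bigr => r _.
    by rewrite (_ : (r \in bad x) = bad x r) //; case: (bad x r : bool).
  rewrite exchange_big /= -sum1_card big_mkcond; apply: leq_sum => r _.
  rewrite inE; case: existsP => // -[x hx].
  by rewrite (bigD1 x) //; move: hx; rewrite /= => ->.
have h2 x : #|bad x| * 2 ^ (17 * j) <= 2 ^ 153 * W ^ L.
  case: (boolP [&& x.1.1 + x.2 <= n, x.1.2 + x.2 <= n &
    take x.2 (drop x.1.1 T) != take x.2 (drop x.1.2 T)]) => hx; last first.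
    rewrite (_ : #|bad x| = 0) //; apply: eq_card0 => r; rewrite !inE.
    by apply: contraNF hx => /and4P[-> -> ->].
  case/and3P: hx => hx1 hx2 hx3.
  have := copies_bad kL (copy_bad_num hx1 hx2 hx3).
  rewrite -!expnM [j * _]mulnC; apply: leq_trans; rewrite leq_mul2r; apply/orP; right.
  by apply: subset_leq_card; apply/subsetP => r; rewrite !inE => /and4P[].
have h3 : (\sum_x #|bad x|) * 2 ^ (17 * j) <= 2 ^ (15 * j.+1) * (2 ^ 153 * W ^ L).
  rewrite big_distrl /=; apply: leq_trans (leq_sum _ (fun x _ => h2 x)) _.
  rewrite sum_nat_const leq_mul2r; apply/orP; right.
  rewrite !card_prod !card_ord (_ : 15 * j.+1 = 5 * j.+1 * 3); last lia.
  have hn : n.+1 <= 2 ^ (5 * j.+1) by rewrite (expnM 2 5).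
  rewrite (expnM 2 (5 * j.+1) 3); move: (2 ^ (5 * j.+1)) hn => Z hn.
  rewrite !expnS expn0 muln1 mulnA.
  by apply: leq_mul => //; apply: leq_mul; apply: ltnW.
have h4 := leq_trans (leq_mul h1 (leqnn (2 ^ (17 * j)))) h3.
have x0 : 0 < 2 ^ (15 * j.+1 + 153) by rewrite expn_gt0.
rewrite -(leq_pmul2r x0) -mulnA -expnD.
(* The exponent is 15 (j + 1) for the triples, 153 = 9 * 17 for the copies, and j + 1 for the bound
   to be reached: 16 j + 169 <= 17 j is the origin of 169. *)
have h5 : 2 ^ (j.+1 + (15 * j.+1 + 153)) <= 2 ^ (17 * j) by rewrite leq_exp2l //; lia.
apply: leq_trans (leq_mul (leqnn _) h5) _.
by apply: leq_trans h4 _; rewrite expnD mulnA mulnC.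
Qed.

(** The fifth power turns 2^-(j+1) into 32^-(j+1), which is below 1/n; the failure probability is
    thus at most n^(-1/5). *)
Lemma bad_tapes_final : 169 <= j ->
  #|[pred r : {ffun 'I_L -> 'I_W} | ~~ good_tape (tape_of r)]| ^ 5 * n ^ 1 <= (W ^ L) ^ 5.
Proof.
move=> hj; have h := bad_tapes hj.
apply: leq_trans (_ : (#|[pred r : {ffun 'I_L -> 'I_W} | ~~ good_tape (tape_of r)]| * 2 ^ j.+1) ^ 5 <= _).
  by rewrite expnMn leq_mul2l expn1 -expnM mulnC (expnM 2 5) (ltnW nj) orbT.
by rewrite leq_exp2r.
Qed.
End Prob.

Lemma teq_same p c W D r g T a b l : prime p -> cubic_rootfree p c -> wf3 p g ->
  a + l <= size T -> b + l <= size T -> take l (drop a T) = take l (drop b T) ->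
  teq p c W D r g T a b l.
Proof.
move=> pp hc hg ha hb E; have [L [th [h1 h2 h3]]] := ext_field pp hc.
by rewrite (teq_hpol _ _ _ pp hg h1 h2 h3 ha hb) E subrr horner0.
Qed.

(** * Heaps and heapsort in rounds *)

Section Sift.
Variable lt : rel nat.

Definition child (sz : nat) (h : nat -> nat) (i : nat) : nat :=
  if (i + i + 2 < sz) && lt (h (i + i + 1)) (h (i + i + 2)) then i + i + 2 else i + i + 1.

(** The value x travels with the hole i and is written once, at the end; k bounds the depth of the
    descent. The relation is arbitrary because on a bad tape the comparison need not be an order. *)
Fixpoint sift (sz k : nat) (h : nat -> nat) (i x : nat) : nat -> nat :=
  if k is k'.+1 then
    if i + i + 1 < sz then
      let c' := child sz h i in
      if lt x (h c') then sift sz k' (upd h i (h c')) c' x else upd h i x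
    else upd h i x
  else upd h i x.

End Sift.

Lemma updE f a v x : upd f a v x = if x == a then v else f x. Proof. by []. Qed.
Lemma upd_eq f a v : upd f a v a = v. Proof. by rewrite /upd eqxx. Qed.

Lemma eq_mkseq_in (A : Type) (f g : nat -> A) n : (forall i, i < n -> f i = g i) -> mkseq f n = mkseq g n.
Proof. by move=> H; apply/eq_in_map => i; rewrite mem_iota => /andP[_ h]; exact: H. Qed.

(** Moving a child into the hole and the hole to the child exchanges two cells of the array in which
    the hole is filled by x. This is the invariant behind [sift_perm]. *)
Lemma mkseq_swap (h : nat -> nat) sz i c x :
  i < sz -> c < sz -> i != c ->
  perm_eq (mkseq (upd (upd h i (h c)) c x) sz) (mkseq (upd h i x) sz).
Proof.
move=> hi hc hic.
pose sw j := if j == i then c else if j == c then i else j.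
have E : mkseq (upd (upd h i (h c)) c x) sz = map (upd h i x) (map sw (iota 0 sz)).
  rewrite -map_comp; apply: eq_map => j /=; rewrite /upd /sw.
  have hci : (c == i) = false by rewrite eq_sym (negPf hic).
  case: (j =P i) => [->|/eqP/negPf hji]; first by rewrite (negPf hic) hci.
  by case: (j =P c) => _; rewrite ?eqxx ?hji.
rewrite E; apply: perm_map; apply: uniq_perm.
- rewrite map_inj_in_uniq ?iota_uniq // => a b _ _; rewrite /sw.
  by do 4?case: eqP; move=> *; subst => //; try lia.
- exact: iota_uniq.
- move=> j; apply/mapP/idP => [[a]|hj].
    by rewrite !mem_iota /sw => ha ->; do 2?case: eqP => _; lia.
  move: hj; rewrite mem_iota => hj; exists (sw j); rewrite /sw.
    by rewrite mem_iota; do 2?case: eqP => _; lia.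
  case: (j =P i) => [->|h1]; first by rewrite eqxx eq_sym (negPf hic).
  case: (j =P c) => [->|h2]; first by rewrite eqxx.
  by case: eqP => // ?; case: eqP.
Qed.

Definition par (j : nat) := j.-1 %/ 2.

Definition heap (le : rel nat) (sz : nat) (h : nat -> nat) : Prop :=
  forall j, 0 < j < sz -> le (h j) (h (par j)).

Section SiftP.
Variable le : rel nat.
Hypothesis le_total : total le.
Hypothesis le_trans : transitive le.
Let lt x y := ~~ le y x.

Let lt_le x y : lt x y -> le x y.
Proof. by rewrite /lt => h; have := le_total x y; rewrite (negPf h) orbF. Qed.

Lemma sift_perm l sz k h i x : i < sz -> perm_eq (mkseq (sift l sz k h i x) sz) (mkseq (upd h i x) sz).
Proof.
elim: k h i => [|k IH] h i hi //=.
case: ifP => // hc; set c' := child _ _ _ _.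
have hc' : c' < sz by rewrite /c' /child; case: ifP => // /andP[].
have hne : i != c' by rewrite /c' /child; case: ifP; lia.
case: ifP => // _.
apply: perm_trans (IH _ _ hc') _.
exact: mkseq_swap.
Qed.

Lemma sift_id l sz k h i x j : i < sz -> sz <= j -> sift l sz k h i x j = h j.
Proof.
elim: k h i => [|k IH] h i hi hj //=; have hji : (j == i) = false by lia.
  by rewrite /upd hji.
case: ifP => [hc|_]; last by rewrite /upd hji.
set c' := child _ _ _ _.
have hc' : c' < sz by rewrite /c' /child; case: ifP => // /andP[].
by case: ifP => _; rewrite ?IH // /upd hji.
Qed.

(** The heap condition may fail only around the hole i; if i has a parent, both x and the children
    of i are bounded by it, so either can fill the hole. The condition sz < (i + 1) 2^(k+1) survives
    a descent, as the index of a child plus one is at least 2 (i + 1), and for k = 0 it says that i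
    has no child. *)
Lemma sift_heap_gen sz k h i x :
  sz < i.+1 * 2 ^ k.+1 -> i < sz ->
  (forall j, 0 < j < sz -> par j != i -> j != i -> le (h j) (h (par j))) ->
  (0 < i -> le x (h (par i)) /\ forall j, 0 < j < sz -> par j = i -> le (h j) (h (par i))) ->
  heap le sz (sift lt sz k h i x).
Proof.
elim: k h i => [|k IH] h i hk hi H1 H2.
  move=> j hj; rewrite /= /upd.
  have hpj : (par j == i) = false by apply/eqP; rewrite /par; rewrite expn1 in hk; lia.
  rewrite hpj; case: (j =P i) => [ji|/eqP ji]; last by apply: H1; rewrite ?hpj.
  by rewrite ji; have [|? _] := H2 _; first lia.
rewrite /=; case: ifP => [hc|hc]; last first.
  move=> j hj; rewrite /= /upd.
  have hpj : (par j == i) = false by apply/eqP; rewrite /par; lia.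
  rewrite hpj; case: (j =P i) => [ji|/eqP ji]; last by apply: H1; rewrite ?hpj.
  by rewrite ji; have [|? _] := H2 _; first lia.
set c' := child _ _ _ _.
have hc' : c' < sz by rewrite /c' /child; case: ifP => // /andP[].
have hne : i != c' by rewrite /c' /child; case: ifP; lia.
have hp' : par c' = i by rewrite /c' /child /par; case: ifP; lia.
have hcc : i + i + 1 <= c' by rewrite /c' /child; case: ifP; lia.
have le_refl y : le y y by have := le_total y y; rewrite orbb.
have hmax j : 0 < j < sz -> par j = i -> le (h j) (h c').
  move=> hj hpj; have [E|E] : j = i + i + 1 \/ j = i + i + 2 by move: hpj hj; rewrite /par; lia.
    by rewrite /c' /child E; case: ifP => // /andP[_ a]; exact: lt_le.
  have hs : i + i + 2 < sz by lia.
  by rewrite /c' /child E hs /=; case: ifP => // /negbFE.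
case: ifP => hx; last first.
  move/negbFE: hx => hx j hj; rewrite /upd.
  case: (j =P i) => [->|/eqP ji].
    case: eqP => // hpi; have [|? _] := H2 _; last by [].
    by case: (posnP i) hpi => // ->; rewrite /par div0n.
  case: (par j =P i) => [E|/eqP hp]; last exact: H1.
  exact: le_trans (hmax _ hj E) hx.
apply: IH => //.
- apply: leq_trans hk _; rewrite (expnS 2 k.+1) mulnCA mulnA leq_mul2r; lia.
- move=> j hj hpj hjc; rewrite /upd.
  case: (j =P i) => [ji|/eqP ji].
    have -> : (par j == i) = false by apply/eqP; rewrite ji /par; lia.
    have [|? Hch] := H2 _; first lia.
    by rewrite ji; apply: Hch => //; lia.
  case: (par j =P i) => [E|/eqP hp]; last exact: H1.
  exact: hmax.
- move=> _; rewrite hp' upd_eq; split; first exact: lt_le.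
  move=> j hj hpj; rewrite /upd.
  have -> : (j == i) = false by apply/eqP; move: hpj hcc; rewrite /par; lia.
  rewrite -hpj; apply: H1 => //; rewrite ?hpj; apply/eqP => E.
    by move: hne; rewrite E eqxx.
  by move: hpj hcc; rewrite E /par; lia.
Qed.

Lemma sift_heap sz k h x : sz < 2 ^ k.+1 -> 0 < sz -> heap le sz h ->
  heap le sz (sift lt sz k h 0 x).
Proof. by move=> hk h0 hh; apply: sift_heap_gen => //; rewrite ?mul1n // => j hj _ _; exact: hh. Qed.

Lemma heap_max sz h j : heap le sz h -> j < sz -> le (h j) (h 0).
Proof.
move=> hh; elim/ltn_ind: j => j IH hj.
case: (posnP j) => [->|j0]; first by have := le_total (h 0) (h 0); rewrite orbb.
have hp : par j < j by rewrite /par; lia.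
apply: le_trans (IH _ hp _); last lia.
by apply: hh; rewrite j0.
Qed.

End SiftP.

Lemma mkseq_add (A : Type) (f : nat -> A) a b : mkseq f (a + b) = mkseq f a ++ mkseq (fun i => f (a + i)) b.
Proof.
rewrite /mkseq iotaD map_cat add0n; congr cat.
by rewrite -[a in iota a b]addn0 iotaDl -map_comp.
Qed.

Section Sort.
Variable lt : rel nat.
Variables (m k : nat).

Fixpoint hsort (sz : nat) (h : nat -> nat) : nat -> nat :=
  if sz is s.+1 then hsort s (upd (sift lt s k h 0 (h s)) s (h 0)) else h.

(** A max-heap keeps the m smallest candidates, 0 standing for +oo in cells not yet filled.
    Candidates are the values beyond [last], the latest one output; [last = 0] means that nothing
    has been output. *)
Definition sel (last : nat) (h : nat -> nat) (x : nat) : nat -> nat :=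
  if ((last == 0) || lt last x) && lt x (h 0) then sift lt m k h 0 x else h.

Definition round (I : seq nat) (s : nat * seq nat) : nat * seq nat :=
  let h := hsort m (foldl (sel s.1) (fun=> 0) I) in
  let o := [seq x <- mkseq h m | x != 0] in
  (last s.1 o, s.2 ++ o).
End Sort.

Section SortP.
Variable le : rel nat.
Hypothesis le_total : total le.
Hypothesis le_trans : transitive le.
Hypothesis le_anti : antisymmetric le.
Hypothesis le0 : forall x, le x 0.
Let lt x y := ~~ le y x.
Variables (m k : nat).
Hypothesis m0 : 0 < m.
Hypothesis hk : m < 2 ^ k.+1.

Let lt_le x y : lt x y -> le x y.
Proof. by rewrite /lt => h; have := le_total x y; rewrite (negPf h) orbF. Qed.
Let le_refl x : le x x. Proof. by have := le_total x x; rewrite orbb. Qed.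

Lemma sift_perm_all s h : s < m ->
  perm_eq (mkseq (upd (sift lt s k h 0 (h s)) s (h 0)) m) (mkseq h m).
Proof.
move=> hs; rewrite -(subnKC hs) !mkseq_add; apply: perm_cat; last first.
  rewrite (_ : mkseq _ _ = mkseq (fun i => h (s.+1 + i)) (m - s.+1)) //.
  apply: eq_mkseq_in => i _; rewrite /upd.
  have -> : (s.+1 + i == s) = false by lia.
  case: (posnP s) => [->|s0]; first by case: (k) => //= k'; rewrite /upd.
  rewrite sift_id //; lia.
case: (posnP s) => [->|s0]; first by rewrite /mkseq /= upd_eq.
have hi : perm_eq (mkseq (upd (upd h 0 (h s)) s (h 0)) s.+1) (mkseq (upd h 0 (h 0)) s.+1).
  by apply: mkseq_swap => //; lia.
rewrite (_ : mkseq (upd h 0 (h 0)) s.+1 = mkseq h s.+1) in hi; last first.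
  by apply: eq_mkseq_in => i _; rewrite /upd; case: eqP => // ->.
apply: perm_trans hi; rewrite !mkseqS !upd_eq -!cats1; apply: perm_cat => //.
rewrite (_ : mkseq _ s = mkseq (sift lt s k h 0 (h s)) s); last first.
  by apply: eq_mkseq_in => i hi; rewrite /upd; case: eqP => //; lia.
rewrite (_ : mkseq (upd (upd _ _ _) _ _) s = mkseq (upd h 0 (h s)) s); last first.
  by apply: eq_mkseq_in => i hi; rewrite updE; case: eqP => //; lia.
exact: sift_perm.
Qed.

Lemma hsort_spec sz h : sz <= m -> heap le sz h ->
  (forall i j, i < sz -> sz <= j < m -> le (h i) (h j)) ->
  (forall j, sz <= j -> j.+1 < m -> le (h j) (h j.+1)) ->
  sorted le (mkseq (hsort lt k sz h) m) /\ perm_eq (mkseq (hsort lt k sz h) m) (mkseq h m).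
Proof.
elim: sz h => [|s IH] h hs hh H1 H2 /=.
  split=> //; apply/(sortedP 0) => i; rewrite size_mkseq => hi.
  by rewrite !nth_mkseq ?H2 //; lia.
set h' := upd _ _ _.
have hperm := sift_perm_all h hs; rewrite -/h' in hperm.
have hlow i : i < s -> exists2 j, j <= s & h' i = h j.
  move=> hi; have s0 : 0 < s by lia.
  have : h' i \in mkseq (upd h 0 (h s)) s.
    rewrite -(perm_mem (sift_perm lt k h (h s) s0)); apply/mapP; exists i; rewrite ?mem_iota //.
    by rewrite /h' updE; case: eqP => //; lia.
  case/mapP => j; rewrite mem_iota => hj ->; rewrite /upd; case: eqP => _.
    by exists s.
  by exists j => //; lia.
have hhigh j : s < j -> h' j = h j.
  move=> hj; rewrite /h' updE; case: eqP => [|_]; first lia.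
  case: (posnP s) => [->|s0]; first by case: (k) => [|k'] /=; rewrite /upd; case: eqP => //; lia.
  by rewrite sift_id //; lia.
have h's : h' s = h 0 by rewrite /h' upd_eq.
have [|||| a b] := IH h'.
- lia.
- case: (posnP s) => [->|s0]; first by move=> j; lia.
  have : heap le s (sift lt s k h 0 (h s)).
    apply: sift_heap => //; first lia.
    by move=> j hj; apply: hh; lia.
  move=> H j hj; rewrite /h' !updE.
  have -> : (j == s) = false by lia.
  have -> : (par j == s) = false by apply/eqP; rewrite /par; lia.
  exact: H.
- move=> i j hi hj; have [l hl ->] := hlow i hi.
  case: (ltngtP s j) hj => [hsj|hsj|<-] hj; [|lia|].
  + by rewrite hhigh //; apply: H1; lia.
  + by rewrite h's; apply: heap_max hh _ => //; lia.
- move=> j hj hjm; rewrite (hhigh j.+1 hj).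
  case: (ltngtP s j) hj hjm => [hsj|hsj|<-] hj hjm; [|lia|].
  + by rewrite hhigh // H2.
  + by rewrite h's; apply: H1; lia.
by split=> //; apply: perm_trans b _.
Qed.

Lemma selE l h x : sel lt m k l h x =
  if ((l == 0) || lt l x) && lt x (h 0) then sift lt m k h 0 x else h.
Proof. by []. Qed.

(** [R] is a ghost list of the refused or evicted candidates and evicted zeros. Heap and [R]
    together stay a permutation of the candidates seen and the m initial zeros, and every kept value
    is below everything in [R]. *)
Lemma foldl_sel l I A h R :
  heap le m h -> perm_eq (mkseq h m ++ R) (A ++ nseq m 0) ->
  (forall x y, x \in mkseq h m -> y \in R -> le x y) ->
  exists h' R', [/\ foldl (sel lt m k l) h I = h', heap le m h',
    perm_eq (mkseq h' m ++ R') ((A ++ [seq x <- I | (l == 0) || lt l x]) ++ nseq m 0) &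
    forall x y, x \in mkseq h' m -> y \in R' -> le x y].
Proof.
elim: I A h R => [|x I IH] A h R H1 H2 H3; first by exists h, R; rewrite /= cats0.
rewrite /= selE; case: (boolP ((l == 0) || lt l x)) => hl /=; last exact: (IH A h R).
have hmax y : y \in mkseq h m -> le y (h 0).
  by case/mapP=> j; rewrite mem_iota => hj ->; apply: heap_max H1 _ => //; lia.
have hm0 : h 0 \in mkseq h m by apply/mapP; exists 0; rewrite ?mem_iota.
rewrite -cat_rcons; case: ifP => hx.
- have hp := sift_perm lt k h x m0.
  apply: (IH _ _ (h 0 :: R)).
  + exact: sift_heap.
  + have e1 : mkseq (upd h 0 x) m = x :: behead (mkseq h m).
      by case: (m) m0 => // m' _; rewrite /mkseq /= upd_eq; congr cons; apply/eq_in_map => i; rewrite mem_iota /upd; case: eqP => //; lia.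
    have e2 : mkseq h m = h 0 :: behead (mkseq h m) by case: (m) m0.
    have e3 : perm_eq (mkseq (sift lt m k h 0 x) m ++ h 0 :: R) (x :: (mkseq h m ++ R)).
      apply: perm_trans (perm_cat hp (perm_refl _)) _.
      move: (behead _) e1 e2 => B -> ->.
      by rewrite /= perm_cons -(cat1s (h 0) R) perm_catCA.
    apply: perm_trans e3 _; rewrite -(cat1s x (mkseq h m ++ R)) cat_rcons perm_sym.
    by rewrite -(cat1s x (nseq m 0)) perm_catCA perm_cat2l perm_sym.
  + move=> y z; rewrite (perm_mem hp) => /mapP[j]; rewrite mem_iota => hj ->.
    have hz0 : z \in R -> le (h 0) z by apply: H3.
    have lex : le (upd h 0 x j) (h 0).
      rewrite /upd; case: eqP => _; first exact: lt_le.
      by apply: hmax; apply/mapP; exists j; rewrite ?mem_iota.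
    by rewrite inE => /orP[/eqP-> //|/hz0]; exact: le_trans.
- apply: (IH _ _ (x :: R)) => //.
  + rewrite cat_rcons -(cat1s x R) perm_catCA perm_sym -(cat1s x (nseq m 0)) perm_catCA.
    by rewrite perm_cat2l perm_sym.
  + move=> y z hy; rewrite inE => /orP[/eqP->|]; last exact: H3.
    by apply: le_trans (hmax _ hy) _; move/negbFE: hx.
Qed.

(** The sorted heap followed by the sorted ghost list is a sorted rearrangement of the candidates
    and m zeros, so by uniqueness of sorting the heap holds the first m entries. Dropping the zeros
    leaves the m smallest candidates, or all of them if there are fewer. *)
Lemma round_spec (I : seq nat) l o : 0 \notin I ->
  let S := sort le [seq x <- I | (l == 0) || lt l x] in
  round lt m k I (l, o) = (last l (take m S), o ++ take m S).
Proof.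
move=> hI S; rewrite /round /=.
have [||| h [R [-> H1 H2 H3]]] := @foldl_sel l I [::] (fun=> 0) [::].
- by move=> j _.
- rewrite cats0 /=; have -> // : mkseq (fun=> 0) m = nseq m 0.
  by apply: (@eq_from_nth _ 0); rewrite ?size_mkseq ?size_nseq // => i hi; rewrite nth_mkseq // nth_nseq hi.
- by [].
have [||h1 h2] := @hsort_spec m h (leqnn m) H1; try by move=> *; lia.
set M := mkseq (hsort lt k m h) m in h1 h2 *.
set F := [seq x <- I | _] in H2 S *.
have hM : M = take m (S ++ nseq m 0).
  have e : M ++ sort le R = S ++ nseq m 0.
    apply: (sorted_eq le_trans le_anti).
    - have sR := sort_sorted le_total R.
      have : pairwise le (M ++ sort le R).
        rewrite pairwise_cat -!(sorted_pairwise le_trans) h1 sR !andbT.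
        apply/allrelP => x y; rewrite mem_sort (perm_mem h2); exact: H3.
      by rewrite -(sorted_pairwise le_trans).
    - have sS := sort_sorted le_total F.
      rewrite (sorted_pairwise le_trans) pairwise_cat -!(sorted_pairwise le_trans) sS /=.
      apply/andP; split; first by apply/allrelP => x y _; rewrite mem_nseq => /andP[_ /eqP->].
      by apply/(sortedP 0) => i; rewrite size_nseq => hi; rewrite !nth_nseq; do 2 case: ifP => _.
    - apply: perm_trans (_ : perm_eq (mkseq h m ++ R) _); first by rewrite perm_cat // perm_sort.
      by apply: perm_trans H2 _; rewrite perm_cat2r perm_sym perm_sort.
  by rewrite -e take_size_cat // size_mkseq.
have hF : all (fun x => x != 0) S.
  rewrite all_sort; apply/allP => x; rewrite mem_filter => /andP[_ hx].
  by apply: contra hI => /eqP <-.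
suff -> : [seq x <- M | x != 0] = take m S by [].
rewrite hM take_cat; case: ltnP => hm.
  by apply/all_filterP; move: hF; rewrite -{1}(cat_take_drop m S) all_cat => /andP[].
rewrite filter_cat (all_filterP hF) (@take_oversize _ m S) // -[RHS]cats0; congr cat.
apply/eqP; rewrite -[X in is_true X]negbK -has_filter; apply/hasPn => x /mem_take.
by rewrite mem_nseq => /andP[_ /eqP->].
Qed.

Lemma rounds_spec (I : seq nat) r : uniq I -> 0 \notin I ->
  let S := sort le I in
  iter r (round lt m k I) (0, [::]) = (last 0 (take (r * m) S), take (r * m) S).
Proof.
move=> uI hI S; elim: r => [|r IH]; first by rewrite mul0n take0.
rewrite iterS IH round_spec //.
set o := take (r * m) S.
have sS : sorted le S by exact: sort_sorted.
(* As [I] has no repetition, the indices strictly beyond the last one output are exactly those not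
   output so far. *)
have -> : sort le [seq x <- I | (last 0 o == 0) || lt (last 0 o) x] = drop (r * m) S.
  have pS : pairwise le (o ++ drop (r * m) S) by rewrite cat_take_drop -(sorted_pairwise le_trans).
  have uS : uniq (o ++ drop (r * m) S) by rewrite cat_take_drop sort_uniq.
  have h0 : 0 \notin S by rewrite mem_sort.
  rewrite -(filter_sort le_total le_trans).
  rewrite (_ : sort le I = o ++ drop (r * m) S); last by rewrite cat_take_drop.
  have h0o : 0 \notin o by apply: contra h0 => /mem_take.
  case: (lastP o) h0o pS uS => [|o' l] h0o pS uS; first by rewrite /= filter_predT.
  have l0 : (l == 0) = false by apply: contraNF h0o => /eqP ->; rewrite mem_rcons inE eqxx.
  rewrite last_rcons l0 /= filter_cat.
  move: pS uS; rewrite pairwise_cat cat_uniq => /and3P[al po _] /and3P[_ hn _].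
  rewrite (_ : filter _ (rcons o' l) = [::]); last first.
    apply/eqP; rewrite -[X in is_true X]negbK -has_filter; apply/hasPn => x.
    rewrite mem_rcons inE => /orP[/eqP->|hx]; first by rewrite /lt le_refl.
    move: po; rewrite pairwise_rcons => /andP[/allP/(_ _ hx) hl _].
    by rewrite /lt negbK.
  apply/all_filterP/allP => x hx; apply/negP => hxl.
  have lx : le l x by move/allrelP: al; apply => //; rewrite mem_rcons inE eqxx.
  have E : x = l by apply: le_anti; rewrite hxl lx.
  by move/hasPn: hn => /(_ _ hx); rewrite E mem_rcons inE eqxx.
by rewrite mulSn addnC takeD last_cat.
Qed.
End SortP.

(** * Comparing suffixes *)

Lemma lexlt_irr s : lexlt s s = false.
Proof. by elim: s => //= a s ->; rewrite ltnn andbF. Qed.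

Lemma lexlt_trans : transitive lexlt.
Proof.
elim=> [|b t IH] [|a s] [|c u] //=.
move=> /orP[h1|/andP[/eqP E1 h1]] /orP[h2|/andP[/eqP E2 h2]].
- by rewrite (ltn_trans h1 h2).
- by rewrite -E2 h1.
- by rewrite E1 h2.
- by rewrite E1 E2 eqxx (IH _ _ h1 h2) orbT.
Qed.

Lemma lexlt_total s t : [|| lexlt s t, s == t | lexlt t s].
Proof.
elim: s t => [|a s IH] [|c t] //=.
by rewrite eqseq_cons; case: (ltngtP a c) => //= _; exact: IH.
Qed.

(** Letters are positive, so the default 0 read past the end acts as a terminator smaller than every
    letter, and a proper prefix comes first without a special case. *)
Lemma lexlt_nth s t k : all (ltn 0) s -> all (ltn 0) t ->
  (forall j, j < k -> nth 0 s j = nth 0 t j) -> nth 0 s k != nth 0 t k ->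
  lexlt s t = (nth 0 s k < nth 0 t k).
Proof.
elim: k s t => [|k IH] [|a s] [|c t] /=; rewrite ?nth_nil ?eqxx //.
- by move=> _ /andP[-> _].
- by move=> _ _ _ /negPf hac; rewrite hac /= orbF.
- by move=> _ /andP[c0 _] /(_ 0 isT) /= h; rewrite -h in c0.
- move=> /andP[_ hs] /andP[_ ht] H hk.
  have /= -> := H 0 isT; rewrite ltnn eqxx /=.
  by apply: IH => // j hj; apply: (H j.+1).
Qed.

Section Order.
Variable T : seq nat.

(** Defined on all of nat so as to be a total order unconditionally: 0 is the greatest element, and
    equal suffixes, which among distinct nonzero indices only those out of range have, are ordered
    by index. *)
Definition sle (x y : nat) : bool :=
  (y == 0) || ((x != 0) && (lexlt (Defs.suffix T x) (Defs.suffix T y) ||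
                             ((Defs.suffix T x == Defs.suffix T y) && (x <= y)))).

Lemma sle0 x : sle x 0. Proof. by []. Qed.

Lemma sle_total : total sle.
Proof.
move=> x y; rewrite /sle; case: eqP => //= _; case: eqP => //= _.
have := lexlt_total (Defs.suffix T x) (Defs.suffix T y); case/or3P => [->|/eqP ->|->]; rewrite ?orbT //.
by rewrite lexlt_irr eqxx /= leq_total.
Qed.

Lemma sle_trans : transitive sle.
Proof.
move=> y x z; rewrite /sle; case: (z =P 0) => //= _; case: (y =P 0) => //= _.
case: (x =P 0) => //= _.
case/orP => [h1|/andP[/eqP -> h1]]; case/orP => [h2|/andP[/eqP <- h2]].
- by rewrite (lexlt_trans h1 h2).
- by rewrite h1.
- by rewrite h2.
- by rewrite eqxx (leq_trans h1 h2) orbT.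
Qed.

Lemma sle_anti : antisymmetric sle.
Proof.
move=> x y; rewrite /sle; case: (x =P 0) => [->|_]; case: (y =P 0) => [->|_] //=.
case/andP => /orP[h1|/andP[/eqP E h1]] /orP[h2|/andP[/eqP E2 h2]].
- by have := lexlt_trans h1 h2; rewrite lexlt_irr.
- by rewrite E2 lexlt_irr in h1.
- by rewrite E lexlt_irr in h2.
- by apply/eqP; rewrite eqn_leq h1 h2.
Qed.

Lemma suffix_neq i j : 0 < i <= size T -> 0 < j <= size T -> i != j -> Defs.suffix T i != Defs.suffix T j.
Proof.
move=> hi hj hij; apply: contra hij => /eqP E.
have : size (Defs.suffix T i) = size (Defs.suffix T j) by rewrite E.
rewrite /Defs.suffix !size_drop => h; lia.
Qed.

Lemma sleN i j : 0 < i <= size T -> 0 < j <= size T -> i != j ->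
  ~~ sle j i = lexlt (Defs.suffix T i) (Defs.suffix T j).
Proof.
move=> hi hj hij; rewrite /sle.
have -> : (i == 0) = false by lia.
have -> : (j == 0) = false by lia.
have hne := suffix_neq hi hj hij.
rewrite [_ == Defs.suffix T i]eq_sym (negPf hne) /= orbF.
have := lexlt_total (Defs.suffix T i) (Defs.suffix T j); rewrite (negPf hne) /=.
case: (boolP (lexlt (Defs.suffix T i) _)) => [h _|_ /= ->] //.
by apply/negP => h2; have := lexlt_trans h h2; rewrite lexlt_irr.
Qed.

Lemma sort_ssa (I : seq nat) : uniq I -> all (fun i => 0 < i <= size T) I ->
  is_sparse_suffix_array T I (sort sle I).
Proof.
move=> uI /allP hI; rewrite /is_sparse_suffix_array perm_sort perm_refl /=.
have h1 : pairwise sle (sort sle I).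
  by rewrite -(sorted_pairwise sle_trans); apply: (sort_sorted sle_total).
have h2 : pairwise (fun i j => i != j) (sort sle I) by rewrite -uniq_pairwise sort_uniq.
apply: pairwise_sorted.
have : pairwise [rel x y | sle x y && (x != y)] (sort sle I) by rewrite pairwise_relI h1 h2.
apply: (@sub_in_pairwise _ (mem I)); last by apply/allP => x; rewrite mem_sort.
move=> x y hx hy /= /andP[hle hne]; rewrite -sleN ?hI //.
by apply: contra hne => h; apply/eqP/sle_anti; rewrite hle h.
Qed.

(** * Common prefixes by bisection over blocks *)

Section Compare.
Variables (s lim kk : nat).
Variable eqb : nat -> nat -> nat -> bool.
Let n := size T.

Fixpoint bs (a b k lo hi : nat) : nat :=
  if k is k'.+1 then
    if lo + 1 < hi then
      let mid := (lo + hi) %/ 2 in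
      if eqb a b mid then bs a b k' mid hi else bs a b k' lo mid
    else lo
  else lo.

Fixpoint scan (cnt x y : nat) : bool :=
  if cnt is c.+1 then
    if nth 0 T x == nth 0 T y then scan c x.+1 y.+1 else nth 0 T x < nth 0 T y
  else nth 0 T x < nth 0 T y.

Definition blocks (i j : nat) := (n - maxn i j + 1) %/ s.

Definition cmpf (i j : nat) : bool :=
  let a := i.-1 in let b := j.-1 in
  let lo := bs a b kk 0 (blocks i j).+1 in
  scan lim (a + lo * s) (b + lo * s).

Lemma bs_lt a b k lo hi : lo < hi -> lo <= bs a b k lo hi < hi.
Proof.
elim: k lo hi => [|k IH] lo hi h /=; first by rewrite leqnn h.
case: ifP => h2; last by rewrite leqnn h.
case: ifP => _; [have := IH ((lo + hi) %/ 2) hi|have := IH lo ((lo + hi) %/ 2)]; lia.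
Qed.

(** The search keeps [eqb] true at lo, unless lo is 0, and false at hi, unless hi is the top. It
    ends with lo and hi adjacent, and no monotonicity of [eqb] is involved. *)
Lemma bs_spec a b k lo hi top : lo < hi -> hi - lo <= 2 ^ k -> hi <= top ->
  lo = 0 \/ eqb a b lo -> hi = top \/ eqb a b hi = false ->
  let r := bs a b k lo hi in
  (r = 0 \/ eqb a b r) /\ (r.+1 = top \/ eqb a b r.+1 = false).
Proof.
elim: k lo hi => [|k IH] lo hi h1 h2 h3 h4 h5 /=.
  by have -> : lo.+1 = hi by lia.
case: ifP => h6; last by have -> : lo.+1 = hi by lia.
rewrite expnS in h2.
case: ifP => h7; apply: IH => //; try lia; by right.
Qed.

Lemma scan_spec cnt x y e : (forall j, j < e -> nth 0 T (x + j) = nth 0 T (y + j)) ->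
  nth 0 T (x + e) != nth 0 T (y + e) -> e <= cnt ->
  scan cnt x y = (nth 0 T (x + e) < nth 0 T (y + e)).
Proof.
elim: e cnt x y => [|e IH] cnt x y H1 H2 H3.
  rewrite !addn0 in H2 *; case: cnt {H3} => //= c; by rewrite (negPf H2).
case: cnt H3 => // c H3 /=.
have := H1 0 isT; rewrite !addn0 => ->; rewrite eqxx.
rewrite -!addSnnS; apply: IH => //; rewrite ?addSnnS //.
by move=> j hj; rewrite !addSnnS; exact: H1.
Qed.

Definition good : Prop := 0 < s -> forall a b mid, a < n -> b < n -> a != b ->
  a + mid * s <= n -> b + mid * s <= n ->
  eqb a b mid = (take (mid * s) (drop a T) == take (mid * s) (drop b T)).

Hypothesis Tpos : all (ltn 0) T.

Lemma nth_pos i : (0 < nth 0 T i) = (i < n).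
Proof.
case: (ltnP i n) => h; last by rewrite nth_default.
by have := allP Tpos _ (mem_nth 0 h).
Qed.

Lemma cmpf_correct i j : good -> n %/ s < 2 ^ kk -> (s = 0 /\ n <= lim) \/ (0 < s /\ s <= lim) ->
  0 < i <= n -> 0 < j <= n -> i != j ->
  cmpf i j = lexlt (Defs.suffix T i) (Defs.suffix T j).
Proof.
move=> hg hkk hs hi hj hij; rewrite /cmpf.
set a := i.-1; set b := j.-1; set nb := blocks i j; set lo := bs _ _ _ _ _.
have hab : a != b by rewrite /a /b; lia.
have han : a < n by rewrite /a; lia.
have hbn : b < n by rewrite /b; lia.
have hlen : n - maxn i j + 1 = n - maxn a b by rewrite /a /b; clear -hi hj; lia.
have hnb : nb * s <= n - maxn a b by rewrite -hlen leq_trunc_div.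
have hblk mid : mid <= nb -> a + mid * s <= n /\ b + mid * s <= n.
  move=> hm; have : mid * s <= nb * s by rewrite leq_mul2r hm orbT.
  by clear -han hbn hnb; lia.
have hnbn : nb <= n %/ s by rewrite /nb /blocks; apply: leq_div2r; lia.
have [hlo1 hlo2] : (lo = 0 \/ eqb a b lo) /\ (lo.+1 = nb.+1 \/ eqb a b lo.+1 = false).
  by apply: bs_spec => //; [rewrite subn0; lia|left|left].
have hlo : lo < nb.+1 by have := @bs_lt a b kk 0 nb.+1 isT; rewrite -/lo; lia.
have [e he1 he2] : exists2 e, nth 0 T (a + e) != nth 0 T (b + e) &
   forall j, j < e -> nth 0 T (a + j) = nth 0 T (b + j).
  (* At [n - maxn a b] the shorter suffix has ended and the other has not, so one letter is 0 and
     the other positive. *)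
  have hex : exists e, nth 0 T (a + e) != nth 0 T (b + e).
    exists (n - maxn a b); apply/eqP => E.
    have := nth_pos (a + (n - maxn a b)); rewrite E nth_pos; clear -han hbn hab; lia.
  exists (ex_minn hex); case: ex_minnP => // m _ hmin j0 hj0.
  by apply/eqP/negPn/negP => h; have := hmin _ h; rewrite leqNgt hj0.
have nth_eq d : a + d <= n -> b + d <= n ->
    (take d (drop a T) == take d (drop b T)) = (d <= e).
  move=> had hbd; apply/eqP/idP => [h|h].
    rewrite leqNgt; apply/negP => hlt; move/eqP: he1; apply.
    by rewrite -!nth_drop -(nth_take 0 hlt) -(nth_take 0 hlt (drop b T)) h.
  have ha' : d <= size (drop a T) by rewrite size_drop -/n; clear -had; lia.
  have hb' : d <= size (drop b T) by rewrite size_drop -/n; clear -hbd; lia.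
  apply: (@eq_from_nth _ 0); rewrite !size_takel //.
  move=> k hk; rewrite !nth_take // !nth_drop; apply: he2; exact: leq_trans hk h.
have hloe : lo * s <= e.
  case: hlo1 => [->|]; first by rewrite mul0n.
  have [->|s0] := posnP s; first by rewrite muln0.
  by have [h1 h2] := hblk lo hlo; rewrite hg // nth_eq.
have he_end : e <= n - maxn a b.
  rewrite leqNgt; apply/negP => /he2 E.
  have := nth_pos (a + (n - maxn a b)); rewrite E nth_pos; clear -han hbn hab; lia.
(* Either the next block differs or the shorter suffix ends within it, so fewer than s further
   letters agree. With s = 0 everything is scanned, and n <= lim. *)
have hel : e - lo * s <= lim.
  case: hs => [[hs hl]|[hs hl]]; first by clear -he_end hl; lia.
  case: hlo2 => [[E]|hf].
    have : n - maxn a b < nb.+1 * s by rewrite -hlen /nb /blocks ltn_ceil.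
    by rewrite E mulSn; clear -he_end hl; lia.
  case: (leqP lo.+1 nb) => hln.
    have [h1 h2] := hblk lo.+1 hln.
    by move: hf; rewrite hg // nth_eq // mulSn; clear -hl; lia.
  have E : lo = nb by apply/eqP; rewrite eqn_leq -ltnS hlo -ltnS.
  have : n - maxn a b < nb.+1 * s by rewrite -hlen /nb /blocks ltn_ceil.
  by rewrite E mulSn; clear -he_end hl; lia.
rewrite (@scan_spec _ _ _ (e - lo * s)) //.
- rewrite -!addnA subnKC // -!nth_drop; symmetry; apply: lexlt_nth.
  + by apply/allP => x /mem_drop; exact/allP.
  + by apply/allP => x /mem_drop; exact/allP.
  + by move=> k hk; rewrite !nth_drop; exact: he2.
  + by rewrite !nth_drop.
- by move=> k hk; rewrite -!addnA; apply: he2; rewrite -ltn_subRL.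
- by rewrite -!addnA subnKC.
Qed.

(* The order tested by the program: 0 plays the role of +oo; outside [0, n]
   the value is irrelevant and chosen to agree with [sle]. *)
Definition less (u v : nat) : bool :=
  if (u <= n) && (v <= n) then
    if u == v then false else if u == 0 then false else if v == 0 then true else cmpf u v
  else ~~ sle v u.

Lemma less_correct : good -> n %/ s < 2 ^ kk -> (s = 0 /\ n <= lim) \/ (0 < s /\ s <= lim) ->
  forall u v, less u v = ~~ sle v u.
Proof.
move=> h1 h2 h3 u v; rewrite /less; case: ifP => // /andP[hu hv].
case: (u =P v) => [->|/eqP huv]; first by have := sle_total v v; rewrite orbb => ->.
case: (u =P 0) => [->|/eqP hu0]; first by rewrite sle0.
case: (v =P 0) => [->|/eqP hv0]; first by rewrite /sle (negPf hu0).
by rewrite cmpf_correct ?sleN -/n //; lia.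
Qed.

End Compare.
End Order.

Section Ext.
Variables (lt1 lt2 : rel nat).
Hypothesis E : forall u v, lt1 u v = lt2 u v.

Lemma eq_sift sz k h i x : sift lt1 sz k h i x = sift lt2 sz k h i x.
Proof.
elim: k h i => [|k IH] h i //=.
have -> : child lt1 sz h i = child lt2 sz h i by rewrite /child E.
by rewrite E IH.
Qed.

Lemma eq_hsort k sz h : hsort lt1 k sz h = hsort lt2 k sz h.
Proof. by elim: sz h => //= s IH h; rewrite eq_sift IH. Qed.

Lemma eq_round m k I st : round lt1 m k I st = round lt2 m k I st.
Proof.
rewrite /round eq_hsort (_ : foldl _ _ _ = foldl (sel lt2 m k st.1) (fun=> 0) I) //.
move: (fun=> 0); elim: I => //= x I IH h; rewrite IH /sel !E; by case: ifP => // _; rewrite eq_sift.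
Qed.
End Ext.

(** * A structured language compiled to the RAM *)

Inductive op := OAdd | OAddW | OSub | OMul | OMulW | ODiv | OMod | OLt | OEq.

(* [RT e] and [RI e] read the text and the index list at the 0-based position
   [e], [LD e] reads memory, [KM k] is [k %% 2 ^ w], and [MaxW] is [2 ^ w - 1].
   [OAdd], [OSub] and [OMul] must not overflow (see [ok] below), while [OAddW]
   and [OMulW] wrap around. *)
Inductive exp :=
| K of nat
| V of nat
| MaxW
| Op of op & exp & exp
| RT of exp
| RI of exp
| LD of exp
| KM of nat.

Inductive cmd :=
| Skip
| Assign of nat & exp
| Sto of exp & exp
| Rnd of nat
| Prt of exp
| Sq of cmd & cmd
| Ife of exp & cmd & cmd
| Whl of exp & cmd.

(** [OMod] computes x - (x / y) y, and [OEq] tests that (x < y) + (y < x) is below 1. *)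
Definition opcode (o : op) (t : nat) : seq instr :=
  match o with
  | OAdd | OAddW => [:: Add t t t.+1]
  | OSub => [:: Defs.Sub t t t.+1]
  | OMul | OMulW => [:: Mul t t t.+1]
  | ODiv => [:: Div t t t.+1]
  | OMod => [:: Div t.+2 t t.+1; Mul t.+2 t.+2 t.+1; Defs.Sub t t t.+2]
  | OLt => [:: Lt t t t.+1]
  | OEq => [:: Lt t.+2 t t.+1; Lt t t.+1 t; Add t t t.+2; Const t.+2 1; Lt t t t.+2]
  end.

(** Stack discipline: the value ends in register t, and only registers from t on are used as
    temporaries. For want of a move instruction [V a] adds a register to 0; [MaxW] is 0 - 1 modulo
    2^w. *)
Fixpoint cexp (e : exp) (t : nat) : seq instr :=
  match e with
  | K n => [:: Const t n]
  | V a => [:: Const t 0; Add t t a]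
  | MaxW => [:: Const t 0; Const t.+1 1; Defs.Sub t t t.+1]
  | Op o e1 e2 => cexp e1 t ++ cexp e2 t.+1 ++ opcode o t
  | RT e => cexp e t ++ [:: Const t.+1 1; Add t t t.+1; ReadT t t]
  | RI e => cexp e t ++ [:: ReadI t t]
  | LD e => cexp e t ++ [:: LoadInd t t]
  | KM n => [:: Const t n]
  end.

Fixpoint depth (e : exp) : nat :=
  match e with
  | K _ | V _ | KM _ => 1
  | MaxW => 2
  | Op _ e1 e2 => maxn (depth e1) (maxn 3 (depth e2).+1)
  | RT e => maxn 2 (depth e)
  | RI e | LD e => depth e
  end.

Lemma depth_gt0 e : 0 < depth e.
Proof. elim: e => //= [o e1 IH1 e2 IH2|e IH]; lia. Qed.

Definition opsz (o : op) := match o with OMod => 3 | OEq => 5 | _ => 1 end.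

Fixpoint exp_size (e : exp) : nat :=
  match e with
  | K _ | KM _ => 1
  | V _ => 2
  | MaxW => 3
  | Op o e1 e2 => exp_size e1 + (exp_size e2 + opsz o)
  | RT e => exp_size e + 3
  | RI e | LD e => exp_size e + 1
  end.

Lemma size_opcode o t : size (opcode o t) = opsz o.
Proof. by case: o. Qed.

Lemma size_cexp e t : size (cexp e t) = exp_size e.
Proof.
elim: e t => //= [o e1 IH1 e2 IH2 t|e IH t|e IH t|e IH t].
- by rewrite !size_cat IH1 IH2 size_opcode.
- by rewrite size_cat IH.
- by rewrite size_cat IH.
- by rewrite size_cat IH.
Qed.

(* Registers 130..159 hold the temporaries of expression evaluation; named
   variables live below them and arrays above. *)
Definition tmp (x : nat) : bool := (130 <= x) && (x < 160).

Fixpoint cmd_size (c : cmd) : nat :=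
  match c with
  | Skip => 0
  | Assign d e => exp_size e + 2
  | Sto e1 e2 => exp_size e1 + (exp_size e2 + 1)
  | Rnd d => 1
  | Prt e => exp_size e + 1
  | Sq c1 c2 => cmd_size c1 + cmd_size c2
  | Ife e c1 c2 => exp_size e + (1 + (cmd_size c1 + (1 + cmd_size c2)))
  | Whl e c => exp_size e + (1 + (cmd_size c + 1))
  end.

Fixpoint compile (o : nat) (c : cmd) : seq instr :=
  match c with
  | Skip => [::]
  | Assign d e => cexp e 130 ++ [:: Const 131 0; Add d 130 131]
  | Sto e1 e2 => cexp e1 130 ++ cexp e2 131 ++ [:: Store 130 131]
  | Rnd d => [:: Rand d]
  | Prt e => cexp e 130 ++ [:: Out 130]
  | Sq c1 c2 => compile o c1 ++ compile (o + cmd_size c1) c2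
  | Ife e c1 c2 =>
      let o1 := o + exp_size e + 1 in
      let o2 := o1 + cmd_size c1 + 1 in
      cexp e 130 ++ [:: Jz 130 o2] ++ compile o1 c1 ++ [:: Jmp (o2 + cmd_size c2)] ++ compile o2 c2
  | Whl e c =>
      let o1 := o + exp_size e + 1 in
      cexp e 130 ++ [:: Jz 130 (o1 + cmd_size c + 1)] ++ compile o1 c ++ [:: Jmp o]
  end.

Lemma size_comp o c : size (compile o c) = cmd_size c.
Proof.
elim: c o => //= [d e|e1 e2|e|c1 IH1 c2 IH2|e c1 IH1 c2 IH2|e c IH] o;
  rewrite ?size_cat /= ?size_cexp ?IH ?IH1 ?IH2 //=; try lia.
- rewrite ?size_cat /= ?size_cexp ?IH ?IH1 ?IH2 //=; lia.
- rewrite ?size_cat /= ?size_cexp ?IH ?IH1 ?IH2 //=; lia.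
Qed.

Definition frag (P : seq instr) (o : nat) (l : seq instr) : Prop :=
  forall k, k < size l -> nth Halt P (o + k) = nth Halt l k.

Lemma frag_cat P o l1 l2 :
  frag P o (l1 ++ l2) -> frag P o l1 /\ frag P (o + size l1) l2.
Proof.
move=> H; split=> k hk.
- rewrite H ?nth_cat ?hk // size_cat; lia.
- by rewrite -addnA H ?size_cat ?ltn_add2l // nth_cat ltnNge leq_addr /= addKn.
Qed.

Record ast := Ast { rg : nat -> nat; rp : nat; ou : seq nat }.

Record machine_ok (w : nat) (T I : seq nat) (MA : nat) : Prop := MachineOk {
  word_gt1 : 1 < 2 ^ w;
  size_lt_word : size T < 2 ^ w;
  letters_lt_word : all (fun a => a < 2 ^ w) T;
  indices_lt_word : all (fun a => a < 2 ^ w) I;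
  temps_le_addr : 160 <= MA }.

(** * Execution of compiled code and preconditions with time bounds *)

Section Machine.
Variables (w : nat) (T I : seq nat) (tape : nat -> nat) (MA : nat).
Local Notation W := (2 ^ w).
Local Notation step P := (Defs.step w P T I tape).

Hypothesis HW : machine_ok w T I MA.
Let W1 : 1 < W. Proof. by case: HW. Qed.
Let TW : size T < W. Proof. by case: HW. Qed.
Let TletW : all (fun a => a < W) T. Proof. by case: HW. Qed.
Let IW : all (fun a => a < W) I. Proof. by case: HW. Qed.
Let MA160 : 160 <= MA. Proof. by case: HW. Qed.

Definition eff (i : instr) (s : (nat -> nat) * nat) : (nat -> nat) * nat :=
  let: (r, m) := s in
  let nx d v ms := (upd r d v, foldr maxn m (d :: ms)) in
  match i with
  | Const d k => nx d (k %% W) [::]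
  | Add d a b => nx d ((r a + r b) %% W) [:: a; b]
  | Defs.Sub d a b => nx d ((r a + (W - r b)) %% W) [:: a; b]
  | Mul d a b => nx d ((r a * r b) %% W) [:: a; b]
  | Div d a b => nx d (r a %/ r b) [:: a; b]
  | Lt d a b => nx d (r a < r b : nat) [:: a; b]
  | LoadInd d a => nx d (r (r a)) [:: a; r a]
  | Store a x => (upd r (r a) (r x), foldr maxn m [:: a; x; r a])
  | ReadT d a => nx d (readT T (r a) %% W) [:: a]
  | ReadI d a => nx d (readI I (r a) %% W) [:: a]
  | _ => s
  end.

Definition line (i : instr) : bool :=
  match i with Rand _ | Jz _ _ | Jmp _ | Out _ | Halt => false | _ => true end.

Definition effs (s : (nat -> nat) * nat) (l : seq instr) := foldl (fun s i => eff i s) s l.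

Lemma exec_line P l o r q ou m :
  frag P o l -> all line l ->
  iter (size l) (step P) (St o r q ou m false) =
  St (o + size l) (effs (r, m) l).1 q ou (effs (r, m) l).2 false.
Proof.
elim: l o r m => [|i l IH] o r m; first by rewrite addn0.
move=> H /andP[Hi Hl].
have Hn := H 0 (ltn0Sn _); rewrite addn0 /= in Hn.
have Hf : frag P o.+1 l.
  by move=> k hk; rewrite addSnnS H.
rewrite [size _]/= iterSr.
have -> : Defs.step w P T I tape (St o r q ou m false) = St o.+1 (eff i (r, m)).1 q ou (eff i (r, m)).2 false.
  by rewrite /Defs.step Hn; case: i Hi H Hn.
have -> : effs (r, m) (i :: l) = effs (eff i (r, m)) l by [].
by rewrite IH // addSnnS -surjective_pairing.
Qed.

Lemma line_cexp e t : all line (cexp e t).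
Proof.
elim: e t => //= [o e1 IH1 e2 IH2 t|e IH t|e IH t|e IH t];
  rewrite ?all_cat ?IH1 ?IH2 ?IH //=; by case: o.
Qed.

Definition evop (o : op) (x y : nat) : nat :=
  match o with
  | OAdd => x + y
  | OAddW => (x + y) %% W
  | OSub => x - y
  | OMul => x * y
  | OMulW => (x * y) %% W
  | ODiv => x %/ y
  | OMod => x %% y
  | OLt => x < y
  | OEq => x == y
  end.

Definition okop (o : op) (x y : nat) : bool :=
  match o with
  | OAdd => x + y < W
  | OSub => y <= x
  | OMul => x * y < W
  | _ => true
  end.

Fixpoint ev (f : nat -> nat) (e : exp) : nat :=
  match e with
  | K n => n
  | V a => f a
  | MaxW => W.-1
  | Op o e1 e2 => evop o (ev f e1) (ev f e2)
  | RT e => nth 0 T (ev f e)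
  | RI e => nth 0 I (ev f e)
  | LD e => f (ev f e)
  | KM n => n %% W
  end.

Fixpoint ok (f : nat -> nat) (e : exp) : Prop :=
  match e with
  | K n => n < W
  | V a => a < 130
  | MaxW | KM _ => True
  | Op o e1 e2 => [/\ ok f e1, ok f e2 & okop o (ev f e1) (ev f e2)]
  | RT e | RI e => ok f e
  | LD e => [/\ ok f e, ev f e <= MA & ~~ tmp (ev f e)]
  end.

(** The bound 2^w covers the temporaries too: with it, and with [okop], every modular instruction
    returns the exact value. *)
Definition represents (r f : nat -> nat) : Prop :=
  (forall x, r x < W) /\ (forall x, ~~ tmp x -> r x = f x).

Lemma nth_lt (s : seq nat) i : all (fun a => a < W) s -> nth 0 s i < W.
Proof.
move=> /allP H; case: (ltnP i (size s)) => h; first exact/H/mem_nth.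
rewrite nth_default //; lia.
Qed.

Lemma upd_lt r d v : (forall x, r x < W) -> v < W -> forall x, upd r d v x < W.
Proof. by move=> H hv x; rewrite /upd; case: ifP. Qed.

Local Ltac updlt := repeat (apply: upd_lt; rewrite ?ltn_mod //).

(** The 1-based address may wrap to 0 when v = 2^w - 1. Position v is then past the end, because
    size T < 2^w, and address 0 reads as 0 as well. *)
Lemma readT_succ v : v < W -> readT T ((v + 1) %% W) = nth 0 T v.
Proof.
move=> hv; rewrite /readT; case: (ltnP (v + 1) W) => h.
  rewrite modn_small // addn1 /=; case: ltnP => // h2; by rewrite nth_default.
have -> : v + 1 = W by lia.
rewrite modnn /= nth_default //; lia.
Qed.

Definition cpost t v (r : nat -> nat) (s : (nat -> nat) * nat) : Prop :=
  [/\ s.1 t = v, (forall x, (x < t) || (160 <= x) -> s.1 x = r x),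
      forall x, s.1 x < W & s.2 <= MA].

Lemma opcodeP o t x y r m :
  130 <= t -> t + 3 <= 160 -> (forall x, r x < W) -> m <= MA ->
  r t = x -> r t.+1 = y -> okop o x y ->
  cpost t (evop o x y) r (effs (r, m) (opcode o t)).
Proof.
move=> h1 h2 rW hm hx hy hok.
have hxW : x < W by rewrite -hx.
have hyW : y < W by rewrite -hy.
have E1 : (t.+1 == t) = false by lia.
have E2 : (t == t.+1) = false by lia.
have E3 : (t.+2 == t) = false by lia.
have E4 : (t == t.+2) = false by lia.
have E5 : (t.+2 == t.+1) = false by lia.
have E6 : (t.+1 == t.+2) = false by lia.
have frame : forall z, (z < t) || (160 <= z) -> ((z == t) = false) * ((z == t.+2) = false).
  by move=> z hz; split; apply/eqP; lia.
have W0 : 0 < W by lia.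
case: o hok => /= hok; split=> /=; try lia;
  try (by move=> z hz; rewrite /upd !(frame z hz));
  try (do 5?[apply: upd_lt => //]; rewrite ?ltn_mod //);
  rewrite /upd ?eqxx ?E1 ?E2 ?E3 ?E4 ?E5 ?E6 ?hx ?hy //.
- by rewrite modn_small.
- rewrite (_ : x + (W - y) = (x - y) + W); last by lia.
  rewrite modnDr modn_small //; lia.
- by rewrite modn_small.
- apply: leq_ltn_trans (leq_div _ _) hxW.
- rewrite (modn_small (m := x %/ y * y)); last exact: leq_ltn_trans (leq_trunc_div _ _) hxW.
  have hle := leq_trunc_div x y.
  rewrite (_ : x + (W - x %/ y * y) = (x - x %/ y * y) + W); last by lia.
  rewrite modnDr modn_small; last by lia.
  by have := divn_eq x y; lia.
- apply: leq_ltn_trans (leq_div _ _) hxW.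
- by case: (x < y); lia.
- rewrite (modn_small (m := 1)) //.
  case: (ltngtP x y) => h; rewrite /= ?modn_small //.
- by case: (x < y); lia.
- by case: (y < _); lia.
- by case: (_ < _ %% _); lia.
Qed.

Lemma effs_cat s l1 l2 : effs s (l1 ++ l2) = effs (effs s l1) l2.
Proof. exact: foldl_cat. Qed.

Lemma cexpP e t r m f :
  represents r f -> ok f e -> 130 <= t -> t + depth e <= 160 -> m <= MA ->
  cpost t (ev f e) r (effs (r, m) (cexp e t)).
Proof.
have W0 : 0 < W by lia.
have frame t0 z : (z < t0) || (160 <= z) -> 130 <= t0 -> t0 < 159 ->
     ((z == t0) = false) * ((z == t0.+1) = false).
  by move=> hz ? ?; split; apply/eqP; lia.
have frame1 t0 z : (z < t0) || (160 <= z) -> 130 <= t0 -> t0 < 160 ->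
     ((z == t0) = false).
  by move=> hz ? ?; apply/eqP; lia.
elim: e t r m => [n|a||o e1 IH1 e2 IH2|e IH|e IH|e IH|n] t r m [rW rf] /= hok h1 h2 hm.
- split=> /=; try lia.
  + by rewrite /upd eqxx modn_small.
  + by move=> z hz; have E1 := frame1 t z hz; rewrite /upd !E1 //; lia.
  + by updlt.
- have E : (a == t) = false by lia.
  split=> /=; try lia.
  + rewrite /upd eqxx E mod0n add0n modn_small // rf // /tmp; lia.
  + by move=> z hz; have E1 := frame1 t z hz; rewrite /upd !E1 //; lia.
  + by updlt.
- have E : (t == t.+1) = false by lia.
  split=> /=; try lia.
  + rewrite /upd !eqxx E mod0n add0n (modn_small (m := 1)) //.
    rewrite modn_small; lia.
  + by move=> z hz; have [||E1 E2] := frame t z hz; rewrite /upd ?E1 ?E2 //; lia.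
  + by updlt.
- case: hok => ok1 ok2 oko.
  rewrite !effs_cat.
  have [] := IH1 t r m (conj rW rf) ok1 h1 _ hm; first by lia.
  case: (effs _ _) => r1 m1 /= a1 a2 a3 a4.
  have rel1 : represents r1 f.
    split=> // x hx; rewrite a2 ?rf //; move: hx; rewrite /tmp; lia.
  have [] := IH2 t.+1 r1 m1 rel1 ok2 _ _ a4; try lia.
  case: (effs _ _) => r2 m2 /= b1 b2 b3 b4.
  have h160 : t + 3 <= 160 by lia.
  have hx2 : r2 t = ev f e1 by rewrite b2 ?a1 //; lia.
  have [] := opcodeP h1 h160 b3 b4 hx2 b1 oko.
  move=> c1 c2 c3 c4; split=> // x hx.
  by rewrite c2 // b2 ?a2 //; lia.
- rewrite !effs_cat.
  have [] := IH t r m (conj rW rf) hok h1 _ hm; first by lia.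
  case: (effs _ _) => r1 m1 /= a1 a2 a3 a4.
  have E : (t == t.+1) = false by lia.
  split=> /=; try lia.
  + rewrite /upd !eqxx E a1 (modn_small (m := 1)) // readT_succ -?a1 //.
    by rewrite modn_small // nth_lt.
  + by move=> z hz; have [||E1 E2] := frame t z hz; rewrite /upd ?E1 ?E2 ?a2 //; lia.
  + by updlt.
- rewrite !effs_cat.
  have [] := IH t r m (conj rW rf) hok h1 _ hm; first by lia.
  case: (effs _ _) => r1 m1 /= a1 a2 a3 a4.
  split=> /=; try lia.
  + by rewrite /upd !eqxx a1 /readI modn_small // nth_lt.
  + by move=> z hz; have E1 := frame1 t z hz; have ? := depth_gt0 e; rewrite /upd !E1 ?a2 //; lia.
  + by updlt.
- case: hok => ok1 hMA htmp.
  rewrite !effs_cat.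
  have [] := IH t r m (conj rW rf) ok1 h1 _ hm; first by lia.
  case: (effs _ _) => r1 m1 /= a1 a2 a3 a4.
  split=> /=; try lia.
  + rewrite /upd !eqxx a1 a2 ?rf //; move: htmp; rewrite /tmp; lia.
  + by move=> z hz; have E1 := frame1 t z hz; have ? := depth_gt0 e; rewrite /upd !E1 ?a2 //; lia.
  + by apply: upd_lt.
- split=> /=; try lia.
  + by rewrite /upd eqxx.
  + by move=> z hz; have E1 := frame1 t z hz; rewrite /upd !E1 //; lia.
  + by updlt.
Qed.

Definition mk o r (s : ast) m := St o r (rp s) (ou s) m false.

Lemma exec_exp P e t o r f q out m :
  frag P o (cexp e t) -> represents r f -> ok f e -> 130 <= t -> t + depth e <= 160 -> m <= MA ->
  exists r' m', iter (exp_size e) (step P) (St o r q out m false) = St (o + exp_size e) r' q out m' false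
    /\ cpost t (ev f e) r (r', m').
Proof.
move=> hf hr hok h1 h2 hm.
have := exec_line r q out m hf (line_cexp _ _); rewrite size_cexp => ->.
have := cexpP hr hok h1 h2 hm.
by case: (effs _ _) => r' m' H; exists r', m'.
Qed.

Lemma rel_frame t r r' f : 130 <= t -> represents r f ->
  (forall x, (x < t) || (160 <= x) -> r' x = r x) -> (forall x, r' x < W) -> represents r' f.
Proof.
by move=> ht [_ H] h1 h2; split=> // x hx; rewrite h1 ?H //; move: hx; rewrite /tmp; lia.
Qed.

Lemma rel_upd r f d v r' : represents r f -> ~~ tmp d -> v < W ->
  (forall x, r' x < W) -> (forall x, ~~ tmp x -> r' x = upd r d v x) -> represents r' (upd f d v).
Proof.
move=> [_ H] hd hv h1 h2; split=> // x hx; rewrite h2 // /upd; case: ifP => // _; exact: H.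
Qed.

Lemma iter_seq (A : Type) (f : A -> A) n m x y : iter n f x = y -> iter (n + m) f x = iter m f y.
Proof. by move=> <-; rewrite addnC iterD. Qed.

(* Weakest precondition with time bound [t]: started on memory [rg s], the
   compiled [c] reaches its end within [t] steps in a state satisfying [Q],
   without touching an address above [MA]. *)
Definition wp (c : cmd) (t : nat) (Q : ast -> Prop) (s : ast) : Prop :=
  forall P o r m, frag P o (compile o c) -> represents r (rg s) -> m <= MA ->
  exists t' r' m' s', [/\ t' <= t, iter t' (step P) (mk o r s m) = mk (o + cmd_size c) r' s' m',
    represents r' (rg s'), m' <= MA & Q s'].

Lemma wp_mono c t t' (Q Q' : ast -> Prop) s :
  wp c t Q s -> t <= t' -> (forall s', Q s' -> Q' s') -> wp c t' Q' s.
Proof.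
move=> H ht HQ P o r m hf hr hm.
have [t1 [r' [m' [s' [h1 h2 h3 h4 h5]]]]] := H P o r m hf hr hm.
exists t1, r', m', s'; split=> //; [exact: leq_trans h1 ht | exact: HQ].
Qed.

Lemma wp_skip t (Q : ast -> Prop) s : Q s -> wp Skip t Q s.
Proof. by move=> H P o r m hf hr hm; exists 0, r, m, s; split=> //=; rewrite addn0. Qed.

Lemma wp_seq c1 c2 t1 t Q s :
  wp c1 t1 (wp c2 (t - t1) Q) s -> t1 <= t -> wp (Sq c1 c2) t Q s.
Proof.
move=> H ht P o r m /= /frag_cat[hf1]; rewrite size_comp => hf2 hr hm.
have [t2 [r2 [m2 [s2 [h1 h2 h3 h4 h5]]]]] := H P o r m hf1 hr hm.
have [t3 [r3 [m3 [s3 [k1 k2 k3 k4 k5]]]]] := h5 P _ r2 m2 hf2 h3 h4.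
exists (t2 + t3), r3, m3, s3; split=> //; first lia.
by rewrite (iter_seq _ h2) k2 addnA.
Qed.

Lemma wp_set d e t (Q : ast -> Prop) f q out :
  ok f e -> d < 130 -> depth e <= 30 -> exp_size e + 2 <= t ->
  Q (Ast (upd f d (ev f e)) q out) -> wp (Assign d e) t Q (Ast f q out).
Proof.
move=> hok hd hde ht HQ P o r m /= /frag_cat[hf1]; rewrite size_cexp => hf2 hr hm.
have h160 : 130 + depth e <= 160 by lia.
have [r1 [m1 [E1 [c1 c2 c3 c4]]]] := exec_exp q out hf1 hr hok (leqnn _) h160 hm.
have := exec_line r1 q out m1 hf2 isT; rewrite [size _]/= => E2.
rewrite /= in c1 c2 c3 c4.
have W0 : 0 < W by lia.
have Ed : (d == 131) = false by lia.
exists (exp_size e + 2), (effs (r1, m1) [:: Const 131 0; Add d 130 131]).1,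
  (effs (r1, m1) [:: Const 131 0; Add d 130 131]).2, (Ast (upd f d (ev f e)) q out).
split=> //.
- by rewrite (iter_seq _ E1) E2 addnA.
- have vW : ev f e < W by rewrite -c1.
  apply: (@rel_upd r) => //; first by rewrite /tmp; lia.
    by rewrite /=; updlt.
  move=> x hx /=; rewrite /upd !eqxx /= c1 mod0n addn0 modn_small //.
  case: (x == d) => //; have -> : (x == 131) = false by move: hx; rewrite /tmp; lia.
  by apply: c2; move: hx; rewrite /tmp; lia.
- rewrite /=; lia.
Qed.

Lemma wp_sto e1 e2 t (Q : ast -> Prop) f q out :
  ok f e1 -> ok f e2 -> ev f e1 <= MA -> ~~ tmp (ev f e1) ->
  depth e1 <= 30 -> depth e2 <= 29 -> exp_size e1 + exp_size e2 + 1 <= t ->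
  Q (Ast (upd f (ev f e1) (ev f e2)) q out) -> wp (Sto e1 e2) t Q (Ast f q out).
Proof.
move=> hok1 hok2 ha hta hd1 hd2 ht HQ P o r m /= /frag_cat[hf1]; rewrite size_cexp.
move=> /frag_cat[hf2]; rewrite size_cexp => hf3 hr hm.
have h160 : 130 + depth e1 <= 160 by lia.
have h160' : 131 + depth e2 <= 160 by lia.
have [r1 [m1 [E1 [c1 c2 c3 c4]]]] := exec_exp q out hf1 hr hok1 (leqnn _) h160 hm.
rewrite /= in c1 c2 c3 c4.
have hr1 := rel_frame (leqnn _) hr c2 c3.
have [r2 [m2 [E2 [d1 d2 d3 d4]]]] := exec_exp q out hf2 hr1 hok2 isT h160' c4.
rewrite /= in d1 d2 d3 d4.
have := exec_line r2 q out m2 hf3 isT; rewrite [size _]/= => E3.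
have e130 : r2 130 = ev f e1 by rewrite d2.
exists (exp_size e1 + (exp_size e2 + 1)), (effs (r2, m2) [:: Store 130 131]).1,
  (effs (r2, m2) [:: Store 130 131]).2, (Ast (upd f (ev f e1) (ev f e2)) q out).
split=> //.
- lia.
- by rewrite (iter_seq _ E1) (iter_seq _ E2) E3 !addnA.
- have vW : ev f e2 < W by rewrite -d1.
  apply: (@rel_upd r) => //.
    by rewrite /= d1; updlt.
  move=> x hx /=; rewrite d1 e130 /upd; case: (x == _) => //.
  rewrite d2 ?c2 //; move: hx; rewrite /tmp; lia.
- rewrite /= e130; lia.
Qed.

Lemma wp_rnd d t (Q : ast -> Prop) f q out :
  d < 130 -> 1 <= t ->
  Q (Ast (upd f d (tape q %% W)) q.+1 out) -> wp (Rnd d) t Q (Ast f q out).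
Proof.
move=> hd ht HQ P o r m hf hr hm.
have := hf 0 isT; rewrite addn0 /= => Hn.
have W0 : 0 < W by lia.
exists 1, (upd r d (tape q %% W)), (maxn m d), (Ast (upd f d (tape q %% W)) q.+1 out); split=> //.
- by rewrite /= Hn /= addn1.
- apply: (@rel_upd r) => //; first by rewrite /tmp; lia.
    by rewrite ltn_mod.
  case: hr => hr _; by updlt.
- lia.
Qed.

Lemma wp_prt e t (Q : ast -> Prop) f q out :
  ok f e -> depth e <= 30 -> exp_size e + 1 <= t ->
  Q (Ast f q (rcons out (ev f e))) -> wp (Prt e) t Q (Ast f q out).
Proof.
move=> hok hde ht HQ P o r m /= /frag_cat[hf1]; rewrite size_cexp => hf2 hr hm.
have h160 : 130 + depth e <= 160 by lia.
have [r1 [m1 [E1 [c1 c2 c3 c4]]]] := exec_exp q out hf1 hr hok (leqnn _) h160 hm.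
rewrite /= in c1 c2 c3 c4.
have := hf2 0 isT; rewrite addn0 /= => Hn.
exists (exp_size e + 1), r1, (maxn m1 130), (Ast f q (rcons out (ev f e))); split=> //.
- by rewrite (iter_seq _ E1) /= Hn /mk /= c1 addnA addn1.
- exact: rel_frame c2 c3.
- lia.
Qed.

Lemma wp_ife e c1 c2 t (Q : ast -> Prop) s :
  ok (rg s) e -> depth e <= 30 -> exp_size e + 2 <= t ->
  (ev (rg s) e != 0 -> wp c1 (t - (exp_size e + 2)) Q s) ->
  (ev (rg s) e = 0 -> wp c2 (t - (exp_size e + 2)) Q s) ->
  wp (Ife e c1 c2) t Q s.
Proof.
case: s => f q out /= hok hde ht H1 H2 P o r m /= /frag_cat[hf1]; rewrite size_cexp => hf hr hm.
have h160 : 130 + depth e <= 160 by lia.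
have [r1 [m1 [E1 [a1 a2 a3 a4]]]] := exec_exp q out hf1 hr hok (leqnn _) h160 hm.
rewrite /= in a1 a2 a3 a4.
have hr1 := rel_frame (leqnn _) hr a2 a3.
move: hf; rewrite -cat1s => /frag_cat[hfj /= /frag_cat[hfc1]]; rewrite size_comp -cat1s.
move=> /frag_cat[hfjmp /= hfc2].
have := hfj 0 isT; rewrite addn0 /= => Hn.
have := hfjmp 0 isT; rewrite addn0 /= => Hn2.
have hm1 : maxn m1 130 <= MA by lia.
have E2 : iter (exp_size e + 1) (step P) (mk o r (Ast f q out) m) =
  mk (if ev f e == 0 then o + exp_size e + 1 + cmd_size c1 + 1 else o + exp_size e + 1) r1 (Ast f q out) (maxn m1 130).
  by rewrite (iter_seq _ E1) /= Hn /= a1 /mk !addn1.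
case: eqP E2 => [e0|/eqP e0] E2.
- have [t3 [r3 [m3 [s3 [k1 k2 k3 k4 k5]]]]] := H2 e0 P _ r1 _ hfc2 hr1 hm1.
  exists (exp_size e + 1 + t3), r3, m3, s3; split=> //; first lia.
  by rewrite (iter_seq _ E2) k2 /mk; congr St; lia.
- have [t3 [r3 [m3 [s3 [k1 k2 k3 k4 k5]]]]] := H1 e0 P _ r1 _ hfc1 hr1 hm1.
  exists (exp_size e + 1 + (t3 + 1)), r3, m3, s3; split=> //; first lia.
  rewrite (iter_seq _ E2) (iter_seq _ k2) /= Hn2 /= /mk; congr St; lia.
Qed.

Lemma whl_head e c P o r m f q out :
  depth e <= 30 -> ok f e -> frag P o (compile o (Whl e c)) -> represents r f -> m <= MA ->
  exists r1 m1, [/\ iter (exp_size e + 1) (step P) (mk o r (Ast f q out) m) =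
    mk (if ev f e == 0 then o + cmd_size (Whl e c) else o + exp_size e + 1) r1 (Ast f q out) m1,
    represents r1 f, m1 <= MA, frag P (o + exp_size e + 1) (compile (o + exp_size e + 1) c) &
    nth Halt P (o + exp_size e + 1 + cmd_size c) = Jmp o].
Proof.
move=> hde hok /= /frag_cat[hf1]; rewrite size_cexp => hf hr hm.
have h160 : 130 + depth e <= 160 by lia.
have [r1 [m1 [E1 [a1 a2 a3 a4]]]] := exec_exp q out hf1 hr hok (leqnn _) h160 hm.
rewrite /= in a1 a2 a3 a4.
have hr1 := rel_frame (leqnn _) hr a2 a3.
move: hf; rewrite -cat1s => /frag_cat[hfj /= /frag_cat[hfc1]]; rewrite size_comp => hfjmp.
have := hfj 0 isT; rewrite addn0 /= => Hn.
have := hfjmp 0 isT; rewrite addn0 /= => Hn2.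
exists r1, (maxn m1 130); split=> //; last lia.
rewrite (iter_seq _ E1) /= Hn /= a1 /mk; case: eqP => _; congr St; lia.
Qed.

(** The index of the invariant bounds the remaining iterations without being their exact number, so
    a loop may exit early. One iteration costs the test, its conditional jump, the body and the jump
    back. *)
Lemma wp_whl (Inv : nat -> ast -> Prop) k tb e c t (Q : ast -> Prop) s :
  depth e <= 30 ->
  (forall k s, Inv k s -> [/\ ok (rg s) e, ev (rg s) e = 0 -> Q s
     & ev (rg s) e != 0 -> 0 < k /\ wp c tb (Inv k.-1) s]) ->
  Inv k s -> k * (exp_size e + tb + 2) + exp_size e + 1 <= t ->
  wp (Whl e c) t Q s.
Proof.
move=> hde Hinv.
elim: k t s => [|k IH] t [f q out] hI ht P o r m hf0 hr hm;
  have [hok hQ hb] := Hinv _ _ hI;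
  have [r1 [m1 [E2 hr1 hm1 hfc1 Hn2]]] := whl_head q out hde hok hf0 hr hm.
- case: eqP E2 => [e0|/eqP e0] E2; last by have [] := hb e0.
  by exists (exp_size e + 1), r1, m1, (Ast f q out); split; [lia|..|exact: hQ].
- case: eqP E2 => [e0|/eqP e0] E2.
    by exists (exp_size e + 1), r1, m1, (Ast f q out); split; [lia|..|exact: hQ].
  have [_ /= hw] := hb e0.
  have [t3 [r3 [m3 [s3 [k1 k2 k3 k4 k5]]]]] := hw P _ r1 _ hfc1 hr1 hm1.
  have ht' : k * (exp_size e + tb + 2) + exp_size e + 1 <= t - (exp_size e + tb + 2).
    by move: ht; rewrite mulSn; lia.
  have [t4 [r4 [m4 [s4 [l1 l2 l3 l4 l5]]]]] := IH _ _ k5 ht' P o r3 m3 hf0 k3 k4.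
  exists (exp_size e + 1 + (t3 + (1 + t4))), r4, m4, s4; split=> //.
    move: ht; rewrite mulSn; lia.
  by rewrite (iter_seq _ E2) (iter_seq _ k2) addnC iterD -l2 /= Hn2.
Qed.
End Machine.

Definition agree (X : seq nat) (f f' : nat -> nat) : Prop := forall x, x \notin X -> f' x = f x.

Lemma agree_trans X f1 f2 f3 : agree X f1 f2 -> agree X f2 f3 -> agree X f1 f3.
Proof. by move=> h1 h2 x hx; rewrite h2 // h1. Qed.
Lemma agree_sub X Y f f' : {subset X <= Y} -> agree X f f' -> agree Y f f'.
Proof. by move=> s h x hx; apply: h; apply: contra hx; exact: s. Qed.
Lemma agree_upd X f f' d v : d \in X -> agree X f f' -> agree X f (upd f' d v).
Proof. by move=> hd h x hx; rewrite /upd; case: eqP => [E|_]; [rewrite E hd in hx | apply: h]. Qed.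
Lemma agree_sub_all X Y f f' : all (mem Y) X -> agree X f f' -> agree Y f f'.
Proof. by move=> /allP h; apply: agree_sub => x /h. Qed.

Lemma upd_arr f d v x : d < 160 -> 160 <= x -> upd f d v x = f x.
Proof. by move=> hd hx; rewrite /upd; case: eqP => // E; rewrite E leqNgt hd in hx. Qed.

Lemma upd_ne f d v x : x != d -> upd f d v x = f x.
Proof. by rewrite /upd => /negPf ->. Qed.

Notation "a ;; b" := (Sq a b) (at level 95, right associativity).
Notation "d ::= e" := (Assign d e) (at level 90).

Section Rules.
Variables (w : nat) (T I : seq nat) (tape : nat -> nat) (MA : nat).
Local Notation W := (2 ^ w).
Hypothesis HW : machine_ok w T I MA.
Local Notation wp := (wp w T I tape MA).
Local Notation ok := (ok w T I MA).
Local Notation ev := (ev w T I).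

Lemma wp_set_seq d e c t (Q : ast -> Prop) f q o :
  d < 130 -> depth e <= 30 -> exp_size e + 2 <= t -> ok f e ->
  wp c (t - (exp_size e + 2)) Q (Ast (upd f d (ev f e)) q o) ->
  wp (d ::= e ;; c) t Q (Ast f q o).
Proof.
move=> h1 h2 h3 h4 h5; apply: (wp_seq HW (t1 := exp_size e + 2)) => //.
exact: (wp_set _ HW).
Qed.

Lemma wp_setv d e v c t (Q : ast -> Prop) f q o :
  d < 130 -> depth e <= 30 -> exp_size e + 2 <= t -> ok f e /\ ev f e = v ->
  wp c (t - (exp_size e + 2)) Q (Ast (upd f d v) q o) ->
  wp (d ::= e ;; c) t Q (Ast f q o).
Proof. by move=> h1 h2 h3 [h4 <-] h5; apply: wp_set_seq. Qed.

Lemma wp_setl d e v t (Q : ast -> Prop) f q o :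
  d < 130 -> depth e <= 30 -> exp_size e + 2 <= t -> ok f e /\ ev f e = v ->
  Q (Ast (upd f d v) q o) -> wp (d ::= e) t Q (Ast f q o).
Proof. by move=> h1 h2 h3 [h4 <-] h5; apply: (wp_set _ HW). Qed.

Lemma ld_add F a A i v : F a = A -> a < 130 -> i < W -> A + i < W -> A + i <= MA -> ~~ tmp (A + i) ->
  F (A + i) = v -> ok F (LD (Op OAdd (V a) (K i))) /\ ev F (LD (Op OAdd (V a) (K i))) = v.
Proof. by move=> /= -> h1 h2 h3 h4 h5 ->; do ![split => //]. Qed.

Lemma ld_var F a A v : F a = A -> a < 130 -> A <= MA -> ~~ tmp A -> F A = v ->
  ok F (LD (V a)) /\ ev F (LD (V a)) = v.
Proof. by move=> /= -> h1 h2 h3 ->; do ![split => //]. Qed.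

End Rules.
Arguments ld_add {w T I MA F a A i v}.
Arguments ld_var {w T I MA F a A v}.

Ltac wtime := rewrite /=;
  match goal with
  | H : is_true (leq _ ?tt) |- is_true (leq _ ?g) =>
      is_var tt; match g with context [tt] => idtac end; clear -H; lia
  | _ => lia
  end.
Ltac wif := lazymatch goal with H : machine_ok _ _ _ _ |- _ =>
  apply: (wp_ife H); [ |by []|wtime| | ] end.
Ltac wsl x := lazymatch goal with H : machine_ok _ _ _ _ |- _ =>
  apply: (wp_setl _ H (v := x)); [by []|by []|wtime| |] end.
Ltac ws := lazymatch goal with H : machine_ok _ _ _ _ |- _ =>
  apply: (wp_setv H); [by []|by []|wtime| |] end.
Ltac wsv x := lazymatch goal with H : machine_ok _ _ _ _ |- _ =>
  apply: (wp_setv H (v := x)); [by []|by []|wtime| |] end.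

(** * Search for the prime and the field *)

(** Increases register r until [e] is false for every x in register 16 from st up to the content of
    register 8. For the prime, r is 8 itself and the inner bound moves with the candidate; for the
    constant c the bound is the fixed p. *)
Definition SEARCH r e st :=
  15 ::= K 0 ;;
  Whl (Op OEq (V 15) (K 0))
    (15 ::= K 1 ;; 16 ::= K st ;;
     Whl (Op OLt (V 16) (V 8))
       (Ife e (15 ::= K 0) Skip ;; 16 ::= Op OAdd (V 16) (K 1)) ;;
     Ife (V 15) Skip (r ::= Op OAdd (V r) (K 1))).

Definition FINDM :=
  13 ::= V 2 ;; 14 ::= K 1 ;;
  Whl (Op OLt (K 31) (V 13))
    (13 ::= Op ODiv (V 13) (K 32) ;; 14 ::= Op OMul (V 14) (K 4)).

Definition RG (c i : nat) := 60 + 4 * c + i.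

Definition DRAW l := foldr (fun c d =>
  Rnd (RG c 0) ;; Rnd (RG c 1) ;; Rnd (RG c 2) ;; Rnd (RG c 3) ;; d) Skip l.

Definition PARAM l := foldr (fun c d =>
  RG c 0 ::= Op OAddW (Op OAddW (V (RG c 0)) (V (RG c 0))) (K 1) ;;
  RG c 1 ::= Op OMod (V (RG c 1)) (V 8) ;;
  RG c 2 ::= Op OMod (V (RG c 2)) (V 8) ;;
  RG c 3 ::= Op OMod (V (RG c 3)) (V 8) ;; d) Skip l.

Section Search.
Variables (w : nat) (T I : seq nat) (tape : nat -> nat) (MA : nat).
Local Notation W := (2 ^ w).
Hypothesis HW : machine_ok w T I MA.
Let W1 : 1 < W. Proof. by case: HW. Qed.
Let TW : size T < W. Proof. by case: HW. Qed.
Local Notation wp := (wp w T I tape MA).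
Local Notation ok := (ok w T I MA).
Local Notation ev := (ev w T I).

Lemma wp_SEARCH r e st (bad : nat -> nat -> bool) (bd : nat -> nat) v0 vf B t (Q : ast -> Prop) f q o :
  let g v := ~~ has (bad v) (iota st (bd v - st)) in
  (r == 8) || (r == 9) -> st < W -> B < W -> vf < W -> depth e <= 30 -> exp_size e <= 40 ->
  f r = v0 -> v0 <= vf -> g vf -> (forall v, v0 <= v < vf -> ~~ g v) ->
  (forall v, v0 <= v <= vf -> bd v <= B) ->
  (forall f' v x, agree [:: 15; 16; r] f f' -> f' r = v -> v0 <= v <= vf -> f' 16 = x -> st <= x < bd v ->
     ok f' e /\ (ev f' e != 0) = bad v x) ->
  (forall f' v, agree [:: 15; 16; r] f f' -> f' r = v -> v0 <= v <= vf -> f' 8 = bd v) ->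
  (vf - v0 + 1) * (B * 80 + 50) + 20 <= t ->
  (forall f', agree [:: 15; 16; r] f f' -> f' r = vf -> Q (Ast f' q o)) ->
  wp (SEARCH r e st) t Q (Ast f q o).
Proof.
move=> g hr hst hB hvf hde hse fr hle gvf hbad hbd hev h8 ht HQ.
have r15 : (r == 15) = false by case/orP: hr => /eqP->.
have r16 : (r == 16) = false by case/orP: hr => /eqP->.
have r130 : r < 130 by case/orP: hr => /eqP->.
have ht0 : 20 <= t by apply: leq_trans ht; rewrite leq_addl.
wsv 0; first by rewrite /=; split => //; lia.
pose Inv (mu : nat) (st : ast) := exists f2 v d, [/\ st = Ast f2 q o, agree [:: 15; 16; r] f f2, f2 r = v /\ f2 15 = d,
  v0 <= v <= vf & if d == 0 then mu = vf - v + 1 else v = vf].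
have [tb htb0 htb] : exists2 tb, tb = B * 80 + 40 & B * 80 + 40 <= tb by exists (B * 80 + 40).
apply: (wp_whl HW (Inv := Inv) (k := vf - v0 + 1) (tb := tb)) => //.
- move=> mu s1 [f2 [v [d [-> ag [rr rd] hv hd]]]] /=.
  rewrite rd; split.
  + by split => //; lia.
  + by move=> E; move: hd; case: eqP E => //= _ _ hd; apply: HQ => //; rewrite rr.
  case: eqP hd => //= _ hmu _; split; first by lia.
  wsv 1; first by [].
  wsv st; first by [].
  set f3 := upd _ 16 _.
  have ag3 : agree [:: 15; 16; r] f f3 by do 2!(apply: agree_upd => //).
  have r3 : f3 r = v by rewrite /f3 !upd_ne ?r15 ?r16.
  have r3_15 : f3 15 = 1 by [].
  have r3_16 : f3 16 = st by [].
  pose Inv2 (mu : nat) (s1 : ast) := exists f4 x, [/\ s1 = Ast f4 q o, agree [:: 15; 16; r] f f4, f4 r = v,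
     [/\ f4 16 = x, st <= x & x + mu = maxn st (bd v)] & f4 15 = ~~ has (bad v) (iota st (x - st))].
  clearbody f3.
  apply: (wp_seq HW (t1 := B * 80 + 10)); last by wtime.
  have hbv := hbd v hv.
  apply: (wp_whl HW (Inv := Inv2) (k := maxn st (bd v) - st) (tb := 60)) => //.
  + move=> mu2 s2 [f4 [x [-> ag4 r4 [r4_16 hx1 hx2] r4_15]]] /=.
    have e8 : f4 8 = bd v by apply: (h8 f4).
    rewrite e8 r4_16; split=> //.
    * move=> E; have {}E : bd v <= x by move: E; case: ltnP.
      have Eb : has (bad v) (iota st (x - st)) = has (bad v) (iota st (bd v - st)).
        by congr (has _ (iota _ _)); move: E hx1 hx2; clear; lia.
      rewrite Eb in r4_15.
      wif; first by [].
        rewrite /= r4_15 -/(g v) => gv; apply: wp_skip.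
        have Ev : v = vf.
          apply/eqP; rewrite eqn_leq; case/andP: hv => hv0 -> /=; rewrite leqNgt; apply/negP => hlt.
          by move: gv; rewrite (negPf (hbad v _)) // hv0.
        by exists f4, v, (g v : nat); split => //; case: (g v) gv.
      rewrite /= r4_15 -/(g v) => gv.
      have {}gv : ~~ g v by case: (g v) gv.
      have hlt : v < vf by case/andP: hv => _; rewrite leq_eqVlt => /orP[/eqP Ev|//]; rewrite Ev gvf in gv.
      wsl v.+1; first by rewrite /= r4 addn1; do ![split => //]; exact: leq_ltn_trans hvf.
      exists (upd f4 r v.+1), v.+1, 0; split => //.
      -- by apply: agree_upd => //; rewrite !inE eqxx !orbT.
      -- by rewrite /upd eqxx (eq_sym 15) r15 r4_15 -/(g v) (negPf gv).
      -- by rewrite hlt andbT; case/andP: hv => h _; apply: leq_trans h _.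
      -- by rewrite /=; move: hmu hlt; clear; lia.
    * move=> E; have {}E : x < bd v by case: (x < bd v) E.
      split; first by move: E hx1 hx2; clear; lia.
      have hxb : st <= x < bd v by rewrite hx1 E.
      have [oke eve] := hev f4 v x ag4 r4 hv r4_16 hxb.
      have xW : x.+1 < W by apply: leq_ltn_trans hB; apply: leq_trans E _.
      have Eh : iota st (x.+1 - st) = rcons (iota st (x - st)) x.
        by rewrite subSn // -addn1 iotaD /= cats1 subnKC.
      have fin f5 : agree [:: 15; 16; r] f f5 -> f5 r = v -> f5 16 = x ->
          f5 15 = ~~ has (bad v) (iota st (x.+1 - st)) ->
          wp (16 ::= Op OAdd (V 16) (K 1)) 10 (Inv2 mu2.-1) (Ast f5 q o).
        move=> ag5 r5 r5_16 r5_15; wsl x.+1; first by rewrite /= r5_16 addn1; do ![split => //].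
        exists (upd f5 16 x.+1), x.+1; split => //.
        -- by apply: agree_upd.
        -- by rewrite upd_ne // r16.
        -- by split=> //; move: E hx1 hx2; clear; lia.
      apply: (wp_seq HW (t1 := 50)) => //.
      apply: (wp_ife HW) => //; first by move: hse; clear; lia.
      -- rewrite /= eve => hb; wsl 0; first by rewrite /=; split=> //; lia.
         apply: fin => //; first by apply: agree_upd.
           by rewrite upd_ne // r15.
         by rewrite Eh has_rcons hb.
      -- rewrite /= => hb; apply: wp_skip; apply: fin => //.
         have {}hb : bad v x = false by rewrite -eve hb.
         by rewrite Eh has_rcons hb.
  + exists f3, st; split => //; last by rewrite subnn.
    by split=> //; lia.
  + by rewrite /=; move: hbv; clear; lia.
- exists (upd f 15 0), v0, 0; split => //.
  + by apply: agree_upd.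
  + by rewrite upd_ne ?r15.
  + by rewrite leqnn.
- by rewrite htb0 /=; move: ht; clear; nia.
Qed.

Lemma wp_FINDM t (Q : ast -> Prop) f q o :
  31 < size T -> f 2 = size T -> size T * 40 + 30 <= t ->
  (forall f' j, agree [:: 13; 14] f f' -> f' 14 = 4 ^ j -> 32 ^ j <= size T < 32 ^ j.+1 -> Q (Ast f' q o)) ->
  wp FINDM t Q (Ast f q o).
Proof.
move=> hn f2 ht HQ.
wsv (size T); first by [].
wsv 1; first by [].
pose Inv (mu : nat) (st : ast) := exists f2 j, [/\ st = Ast f2 q o, agree [:: 13; 14] f f2,
  f2 13 = size T %/ 32 ^ j /\ f2 14 = 4 ^ j, 0 < size T %/ 32 ^ j & size T %/ 32 ^ j <= mu].
apply: (wp_whl HW (Inv := Inv) (k := size T) (tb := 20)) => //.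
- move=> mu st [f3 [j [-> ag [r13 r14] h0 hmu]]] /=.
  have p0 : 0 < 32 ^ j by rewrite expn_gt0.
  have hj : 32 ^ j <= size T by rewrite -(mul1n (32 ^ j)) -leq_divRL.
  have h4 : 4 ^ j <= 32 ^ j by case: j {r13 r14 h0 hmu p0 hj} => // j; rewrite leq_exp2r.
  rewrite r13; split=> //.
  + by split=> //; lia.
  + move=> E; apply: (HQ _ j) => //; rewrite hj /=.
    have : size T %/ 32 ^ j < 32 by move: E; case: (ltnP 31).
    by rewrite ltn_divLR // -expnS.
  + move=> E; have {}E : 31 < size T %/ 32 ^ j by move: E; case: (31 < _).
    have E2 : 32 ^ j * 32 <= size T.
      by apply: leq_trans (leq_trunc_div (size T) (32 ^ j)); rewrite mulnC leq_mul2r E orbT.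
    split; first by lia.
    wsv (size T %/ 32 ^ j.+1).
      by rewrite /= r13 -divnMA expnSr; do ![split => //]; lia.
    wsl (4 ^ j.+1).
      rewrite /= /upd /= r14 expnSr; do ![split => //]; first lia.
      by apply: leq_ltn_trans TW; apply: leq_trans E2; apply: leq_mul.
    exists (upd (upd f3 13 (size T %/ 32 ^ j.+1)) 14 (4 ^ j.+1)), j.+1; split => //.
    * by do 2!(apply: agree_upd => //).
    * by rewrite divn_gt0 ?expn_gt0 // expnSr.
    * rewrite expnSr divnMA; move: h0 hmu; clear; move: (size T %/ _) => x h0 hmu.
      have := leq_div2l; have := divn_eq x 32; lia.
- exists (upd (upd f 13 (size T)) 14 1), 0; split => //; rewrite ?divn1 //; last by lia.
  by do 2!(apply: agree_upd => //).
- by wtime.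
Qed.

Lemma wp_DRAW a k t (Q : ast -> Prop) f q o :
  a + k <= 17 -> k * 4 <= t ->
  (forall f', (forall y, (y < RG a 0) || (RG (a + k) 0 <= y) -> f' y = f y) ->
     (forall cc i, a <= cc < a + k -> i < 4 -> f' (RG cc i) = tape (q + 4 * (cc - a) + i) %% W) ->
     Q (Ast f' (q + 4 * k) o)) ->
  wp (DRAW (iota a k)) t Q (Ast f q o).
Proof.
elim: k a t f q Q => [|k IH] a t f q Q hak ht HQ.
  apply: wp_skip; rewrite -{1}(addn0 q) -(muln0 4); apply: HQ => //.
  by move=> cc i; lia.
have hRG i : i < 4 -> RG a i < 130 by rewrite /RG; lia.
rewrite /=.
do 4!(apply: (wp_seq HW (t1 := 1)); [|by lia]; apply: (wp_rnd HW) => //; first exact: hRG).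
apply: IH; [lia|lia|] => f' h1 h2.
rewrite (_ : q.+4 + 4 * k = q + 4 * k.+1); last by lia.
apply: HQ.
- move=> y hy; rewrite h1; last by move: hy; rewrite /RG; lia.
  by do 4!(rewrite upd_ne; last by apply/eqP; move: hy; rewrite /RG; lia).
- move=> cc i hcc hi; have [E|ne] := eqVneq cc a; last first.
    by rewrite h2; [congr (tape _ %% _); lia| lia|].
  rewrite E subnn muln0 addn0 h1; last by rewrite /RG; lia.
  have RGeq j j' : (RG a j == RG a j') = (j == j') by rewrite /RG eqn_add2l.
  rewrite /upd !RGeq; move: i hi {h1 h2} => [|[|[|[|i hi]]]]; last by move: hi; rewrite ltnNge.
  - by rewrite addn0.
  - by rewrite addn1.
  - by rewrite addn2.
  - by rewrite addn3.
Qed.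

Lemma wp_PARAM l p t (Q : ast -> Prop) f q o :
  uniq l -> all (fun cc => cc < 17) l -> f 8 = p -> size l * 40 <= t ->
  (forall f', (forall y, (forall cc i, cc \in l -> i < 4 -> y <> RG cc i) -> f' y = f y) ->
     (forall cc, cc \in l -> f' (RG cc 0) = odd_word w (f (RG cc 0)) /\
        (forall i, 0 < i < 4 -> f' (RG cc i) = f (RG cc i) %% p)) ->
     Q (Ast f' q o)) ->
  wp (PARAM l) t Q (Ast f q o).
Proof.
elim: l t f Q => [|cc l IH] t f Q.
  by move=> _ _ h8 ht HQ; apply: wp_skip; apply: HQ.
move=> /= /andP[hn hu] /andP[hc hl] h8 ht HQ.
have hRG i : i < 4 -> RG cc i < 130 by rewrite /RG; lia.
have n8 i : RG cc i != 8 by rewrite /RG; lia.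
have ne i j : i != j -> RG cc i != RG cc j by rewrite /RG eqn_add2l.
have RGeq j j' : (RG cc j == RG cc j') = (j == j') by rewrite /RG eqn_add2l.
rewrite mulSn in ht.
have ht0 : 40 <= t by lia.
apply: (wp_setv HW (v := odd_word w (f (RG cc 0)))); [exact: hRG|by []|by wtime| |].
  rewrite /= /odd_word; do ![split => //]; try exact: hRG.
  by rewrite modnDml.
apply: (wp_setv HW (v := f (RG cc 1) %% p)); [exact: hRG|by []|by wtime| |].
  by rewrite /= upd_ne ?ne // upd_ne 1?eq_sym // h8; do ![split=> //]; exact: hRG.
apply: (wp_setv HW (v := f (RG cc 2) %% p)); [exact: hRG|by []|by wtime| |].
  by rewrite /= /upd !RGeq !(eq_sym 8) !(negPf (n8 _)) h8; do ![split=> //]; exact: hRG.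
apply: (wp_setv HW (v := f (RG cc 3) %% p)); [exact: hRG|by []|by wtime| |].
  by rewrite /= /upd !RGeq !(eq_sym 8) !(negPf (n8 _)) h8; do ![split=> //]; exact: hRG.
set f1 := upd _ (RG cc 3) _.
have f1y y : (forall i, i < 4 -> y <> RG cc i) -> f1 y = f y.
  by move=> hy; rewrite /f1 !upd_ne //; apply/eqP; exact: hy.
have f10 : f1 (RG cc 0) = odd_word w (f (RG cc 0)).
  by rewrite /f1 /upd !RGeq.
have f1i i : 0 < i < 4 -> f1 (RG cc i) = f (RG cc i) %% p.
  by move: i => [|[|[|[|]]]] // _; rewrite /f1 /upd !RGeq.
clearbody f1.
have RGinj cc' i i' : i < 4 -> i' < 4 -> RG cc' i = RG cc i' -> cc' = cc.
  by rewrite /RG; lia.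
apply: IH => //.
- by rewrite f1y // => i _ /eqP; rewrite eq_sym (negPf (n8 _)).
- by wtime.
move=> f' h1 h2; apply: HQ.
- move=> y hy; rewrite h1 => [|c' i' hc' hi']; last by apply: hy => //; rewrite inE hc' orbT.
  by apply: f1y => i hi; apply: hy => //; rewrite inE eqxx.
- move=> c'; rewrite inE; have [->|nec] := eqVneq c' cc.
    have hh i : i < 4 -> f' (RG cc i) = f1 (RG cc i).
      move=> hi; rewrite h1 // => c2 i2 hc2 hi2 /esym/RGinj E; move: hn; rewrite -E ?hc2 //.
    by move=> _; split=> [|i hi]; [rewrite hh | rewrite hh ?f1i //; case/andP: hi].
  move=> /= hc'; have [a1 a2] := h2 _ hc'.
  have hh i : i < 4 -> f1 (RG c' i) = f (RG c' i).
    by move=> hi; rewrite f1y // => i2 hi2 /RGinj E; rewrite E ?eqxx // in nec.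
  by split=> [|i hi]; [rewrite a1 hh|rewrite a2 // hh //; case/andP: hi].
Qed.
End Search.

(** * The sorting program *)

(* Registers: 2 = n, 3 = b, 4 = s, 5 = bound on the letters scanned, 6 = heap
   capacity m, 7 = heap base, 8 = p, 9 = c, 10 = divisor of the letter hash,
   11 = samples per copy, 12 = base of the samples, 13 and 14 = operands of
   [LT], 15 = its result, 16..49 = scratch of the comparison, 50..59 = scratch
   of the sort; [RG cc 0] is the multiplier of copy [cc] and [RG cc 1..3] its
   evaluation point. *)
Definition mmE e1 e2 := Op OMod (Op OMul e1 e2) (V 8).
Definition adE e1 e2 := Op OMod (Op OAdd e1 e2) (V 8).
Definition hlE e := Op ODiv (Op OMulW (V 28) e) (V 10).

Definition d3E a b := adE (mmE (V a.+1) (V b.+2)) (mmE (V a.+2) (V b.+1)).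
Definition d4E a b := mmE (V a.+2) (V b.+2).
Definition mulE0 a b := adE (mmE (V a) (V b)) (mmE (V 9) (d3E a b)).
Definition mulE1 a b :=
  adE (adE (mmE (V a) (V b.+1)) (mmE (V a.+1) (V b))) (adE (d3E a b) (mmE (V 9) (d4E a b))).
Definition mulE2 a b :=
  adE (adE (mmE (V a) (V b.+2)) (mmE (V a.+1) (V b.+1))) (adE (mmE (V a.+2) (V b)) (d4E a b)).

Definition MUL a b :=
  47 ::= mulE0 a b ;; 48 ::= mulE1 a b ;; 49 ::= mulE2 a b ;;
  a ::= V 47 ;; a.+1 ::= V 48 ;; a.+2 ::= V 49.

Definition PHI :=
  46 ::= Op ODiv (V 45) (V 4) ;;
  47 ::= Op OAdd (V 29) (Op OMul (V 46) (K 6)) ;;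
  30 ::= LD (V 47) ;;
  31 ::= LD (Op OAdd (V 47) (K 1)) ;;
  32 ::= LD (Op OAdd (V 47) (K 2)) ;;
  46 ::= Op OMul (V 46) (V 4) ;;
  Whl (Op OLt (V 46) (V 45))
    (MUL 30 25 ;;
     30 ::= adE (V 30) (hlE (RT (V 46))) ;;
     46 ::= Op OAdd (V 46) (K 1)).

Definition QRY (e : exp) (d : nat) :=
  45 ::= e ;; PHI ;; d ::= V 30 ;; d.+1 ::= V 31 ;; d.+2 ::= V 32.

Definition TEST (c : nat) :=
  25 ::= V (RG c 1) ;; 26 ::= V (RG c 2) ;; 27 ::= V (RG c 3) ;; 28 ::= V (RG c 0) ;;
  29 ::= Op OAdd (V 12) (Op OMul (Op OMul (K c) (V 11)) (K 6)) ;;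
  QRY (V 16) 36 ;; QRY (V 17) 39 ;;
  QRY (Op OAdd (V 16) (Op OMul (V 20) (V 4))) 42 ;;
  QRY (Op OAdd (V 17) (Op OMul (V 20) (V 4))) 30 ;;
  47 ::= Op OAdd (V 29) (Op OAdd (Op OMul (V 20) (K 6)) (K 3)) ;;
  33 ::= LD (V 47) ;;
  34 ::= LD (Op OAdd (V 47) (K 1)) ;;
  35 ::= LD (Op OAdd (V 47) (K 2)) ;;
  MUL 36 33 ;; MUL 39 33 ;;
  24 ::= Op OMul (V 24) (Op OMul (Op OEq (adE (V 42) (V 39)) (adE (V 30) (V 36)))
          (Op OMul (Op OEq (adE (V 43) (V 40)) (adE (V 31) (V 37)))
                   (Op OEq (adE (V 44) (V 41)) (adE (V 32) (V 38))))).

Definition TESTS := foldr (fun c d => TEST c ;; d) Skip (iota 0 kappa).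

Definition BSEARCH :=
  Whl (Op OLt (Op OAdd (V 18) (K 1)) (V 19))
    (20 ::= Op ODiv (Op OAdd (V 18) (V 19)) (K 2) ;;
     24 ::= K 1 ;;
     TESTS ;;
     Ife (V 24) (18 ::= V 20) (19 ::= V 20)).

Definition SCAN :=
  23 ::= V 5 ;;
  Whl (Op OMul (Op OLt (K 0) (V 23)) (Op OEq (RT (V 21)) (RT (V 22))))
    (21 ::= Op OAdd (V 21) (K 1) ;; 22 ::= Op OAdd (V 22) (K 1) ;; 23 ::= Op OSub (V 23) (K 1)) ;;
  15 ::= Op OLt (RT (V 21)) (RT (V 22)).

Definition CMPF :=
  16 ::= Op OSub (V 13) (K 1) ;; 17 ::= Op OSub (V 14) (K 1) ;;
  Ife (Op OLt (V 13) (V 14)) (23 ::= Op OAdd (Op OSub (V 2) (V 14)) (K 1))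
                             (23 ::= Op OAdd (Op OSub (V 2) (V 13)) (K 1)) ;;
  18 ::= K 0 ;; 19 ::= Op OAdd (Op ODiv (V 23) (V 4)) (K 1) ;;
  BSEARCH ;;
  21 ::= Op OAdd (V 16) (Op OMul (V 18) (V 4)) ;;
  22 ::= Op OAdd (V 17) (Op OMul (V 18) (V 4)) ;;
  SCAN.

Definition LT :=
  Ife (Op OEq (V 13) (V 14)) (15 ::= K 0)
    (Ife (V 13) (Ife (V 14) CMPF (15 ::= K 1)) (15 ::= K 0)).

Definition HP (e : exp) := Op OAdd (V 7) e.

Definition CHILD :=
  51 ::= Op OAdd (Op OAdd (V 50) (V 50)) (K 1) ;;
  Ife (Op OLt (V 51) (V 53))
    (Ife (Op OLt (Op OAdd (V 51) (K 1)) (V 53))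
      (13 ::= LD (HP (V 51)) ;; 14 ::= LD (HP (Op OAdd (V 51) (K 1))) ;; LT ;;
       Ife (V 15) (51 ::= Op OAdd (V 51) (K 1)) Skip)
      Skip)
    Skip.

Definition SIFT :=
  54 ::= K 1 ;;
  Whl (V 54)
    (CHILD ;;
     Ife (Op OLt (V 51) (V 53))
       (55 ::= LD (HP (V 51)) ;; 13 ::= V 52 ;; 14 ::= V 55 ;; LT ;;
        Ife (V 15) (Sto (HP (V 50)) (V 55) ;; 50 ::= V 51) (54 ::= K 0))
       (54 ::= K 0)) ;;
  Sto (HP (V 50)) (V 52).

Definition HSORT :=
  53 ::= V 6 ;;
  Whl (V 53)
    (53 ::= Op OSub (V 53) (K 1) ;;
     52 ::= LD (HP (V 53)) ;;
     59 ::= LD (V 7) ;;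
     50 ::= K 0 ;;
     SIFT ;;
     Sto (HP (V 53)) (V 59)).

Definition SEL :=
  52 ::= RI (V 57) ;;
  15 ::= K 1 ;;
  Ife (V 58) (13 ::= V 58 ;; 14 ::= V 52 ;; LT) Skip ;;
  Ife (V 15)
    (13 ::= V 52 ;; 14 ::= LD (V 7) ;; LT ;;
     Ife (V 15) (53 ::= V 6 ;; 50 ::= K 0 ;; SIFT) Skip)
    Skip.

Definition CLEAR :=
  57 ::= K 0 ;;
  Whl (Op OLt (V 57) (V 6)) (Sto (HP (V 57)) (K 0) ;; 57 ::= Op OAdd (V 57) (K 1)).

Definition COLLECT :=
  57 ::= K 0 ;;
  Whl (Op OLt (V 57) (V 3)) (SEL ;; 57 ::= Op OAdd (V 57) (K 1)).

Definition EMIT :=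
  57 ::= K 0 ;;
  Whl (Op OLt (V 57) (V 6))
    (55 ::= LD (HP (V 57)) ;;
     Ife (V 55) (Prt (V 55) ;; 58 ::= V 55) Skip ;;
     57 ::= Op OAdd (V 57) (K 1)).

Definition ROUND := CLEAR ;; COLLECT ;; HSORT ;; EMIT.

Definition MAIN :=
  58 ::= K 0 ;; 56 ::= V 3 ;;
  Whl (V 56)
    (ROUND ;; Ife (Op OLt (V 6) (V 56)) (56 ::= Op OSub (V 56) (V 6)) (56 ::= K 0)).

Definition STOS l := foldr (fun i d => Sto (Op OAdd (V 47) (K i)) (V (30 + i)) ;; d) Skip l.

Definition STORE :=
  Ife (Op OMod (V 45) (V 4)) Skip
    (47 ::= Op OAdd (V 29) (Op OMul (Op ODiv (V 45) (V 4)) (K 6)) ;; STOS (iota 0 6)).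

Definition BUILD c :=
  25 ::= V (RG c 1) ;; 26 ::= V (RG c 2) ;; 27 ::= V (RG c 3) ;; 28 ::= V (RG c 0) ;;
  29 ::= Op OAdd (V 12) (Op OMul (Op OMul (K c) (V 11)) (K 6)) ;;
  30 ::= K 0 ;; 31 ::= K 0 ;; 32 ::= K 0 ;; 33 ::= K 1 ;; 34 ::= K 0 ;; 35 ::= K 0 ;;
  45 ::= K 0 ;;
  Whl (Op OLt (V 45) (V 2))
    (STORE ;; MUL 30 25 ;; 30 ::= adE (V 30) (hlE (RT (V 45))) ;; MUL 33 25 ;;
     45 ::= Op OAdd (V 45) (K 1)) ;;
  STORE.

Definition BUILDS l := foldr (fun c d => BUILD c ;; d) Skip l.

Section Prog.
Variables (w : nat) (T I : seq nat) (tape : nat -> nat) (MA : nat).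
Local Notation W := (2 ^ w).
Hypothesis HW : machine_ok w T I MA.
Let W1 : 1 < W. Proof. by case: HW. Qed.
Let TW : size T < W. Proof. by case: HW. Qed.
Local Notation n := (size T).
Local Notation wp := (wp w T I tape MA).
Local Notation ok := (ok w T I MA).
Local Notation ev := (ev w T I).

Variables (s lim m hb p c D q1 sb : nat).
Variables (rr g0 g1 g2 : nat -> nat).
Local Notation gg cc := ((g0 cc, g1 cc, g2 cc) : tri).
Local Notation PH cc := (phi p c W D (rr cc) (gg cc)).
Local Notation PWc cc := (pw p c (gg cc)).
Local Notation c0 x := ((x : tri).1.1) (only parsing).
Local Notation c1 x := ((x : tri).1.2) (only parsing).
Local Notation c2 x := ((x : tri).2) (only parsing).

(* Sample k of copy cc: the fingerprint of the first k * s letters (i < 3) and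
   the power of the evaluation point by k * s (3 <= i < 6). *)
Definition addr cc k i := sb + (cc * q1 + k) * 6 + i.

Record envL (f : nat -> nat) : Prop := EnvL {
  eP : f 8 = p; eC : f 9 = c; eD : f 10 = D; eQ : f 11 = q1; eSB : f 12 = sb;
  eR : forall cc, cc < kappa -> f (RG cc 0) = rr cc;
  eG0 : forall cc, cc < kappa -> f (RG cc 1) = g0 cc;
  eG1 : forall cc, cc < kappa -> f (RG cc 2) = g1 cc;
  eG2 : forall cc, cc < kappa -> f (RG cc 3) = g2 cc;
  eS : forall cc k, cc < kappa -> k * s <= n ->
    [/\ f (addr cc k 0) = c0 (PH cc (take (k * s) T)),
        f (addr cc k 1) = c1 (PH cc (take (k * s) T)) &
        f (addr cc k 2) = c2 (PH cc (take (k * s) T))] /\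
    [/\ f (addr cc k 3) = c0 (PWc cc (k * s)),
        f (addr cc k 4) = c1 (PWc cc (k * s)) &
        f (addr cc k 5) = c2 (PWc cc (k * s))] }.

(** The sample table is demanded only for s > 0, so that one verification of the sort covers both
    the fingerprint comparison and the letter-by-letter one. *)
Record env (f : nat -> nat) : Prop := Env {
  eN : f 2 = n; eB : f 3 = size I; eSs : f 4 = s; eLim : f 5 = lim; eM : f 6 = m; eHB : f 7 = hb;
  eL : 0 < s -> envL f }.

Definition scr (x : nat) : bool := (12 < x) && (x < 60).
(** Cells that may hold the heap: those between the registers and the samples for long texts,
    register 0 alone for short ones. *)
Definition hcell (x : nat) : bool := (x == 0) || ((160 <= x) && (x < sb)).

Record sampling_ok : Prop := Big {
  bpp : prime p; bcp : c < p; bp2 : p * p <= n;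
  bwf : forall cc, wf3 p (gg cc);
  brr : forall cc, rr cc < W;
  bD : D < W; bD0 : 0 < D; bsb : 160 <= sb;
  bhl : forall r x, hl W D r x < p;
  bq : n %/ s < q1;
  bmem : sb + kappa * q1 * 6 <= MA; bmemW : sb + kappa * q1 * 6 < W }.

Hypothesis Hbig : 0 < s -> sampling_ok.
Hypothesis Hsb : 160 <= sb.

Lemma env_chg f f' : env f -> (forall x, ~~ scr x -> ~~ hcell x -> f' x = f x) -> env f'.
Proof.
case=> e2 e3 e4 e5 e6 e7 eL H; split; try by rewrite H.
move=> s0; case: (eL s0) => h1 h2 h3 h4 h5 h6 h7 h8 h9 h10.
have hRG cc i : cc < kappa -> i < 4 -> f' (RG cc i) = f (RG cc i).
  by move=> hc hi; apply: H; rewrite /RG /scr /hcell; move: hc; rewrite /kappa; lia.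
have hA cc k i : f' (addr cc k i) = f (addr cc k i).
  by apply: H; rewrite /addr /scr /hcell; move: ((cc * q1 + k) * 6) => z; lia.
split; rewrite ?H //; try (by move=> cc hc; rewrite hRG // -?h6 -?h7 -?h8 -?h9).
by move=> cc k hc hk; rewrite !hA; exact: h10.
Qed.

Lemma env_agree X f f' : env f -> agree X f f' -> all scr X -> env f'.
Proof.
move=> he ha /allP hX; apply: (env_chg he) => x hx _; apply: ha.
by apply: contra hx => /hX.
Qed.

Lemma env_upd f d v : scr d -> env f -> env (upd f d v).
Proof.
move=> hd he; apply: (@env_agree [:: d]) he _ _; last by rewrite /= hd.
by move=> x; rewrite inE /upd => /negPf ->.
Qed.

Definition okp f e v := [/\ ok f e, ev f e = v & v < p].

Lemma okp_V f a v : a < 130 -> f a = v -> v < p -> okp f (V a) v.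
Proof. by move=> h1 h2 h3; split. Qed.

(** * Fingerprint arithmetic in machine words *)

Section Arith.
Hypothesis Hb : sampling_ok.
Let p0 : 0 < p. Proof. by case: Hb => /prime_gt0. Qed.
Let pW : p * p < W. Proof. by case: Hb => _ _ h *; lia. Qed.
Let ppW : p + p < W. Proof. have p1 : 1 < p by case: Hb => /prime_gt1. apply: leq_ltn_trans pW. nia. Qed.

Lemma okp_mm f e1 e2 v1 v2 : f 8 = p -> okp f e1 v1 -> okp f e2 v2 ->
  okp f (mmE e1 e2) (mm p v1 v2).
Proof.
move=> h8 [a1 a2 a3] [b1 b2 b3]; split; rewrite /= ?a2 ?b2 ?h8 //; last by rewrite ltn_mod.
by do 2!split => //; apply: leq_ltn_trans pW; apply: leq_mul; apply: ltnW.
Qed.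

Lemma okp_ad f e1 e2 v1 v2 : f 8 = p -> okp f e1 v1 -> okp f e2 v2 ->
  okp f (adE e1 e2) (ad p v1 v2).
Proof.
move=> h8 [a1 a2 a3] [b1 b2 b3]; split; rewrite /= ?a2 ?b2 ?h8 //; last by rewrite ltn_mod.
by do 2!split => //; apply: leq_ltn_trans ppW; apply: leq_add; apply: ltnW.
Qed.

Lemma mul_ok f a b (x y : tri) : f 8 = p -> f 9 = c -> a + 2 < 130 -> b + 2 < 130 ->
  (f a, f a.+1, f a.+2) = x -> (f b, f b.+1, f b.+2) = y -> wf3 p x -> wf3 p y ->
  [/\ okp f (mulE0 a b) (mul3 p c x y).1.1, okp f (mulE1 a b) (mul3 p c x y).1.2 &
     okp f (mulE2 a b) (mul3 p c x y).2].
Proof.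
move=> h8 h9 ha hb' <- <- /and3P[x0 x1 x2] /and3P[y0 y1 y2].
have cp : c < p by case: Hb.
have P3 : okp f (d3E a b) (ad p (mm p (f a.+1) (f b.+2)) (mm p (f a.+2) (f b.+1))).
  by apply: okp_ad => //; apply: okp_mm => //; apply: okp_V => //; lia.
have P4 : okp f (d4E a b) (mm p (f a.+2) (f b.+2)).
  by apply: okp_mm => //; apply: okp_V => //; lia.
split; rewrite /= /mulE0 /mulE1 /mulE2;
  repeat first [exact: P3 | exact: P4 | apply: okp_ad => // | apply: okp_mm => //
    | apply: okp_V => //; lia ].
Qed.

(** The operand pairs that occur in the program; with concrete numbers the disjointness of the
    registers is decided by computation. *)
Definition mulregs : seq (nat * nat) := [:: (30,25); (33,25); (36,33); (39,33)].

Lemma wp_MUL a b (x y : tri) t (Q : ast -> Prop) f q o : (a, b) \in mulregs ->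
  f 8 = p -> f 9 = c ->
  (f a, f a.+1, f a.+2) = x -> (f b, f b.+1, f b.+2) = y -> wf3 p x -> wf3 p y -> 210 <= t ->
  (forall f', agree [:: 47; 48; 49; a; a.+1; a.+2] f f' ->
     (f' a, f' a.+1, f' a.+2) = mul3 p c x y -> Q (Ast f' q o)) ->
  wp (MUL a b) t Q (Ast f q o).
Proof.
move=> hab h8 h9 hx hy wx wy ht HQ.
have solve a' b' : (a', b') = (a, b) -> a' + 2 < 130 -> b' + 2 < 130 ->
    (forall v, let f1 := upd f 47 v in [/\ f1 8 = p, f1 9 = c, (f1 a', f1 a'.+1, f1 a'.+2) = x & (f1 b', f1 b'.+1, f1 b'.+2) = y]) ->
    (forall v u, let f1 := upd (upd f 47 v) 48 u in [/\ f1 8 = p, f1 9 = c, (f1 a', f1 a'.+1, f1 a'.+2) = x & (f1 b', f1 b'.+1, f1 b'.+2) = y]) ->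
    (forall v0 v1 v2, let f3 := upd (upd (upd f 47 v0) 48 v1) 49 v2 in
       wp (a' ::= V 47 ;; a'.+1 ::= V 48 ;; a'.+2 ::= V 49) 12 (fun s' => exists2 f', s' = Ast f' q o &
         agree [:: 47; 48; 49; a'; a'.+1; a'.+2] f f' /\ (f' a', f' a'.+1, f' a'.+2) = (v0, v1, v2)) (Ast f3 q o)) ->
    wp (MUL a' b') t Q (Ast f q o).
  move=> [Ea Eb] ha hb' H1 H2 H3; rewrite Ea Eb in ha hb' H1 H2 H3 *.
  have [[ok0 ev0 _] _ _] := @mul_ok f a b x y h8 h9 ha hb' hx hy wx wy.
  apply: (wp_setv HW); [by []|by []|by rewrite /=; lia|by split; [exact: ok0|exact: ev0]|].
  have [p1 c1 x1 y1] := H1 (mul3 p c x y).1.1.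
  have [_ [ok1 ev1 _] _] := mul_ok p1 c1 ha hb' x1 y1 wx wy.
  apply: (wp_setv HW); [by []|by []|by rewrite /=; lia|by split; [exact: ok1|exact: ev1]|].
  have [p2 c2 x2 y2] := H2 (mul3 p c x y).1.1 (mul3 p c x y).1.2.
  have [_ _ [ok2 ev2 _]] := mul_ok p2 c2 ha hb' x2 y2 wx wy.
  apply: (wp_setv HW); [by []|by []|by rewrite /=; lia|by split; [exact: ok2|exact: ev2]|].
  apply: (wp_mono (H3 _ _ _)); first by rewrite /=; lia.
  move=> s' [f' -> [ag eq]]; apply: HQ => //.
  by rewrite eq; case: (mul3 p c x y) => [[? ?] ?].
have fin a' f3 v0 v1 v2 : a' < 45 -> agree [:: 47; 48; 49; a'; a'.+1; a'.+2] f f3 ->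
   f3 47 = v0 -> f3 48 = v1 -> f3 49 = v2 ->
   wp (a' ::= V 47 ;; a'.+1 ::= V 48 ;; a'.+2 ::= V 49) 12 (fun s' => exists2 f', s' = Ast f' q o &
         agree [:: 47; 48; 49; a'; a'.+1; a'.+2] f f' /\ (f' a', f' a'.+1, f' a'.+2) = (v0, v1, v2)) (Ast f3 q o).
  move=> ha' ag e0 e1 e2.
  have l1 : (48 == a') = false by lia.
  have l2 : (49 == a'.+1) = false by lia.
  have l3 : (49 == a') = false by lia.
  apply: (wp_set_seq HW) => //=; first by lia.
  apply: (wp_set_seq HW) => //=; first by lia.
  apply: (wp_set _ HW) => //=; first by lia.
  eexists; first by [].
  split; last first.
    rewrite /upd !eqxx l1 l2 l3 e0 e1 e2.
    have -> : (a' == a'.+2) = false by lia.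
    have -> : (a' == a'.+1) = false by lia.
    by have -> : (a'.+1 == a'.+2) = false by lia.
  by do 3!(apply: agree_upd; first by rewrite !inE eqxx ?orbT).
have ag3 a' v0 v1 v2 : agree [:: 47; 48; 49; a'; a'.+1; a'.+2] f (upd (upd (upd f 47 v0) 48 v1) 49 v2).
  by do 3!(apply: agree_upd; first by rewrite !inE eqxx ?orbT).
move: hab; rewrite !inE => /or4P[] /eqP[Ea Eb]; rewrite Ea Eb in solve hx hy *;
  (apply: solve => //; move=> v0 v1 v2; apply: fin => //).
Qed.

Lemma addr_lt cc k i : cc < kappa -> k < q1 -> i < 6 -> addr cc k i < sb + kappa * q1 * 6.
Proof.
move=> hc hk hi; rewrite /addr -addnA ltn_add2l.
have h : (cc * q1 + k).+1 <= kappa * q1.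
  apply: leq_trans (_ : cc.+1 * q1 <= _); first by rewrite mulSn addnC ltn_add2r.
  by rewrite leq_mul2r hc orbT.
lia.
Qed.

Lemma ntmp_sb x : sb <= x -> ~~ tmp x.
Proof. by rewrite /tmp => h; lia. Qed.

Lemma div_lt_q1 x : 0 < s -> x <= n -> x %/ s < q1.
Proof. by case: Hb => *; apply: leq_ltn_trans (leq_div2r _ _) _; eassumption. Qed.

Definition TPHI := 260 * (s + 1).

(** Horner's rule resumes at the sample preceding x and reads only x mod s letters, hence a cost
    linear in s. *)
Lemma wp_PHI cc x t (Q : ast -> Prop) f q o :
  cc < kappa -> 0 < s -> env f -> f 25 = g0 cc -> f 26 = g1 cc -> f 27 = g2 cc -> f 28 = rr cc ->
  f 29 = addr cc 0 0 -> f 45 = x -> x <= n -> TPHI <= t ->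
  (forall f', agree [:: 30; 31; 32; 46; 47; 48; 49] f f' ->
     (f' 30, f' 31, f' 32) = PH cc (take x T) -> Q (Ast f' q o)) ->
  wp PHI t Q (Ast f q o).
Proof.
move=> hcc s0 he h25 h26 h27 h28 h29 h45 hx ht HQ.
have [e2 _ e4 _ _ _ /(_ s0) eL] := he.
have [e8 e9 e10 e11 e12 _ _ _ _ eS] := eL.
have hk := div_lt_q1 s0 hx.
have hks : x %/ s * s <= n by apply: leq_trans (leq_trunc_div _ _) hx.
have ha i : i < 6 -> addr cc (x %/ s) i < sb + kappa * q1 * 6 by exact: addr_lt.
have [_ _ _ _ _ _ _ _ _ _ hmMA hmW] := Hb.
have haE i : addr cc (x %/ s) i = addr cc 0 0 + x %/ s * 6 + i by rewrite /addr; lia.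
have hsb k i : sb <= addr cc k i by rewrite /addr -addnA leq_addr.
have [[s1 s2 s3] _] := eS cc (x %/ s) hcc hks.
rewrite !haE in s1 s2 s3.
have hA i : i < 6 -> [/\ addr cc 0 0 + x %/ s * 6 + i < W, addr cc 0 0 + x %/ s * 6 + i <= MA
    & ~~ tmp (addr cc 0 0 + x %/ s * 6 + i)].
  move=> hi; have := ha i hi; rewrite haE => h; split.
  - exact: ltn_trans h hmW.
  - exact: leq_trans (ltnW h) hmMA.
  - by apply: ntmp_sb; rewrite -addnA (leq_trans (hsb 0 0)) // leq_addr.
have [w0 a0 t0] := hA 0 isT; have [w1 a1 t1] := hA 1 isT; have [w2 a2 t2] := hA 2 isT.
rewrite addn0 in w0 a0 t0 s1.
have big0 : 160 <= addr cc 0 0 + x %/ s * 6.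
  by apply: leq_trans Hsb _; apply: leq_trans (hsb 0 0) _; apply: leq_addr.
have big1 : 160 <= addr cc 0 0 + x %/ s * 6 + 1 by apply: leq_trans big0 _; apply: leq_addr.
have big2 : 160 <= addr cc 0 0 + x %/ s * 6 + 2 by apply: leq_trans big0 _; apply: leq_addr.
have w6 : 6 < W by apply: leq_ltn_trans w0; apply: leq_trans (leq_addr _ _); apply: leq_trans (hsb 0 0); apply: leq_trans Hsb.
have ht0 : 260 <= t by move: ht; rewrite /TPHI; lia.
apply: (wp_setv HW (v := x %/ s)) => //=; [lia|by rewrite h45 e4|].
apply: (wp_setv HW (v := addr cc 0 0 + x %/ s * 6)) => //=; [lia| |].
  by rewrite /upd /= h29; do ![split => //]; apply: leq_ltn_trans w0; rewrite leq_addl.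
wsv (PH cc (take (x %/ s * s) T)).1.1; first by apply: (ld_var (A := addr cc 0 0 + x %/ s * 6)) => //; rewrite !upd_arr.
wsv (PH cc (take (x %/ s * s) T)).1.2.
  by apply: (ld_add (A := addr cc 0 0 + x %/ s * 6)) => //; rewrite !upd_arr.
wsv (PH cc (take (x %/ s * s) T)).2.
  apply: (ld_add (A := addr cc 0 0 + x %/ s * 6)) => //; first exact: ltn_trans w6.
  by rewrite !upd_arr.
apply: (wp_setv HW (v := x %/ s * s)) => //=; [lia| |].
  by rewrite /upd /= e4; do ![split => //]; exact: leq_ltn_trans hks TW.
set f1 := upd _ 46 _.
pose Inv (k : nat) (st : ast) := exists f2 y, [/\ st = Ast f2 q o,
  agree [:: 30; 31; 32; 46; 47; 48; 49] f f2, f2 46 = y /\ y + k = x &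
  (f2 30, f2 31, f2 32) = PH cc (take y T)].
apply: (wp_whl HW (Inv := Inv) (k := x %% s) (tb := 245)) => //.
- move=> k st [f2 [y [-> ag [h46 hy] hph]]] /=.
  have e45 : f2 45 = x by rewrite (ag 45 isT).
  rewrite h46 e45; split => //.
  + move=> hlt; apply: HQ => //.
    have -> : x = y by move: hlt; case: ltnP => //; lia.
    exact: hph.
  + move=> hlt; have {}hlt : y < x by move: hlt; case: ltnP.
    split; first lia.
    have he2 : env f2 by apply: env_agree ag _.
    have [_ _ _ _ _ _ /(_ s0) eL2] := he2.
    have [r8 r9 r10 _ _ _ _ _ _ _] := eL2.
    apply: (wp_seq HW (t1 := 210)) => //.
    have wfp := wf_phi c W D (rr cc) (gg cc) (bpp Hb) (take y T).
    apply: (@wp_MUL 30 25 _ _ _ _ f2 q o isT r8 r9 hph _ wfp (bwf Hb cc)) => //.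
      by rewrite (ag 25 isT) (ag 26 isT) (ag 27 isT) h25 h26 h27.
    move=> f3 ag3 hm.
    have hyn : y < n by lia.
    have r3 z : z \notin [:: 47; 48; 49; 30; 31; 32] -> f3 z = f2 z := ag3 z.
    have [m0 m1 m2] : [/\ f3 30 < p, f3 31 < p & f3 32 < p].
      by have := wf_mul3 c (bpp Hb) (PH cc (take y T)) (gg cc); rewrite -hm => /and3P.
    have hrc : PH cc (take y.+1 T) = stp p c W D (rr cc) (gg cc) (PH cc (take y T)) (nth 0 T y).
      by rewrite (take_nth 0 hyn) /phi foldl_rcons.
    apply: (wp_setv HW (v := ad p (f3 30) (hl W D (rr cc) (nth 0 T y)))) => //.
      have [] : okp f3 (adE (V 30) (hlE (RT (V 46)))) (ad p (f3 30) (hl W D (rr cc) (nth 0 T y))).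
        apply: okp_ad; first by rewrite r3.
          by apply: okp_V.
        by split; rewrite /= ?r3 // ?(ag 28 isT) ?h28 ?h46 ?r10 //; exact: (bhl Hb).
      by [].
    wsl (y + 1).
      rewrite /= /upd /= r3 // h46; do ![split => //]; lia.
    exists (upd (upd f3 30 (ad p (f3 30) (hl W D (rr cc) (nth 0 T y)))) 46 (y + 1)), (y + 1); split => //.
    * do 2!(apply: agree_upd => //); apply: agree_trans ag _.
      exact: agree_sub_all ag3.
    * split; [by []|lia].
    * by rewrite addn1 hrc /stp -hm /upd.
- exists f1, (x %/ s * s); split => //.
  + by rewrite /f1; do 6!(apply: agree_upd => //).
  + by split => //; rewrite -divn_eq.
  + by rewrite /f1 /upd /=; case: (PH cc _) => [[? ?] ?].
- have := ltn_pmod x s0 => h; rewrite /=; move: ht; rewrite /TPHI; nia.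
Qed.

Definition teqc cc a b l := teq p c W D (rr cc) (gg cc) T a b l.

Lemma upd_RG f d v cc i : d < 60 -> upd f d v (RG cc i) = f (RG cc i).
Proof. by move=> hd; apply: upd_ne; rewrite /RG; lia. Qed.

Lemma RG130 cc i : cc < kappa -> i < 4 -> RG cc i < 130.
Proof. by rewrite /kappa /RG; lia. Qed.

Definition par5 cc (f : nat -> nat) :=
  [/\ f 25 = g0 cc, f 26 = g1 cc, f 27 = g2 cc, f 28 = rr cc & f 29 = addr cc 0 0].

Lemma par5_agree cc X f f' : par5 cc f -> agree X f f' -> all (fun x => 29 < x) X -> par5 cc f'.
Proof.
move=> [h1 h2 h3 h4 h5] ag /allP hX.
by split; rewrite ag //; apply/negP => /hX.
Qed.

Definition qryregs d := [:: 30; 31; 32; 45; 46; 47; 48; 49; d; d.+1; d.+2].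

Lemma wp_QRY cc e d x t (Q : ast -> Prop) f q o :
  d \in [:: 30; 36; 39; 42] -> cc < kappa -> 0 < s -> env f -> par5 cc f ->
  depth e <= 30 -> exp_size e <= 50 -> ok f e -> ev f e = x -> x <= n -> TPHI + 70 <= t ->
  (forall f', agree (qryregs d) f f' -> (f' d, f' d.+1, f' d.+2) = PH cc (take x T) -> Q (Ast f' q o)) ->
  wp (QRY e d) t Q (Ast f q o).
Proof.
move=> hd hcc s0 he hp hde hsz hok hev hx ht HQ.
apply: (wp_setv HW (v := x)) => //; first by lia.
have [p1 p2 p3 p4 p5] := hp.
apply: (wp_seq HW (t1 := TPHI)); last by lia.
apply: (@wp_PHI cc x) => //; first exact: env_upd.
move=> f1 ag1 r1.
have ag2 : agree (qryregs d) f f1.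
  by apply: agree_trans (agree_sub_all _ ag1) => //; apply: agree_upd.
move: hd r1 HQ ag2; rewrite !inE => /or4P[] /eqP-> r1 HQ ag2;
  (ws; first by []); (ws; first by []); (apply: (wp_setl _ HW); [by []|by []|rewrite /=; lia|by []|]);
  apply: HQ; rewrite ?/upd //=; do 3!(apply: agree_upd => //).
Qed.

Definition TTEST := 4 * TPHI + 1000.
Definition XT := iota 24 26.

(** Four prefix fingerprints are computed, but the power of the evaluation point by mid * s is read
    from sample number mid, which is why samples store powers too. Register 24 accumulates the
    conjunction over the copies as a product. *)
Lemma wp_TEST cc a b mid (F : bool) t (Q : ast -> Prop) f q o :
  cc < kappa -> 0 < s -> env f -> f 16 = a -> f 17 = b -> f 20 = mid -> f 24 = F ->
  a + mid * s <= n -> b + mid * s <= n -> TTEST <= t ->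
  (forall f', agree XT f f' -> f' 24 = F && teqc cc a b (mid * s) -> Q (Ast f' q o)) ->
  wp (TEST cc) t Q (Ast f q o).
Proof.
move=> hcc s0 he h16 h17 h20 h24 ha hb' ht HQ.
have [e2 _ e4 _ _ _ /(_ s0) eL] := he.
have [e8 e9 e10 e11 e12 eR0 eR1 eR2 eR3 eS0] := eL.
have [_ _ _ _ _ _ _ _ _ _ hmMA hmW] := Hb.
have ht0 : 4 * TPHI + 1000 <= t by [].
have hrg i : i < 4 -> RG cc i < 130 by exact: RG130.
have hmn : mid * s <= n by apply: leq_trans ha; exact: leq_addl.
have hmq : mid < q1.
  apply: leq_ltn_trans (div_lt_q1 s0 (leqnn n)); by rewrite leq_divRL.
have han : a <= n by apply: leq_trans ha; exact: leq_addr.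
have hbn : b <= n by apply: leq_trans hb'; exact: leq_addr.
have hm3 := addr_lt hcc hmq (isT : 3 < 6).
have hm4 := addr_lt hcc hmq (isT : 4 < 6).
have hm5 := addr_lt hcc hmq (isT : 5 < 6).
have hc0 := addr_lt hcc (leq_ltn_trans (leq0n _) hmq) (isT : 0 < 6).
have hsb i : sb <= addr cc mid i by rewrite /addr -addnA leq_addr.
have haE i : addr cc mid i = addr cc 0 0 + (mid * 6 + i) by rewrite /addr; lia.
have addrW i : addr cc mid i < sb + kappa * q1 * 6 -> addr cc mid i < W by move=> h; exact: ltn_trans h hmW.
have addrM i : addr cc mid i < sb + kappa * q1 * 6 -> addr cc mid i <= MA by move=> h; exact: leq_trans (ltnW h) hmMA.
have w160 : 160 < W.
  by apply: leq_ltn_trans (addrW 3 hm3); apply: leq_trans Hsb (hsb 3).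
have wfP x := wf_phi c W D (rr cc) (gg cc) (bpp Hb) x.
wsv (g0 cc); first by split; [exact: hrg|rewrite /= eR1].
wsv (g1 cc); first by split; [exact: hrg|rewrite /= upd_RG // eR2].
wsv (g2 cc); first by split; [exact: hrg|rewrite /= !upd_RG // eR3].
wsv (rr cc); first by split; [exact: hrg|rewrite /= !upd_RG // eR0].
wsv (addr cc 0 0).
  have a1 : cc * q1 * 6 < W by apply: leq_ltn_trans (addrW 3 hm3); rewrite /addr; lia.
  have a2 : cc * q1 < W by apply: leq_ltn_trans a1; lia.
  have a3 : cc < W by apply: leq_trans hcc _; apply: leq_trans (ltnW w160).
  rewrite /= /upd /= e11 e12; do ![split => //]; last by rewrite /addr !addn0.
    by apply: ltn_trans w160.
  by apply: leq_ltn_trans (ltn_trans hc0 hmW); rewrite /addr !addn0.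
have hp1 : par5 cc (upd (upd (upd (upd (upd f 25 (g0 cc)) 26 (g1 cc)) 27 (g2 cc)) 28 (rr cc)) 29 (addr cc 0 0)) by [].
set F1 := upd _ 29 _ in hp1 *.
have hE1 : env F1 by do 5!(apply: env_upd => //).
have agF1 : agree (iota 25 5) f F1 by do 5!(apply: agree_upd => //).
apply: (wp_seq HW (t1 := TPHI + 70)); last by rewrite /=; lia.
apply: (@wp_QRY cc _ 36 a) => // f1 ag1 r1.
have hE2 := env_agree hE1 ag1 isT; have hp2 := par5_agree hp1 ag1 isT.
apply: (wp_seq HW (t1 := TPHI + 70)); last by rewrite /=; lia.
apply: (@wp_QRY cc _ 39 b) => //; first by rewrite /= ag1.
move=> f2 ag2 r2.
have hE3 := env_agree hE2 ag2 isT; have hp3 := par5_agree hp2 ag2 isT.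
have v16 : f2 16 = a by rewrite ag2 // ag1.
have v17 : f2 17 = b by rewrite ag2 // ag1.
have v20 : f2 20 = mid by rewrite ag2 // ag1.
have v4 : f2 4 = s by case: hE3.
apply: (wp_seq HW (t1 := TPHI + 70)); last by rewrite /=; lia.
have W_l x : x <= n -> x < W by move=> h; exact: leq_ltn_trans h TW.
apply: (@wp_QRY cc _ 42 (a + mid * s)) => //; rewrite /= ?v16 ?v20 ?v4 //.
  by do ![split => //]; exact: W_l.
move=> f3 ag3 r3.
have hE4 := env_agree hE3 ag3 isT; have hp4 := par5_agree hp3 ag3 isT.
apply: (wp_seq HW (t1 := TPHI + 70)); last by rewrite /=; lia.
apply: (@wp_QRY cc _ 30 (b + mid * s)) => //; rewrite /= ?(ag3 17) ?(ag3 20) ?(ag3 4) // ?v17 ?v20 ?v4 //.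
  by do ![split => //]; exact: W_l.
move=> f4 ag4 r4.
have hE5 := env_agree hE4 ag4 isT; have [_ _ _ _ p29] := par5_agree hp4 ag4 isT.
have agf4 : agree (iota 25 25) f f4.
  by do 5!(apply: agree_trans; [|apply: agree_sub_all; [|eassumption]; [by []]]) => //.
wsv (addr cc mid 3).
  rewrite /= p29 ag4 // ag3 // v20 -haE; do ![split => //].
  - exact: ltn_trans w160.
  - by apply: leq_ltn_trans (addrW 3 hm3); rewrite haE; lia.
  - exact: ltn_trans w160.
  - by apply: leq_ltn_trans (addrW 3 hm3); rewrite haE; lia.
  - exact: addrW.
have [_ _ _ _ _ _ /(_ s0) [_ _ _ _ _ _ _ _ _ /(_ cc mid hcc hmn) [_ [b0 b1 b2]]]] := hE5.
have b160 i : 160 <= addr cc mid i by exact: leq_trans Hsb (hsb i).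
set pwm := PWc cc (mid * s) in b0 b1 b2.
have wfm : wf3 p pwm by exact: (wf_pw _ _ (bpp Hb)).
wsv pwm.1.1.
  apply: (ld_var (A := addr cc mid 3)) => //; rewrite ?upd_arr //; [exact: addrM | exact: ntmp_sb].
have a41 : addr cc mid 4 = addr cc mid 3 + 1 by rewrite !haE; lia.
have a52 : addr cc mid 5 = addr cc mid 3 + 2 by rewrite !haE; lia.
wsv pwm.1.2.
  apply: (ld_add (A := addr cc mid 3)) => //; rewrite -?a41 ?upd_arr //;
    [exact: addrW | exact: addrM | exact: ntmp_sb].
wsv pwm.2.
  apply: (ld_add (A := addr cc mid 3)) => //; rewrite -?a52 ?upd_arr //;
    [exact: ltn_trans w160 | exact: addrW | exact: addrM | exact: ntmp_sb].
set F5 := upd _ 35 _.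
have agF5 : agree (iota 25 25) f F5 by do 4!(apply: agree_upd => //).
have hE6 : env F5 by do 4!(apply: env_upd => //).
have q36 z : z \in [:: 36; 37; 38] -> F5 z = f1 z.
  by rewrite !inE => /or3P[] /eqP->; rewrite /F5 /upd /= ag4 // ag3 // ag2.
have q39 z : z \in [:: 39; 40; 41] -> F5 z = f2 z.
  by rewrite !inE => /or3P[] /eqP->; rewrite /F5 /upd /= ag4 // ag3.
have q42 z : z \in [:: 42; 43; 44] -> F5 z = f3 z.
  by rewrite !inE => /or3P[] /eqP->; rewrite /F5 /upd /= ag4.
have q30 z : z \in [:: 30; 31; 32] -> F5 z = f4 z.
  by rewrite !inE => /or3P[] /eqP->; rewrite /F5 /upd.
have q33 : (F5 33, F5 34, F5 35) = pwm by rewrite /F5 /upd /=; case: (pwm) => [[? ?] ?].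
have [_ _ _ _ _ _ /(_ s0) [x8 x9 _ _ _ _ _ _ _ _]] := hE6.
clearbody F5.
apply: (wp_seq HW (t1 := 210)); last by rewrite /=; lia.
apply: (@wp_MUL 36 33 (PH cc (take a T)) pwm) => //; first by rewrite !q36.
move=> f6 ag6 m6.
apply: (wp_seq HW (t1 := 210)); last by rewrite /=; lia.
apply: (@wp_MUL 39 33 (PH cc (take b T)) pwm) => //; try (by rewrite ag6).
- by rewrite !ag6 // !q39.
- by rewrite !ag6.
move=> f7 ag7 m7.
have z8 : f7 8 = p by rewrite ag7 // ag6.
pose a3 := mul3 p c (PH cc (take a T)) pwm; pose b3 := mul3 p c (PH cc (take b T)) pwm.
have r36 : (f7 36, f7 37, f7 38) = a3 by rewrite !ag7.
have r42 : (f7 42, f7 43, f7 44) = PH cc (take (a + mid * s) T) by rewrite !ag7 // !ag6 // !q42.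
have r30 : (f7 30, f7 31, f7 32) = PH cc (take (b + mid * s) T) by rewrite !ag7 // !ag6 // !q30.
have r24 : f7 24 = F.
  by rewrite ag7 // ag6 // agF5.
have wa := wf_mul3 c (bpp Hb) (PH cc (take a T)) pwm.
have wb := wf_mul3 c (bpp Hb) (PH cc (take b T)) pwm.
have w42 := wfP (take (a + mid * s) T); have w30 := wfP (take (b + mid * s) T).
have tE : teqc cc a b (mid * s) = [&& ad p (f7 42) (f7 39) == ad p (f7 30) (f7 36),
    ad p (f7 43) (f7 40) == ad p (f7 31) (f7 37) & ad p (f7 44) (f7 41) == ad p (f7 32) (f7 38)].
  by rewrite /teqc /teq -/pwm -m7 -/a3 -r36 -r42 -r30 /add3 !xpair_eqE -andbA.
rewrite -m7 in wb; rewrite -/a3 -r36 in wa; rewrite -r42 in w42; rewrite -r30 in w30.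
case/and3P: wa => wa0 wa1 wa2; case/and3P: wb => wb0 wb1 wb2.
case/and3P: w42 => wc0 wc1 wc2; case/and3P: w30 => wd0 wd1 wd2.
have sumW x y : x < p -> y < p -> x + y < W.
  by move=> h1 h2; apply: leq_ltn_trans ppW; apply: leq_add; apply: ltnW.
wsl (nat_of_bool (F && teqc cc a b (mid * s))).
  split; last first.
    by rewrite /= z8 r24 tE /ad; case: (F); do 3!case: (_ == _).
  rewrite /= z8 r24; do ![split => //]; rewrite ?mulnb //;
    first [exact: leq_ltn_trans (leq_b1 _) W1 | by apply: sumW].
apply: HQ; last by rewrite /upd.
apply: agree_upd => //.
apply: agree_trans (_ : agree XT f F5) _; first exact: agree_sub_all agF5.
by apply: agree_trans (agree_sub_all _ ag6) (agree_sub_all _ ag7).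
Qed.
Definition eqb (a b mid : nat) : bool := all (fun cc => teqc cc a b (mid * s)) (iota 0 kappa).

Lemma wp_TESTS_gen l a b mid (F : bool) t (Q : ast -> Prop) f q o :
  all (fun cc => cc < kappa) l -> 0 < s -> env f -> f 16 = a -> f 17 = b -> f 20 = mid -> f 24 = F ->
  a + mid * s <= n -> b + mid * s <= n -> size l * TTEST <= t ->
  (forall f', agree XT f f' -> f' 24 = F && all (fun cc => teqc cc a b (mid * s)) l -> Q (Ast f' q o)) ->
  wp (foldr (fun c d => TEST c ;; d) Skip l) t Q (Ast f q o).
Proof.
move=> hl s0; elim: l F f t hl => [|cc l IH] F f t /= hl he h16 h17 h20 h24 ha hb' ht HQ.
  by apply: wp_skip; apply: HQ => //; rewrite andbT.
case/andP: hl => hcc hl.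
apply: (wp_seq HW (t1 := TTEST)); last by apply: leq_trans ht; rewrite mulSn leq_addr.
apply: (wp_TEST hcc s0 he h16 h17 h20 h24) => // f1 ag1 r1.
apply: (IH (F && teqc cc a b (mid * s))) => //; try by rewrite ag1.
- exact: env_agree he ag1 isT.
- by move: ht; rewrite mulSn; lia.
- by move=> f2 ag2 r2; apply: HQ; [exact: agree_trans ag1 ag2 | rewrite r2 andbA].
Qed.
End Arith.

Opaque TTEST TPHI TESTS.

Variable kk : nat.
Hypothesis Hkk : n %/ s < 2 ^ kk.
Hypothesis Tpos : all (ltn 0) T.

Definition TCMP := 200 + kk * (kappa * TTEST + 100) + lim * 60.
Definition XC := iota 15 35.

(** Room for lo + hi in the bisection without overflow. For s = 0 it rests on n %/ 0 = 0. *)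
Lemma two_blocks : n %/ s + n %/ s + 2 <= W.
Proof.
case: (posnP s) => [->|s0]; first by rewrite divn0.
have [_ _ _ _ _ _ _ _ _ hq _ hW] := Hbig s0.
by apply: leq_trans (ltnW hW); rewrite /kappa; lia.
Qed.

Lemma blocks_le u v : 0 < u <= n -> blocks T s u v <= n %/ s.
Proof. by move=> hu; rewrite /blocks; apply: leq_div2r; lia. Qed.

Lemma wp_BSEARCH a b nb t (Q : ast -> Prop) f q o :
  env f -> f 16 = a -> f 17 = b -> f 18 = 0 -> f 19 = nb.+1 ->
  nb <= n %/ s -> a + nb * s <= n -> b + nb * s <= n -> 10 + kk * (kappa * TTEST + 100) <= t ->
  (forall f', agree (iota 18 3 ++ XT) f f' -> f' 18 = bs eqb a b kk 0 nb.+1 -> Q (Ast f' q o)) ->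
  wp BSEARCH t Q (Ast f q o).
Proof.
move=> he h16 h17 h18 h19 hnb ha hb' ht HQ.
have hWb := two_blocks.
pose tgt := bs eqb a b kk 0 nb.+1.
pose Inv (k : nat) (st : ast) := exists f2 lo hi, [/\ st = Ast f2 q o,
  agree (iota 18 3 ++ XT) f f2, [/\ f2 18 = lo, f2 19 = hi & hi <= nb.+1],
  lo < hi /\ hi - lo <= 2 ^ k & bs eqb a b k lo hi = tgt].
apply: (wp_whl HW (Inv := Inv) (k := kk) (tb := kappa * TTEST + 80)) => //.
- move=> k st [f2 [lo [hi [-> ag [r18 r19 hhi] [hlh hpow] htgt]]]] /=.
  rewrite r18 r19; split.
  + by do ![split => //]; lia.
  + move=> hlt; have {}hlt : (lo + 1 < hi) = false by case: (lo + 1 < hi) hlt.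
    apply: HQ => //; rewrite r18 -/tgt -htgt.
    by case: (k) => //= k'; rewrite hlt.
  + move=> hlt; have {}hlt : lo + 1 < hi by case: (lo + 1 < hi) hlt.
    case: k hpow htgt => [|k] hpow htgt; first by lia.
    split=> //.
    (* Entering the loop requires nb >= 1, which is impossible for s = 0 as n %/ 0 = 0. *)
    have s0 : 0 < s.
      rewrite lt0n; apply/eqP => s0; move: hnb; rewrite s0 divn0; lia.
    have he2 : env f2 by exact: env_agree he ag isT.
    set mid := (lo + hi) %/ 2.
    have hmid : lo < mid < hi by rewrite /mid; lia.
    wsv mid.
      by rewrite /= r18 r19; do ![split => //]; lia.
    wsv 1; first by [].
    have hmn x : x + nb * s <= n -> x + mid * s <= n.
      by apply: leq_trans; rewrite leq_add2l leq_mul2r; apply/orP; right; lia.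
    apply: (wp_seq HW (t1 := kappa * TTEST)); last by wtime.
    apply: (@wp_TESTS_gen (Hbig s0) (iota 0 kappa) a b mid true) => //.
    * by do 2!(apply: env_upd => //).
    * by rewrite /upd /= ag.
    * by rewrite /upd /= ag.
    * exact: hmn.
    * exact: hmn.
    move=> f3 ag3 r24; rewrite andTb -/(eqb a b mid) in r24.
    have ag3' : agree (iota 18 3 ++ XT) f f3.
      apply: agree_trans (agree_sub_all _ ag3) => //.
      by do 2!(apply: agree_upd => //).
    have r18' : f3 18 = lo by rewrite ag3.
    have r19' : f3 19 = hi by rewrite ag3.
    have r20' : f3 20 = mid by rewrite ag3.
    rewrite /= hlt -/mid in htgt; rewrite expnS in hpow.
    wif; first by [].
    * rewrite /= r24 => h; have hE : eqb a b mid by case: (eqb a b mid) h.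
      rewrite hE in htgt.
      wsl mid; first by [].
      exists (upd f3 18 mid), mid, hi; split; [by []|exact: agree_upd| | |exact: htgt];
        split; rewrite /upd /= ?r18' ?r19' //; rewrite /mid; lia.
    * rewrite /= r24 => h; have hE : eqb a b mid = false by case: (eqb a b mid) h.
      rewrite hE in htgt.
      wsl mid; first by [].
      exists (upd f3 19 mid), lo, mid; split; [by []|exact: agree_upd| | |exact: htgt];
        split; rewrite /upd /= ?r18' ?r19' //; rewrite /mid; lia.
- exists f, 0, nb.+1; split => //; split => //; rewrite subn0; exact: leq_ltn_trans hnb Hkk.
- by move: ht; rewrite /=; move: (kappa * TTEST) => X; lia.
Qed.

Lemma nth_T_pos i : (0 < nth 0 T i) = (i < n).
Proof. exact: nth_pos. Qed.

Lemma wp_SCAN x y t (Q : ast -> Prop) f q o :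
  env f -> f 21 = x -> f 22 = y -> x <= n -> y <= n -> x != y -> 60 + lim * 60 <= t ->
  (forall f', agree [:: 15; 21; 22; 23] f f' -> f' 15 = scan T lim x y -> Q (Ast f' q o)) ->
  wp SCAN t Q (Ast f q o).
Proof.
move=> he h21 h22 hx hy hxy ht HQ.
have [e2 _ e4 e5 _ _ _] := he.
wsv lim; first by [].
set f1 := upd f 23 lim.
pose Inv (k : nat) (st : ast) := exists f2 x' y', [/\ st = Ast f2 q o,
  agree [:: 15; 21; 22; 23] f f2, [/\ f2 21 = x', f2 22 = y' & f2 23 = k],
  [/\ x' <= n, y' <= n & x' != y'] & scan T k x' y' = scan T lim x y].
apply: (wp_seq HW (t1 := 30 + lim * 55)); last by wtime.
apply: (wp_whl HW (Inv := Inv) (k := lim) (tb := 20)) => //.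
- move=> k st [f2 [x' [y' [-> ag [r21 r22 r23] [hx' hy' hne] hsc]]]] /=.
  rewrite r21 r22 r23; split.
  + do ![split => //]; case: (0 < k); case: (nth 0 T x' == nth 0 T y') => //=; exact: ltnW.
  + move=> hstop; wsl (nat_of_bool (nth 0 T x' < nth 0 T y')).
      by rewrite /= r21 r22.
    apply: HQ; first by apply: agree_upd.
    rewrite /upd /= -hsc; case: (k) hstop => //= k'; by case: (nth 0 T x' == nth 0 T y').
  + move=> hgo; have [k0 Exy] : 0 < k /\ nth 0 T x' = nth 0 T y'.
      by move: hgo; case: (0 < k); case: (nth 0 T x' =P nth 0 T y').
    case: k k0 r23 hsc {hgo} => // k _ r23; rewrite /= Exy eqxx => hsc.
    split=> //.
    (* Equal letters lie both inside the text or both outside it; outside, both positions would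
       equal n although they are distinct. *)
    have hxn : x' < n /\ y' < n.
      have := nth_T_pos x'; rewrite Exy nth_T_pos => Ey.
      move/eqP: hne; lia.
    case: hxn => hxn hyn.
    wsv x'.+1.
      rewrite /= r21 addn1; do ![split => //]; exact: leq_ltn_trans hxn TW.
    wsv y'.+1.
      rewrite /= /upd /= r22 addn1; do ![split => //]; exact: leq_ltn_trans hyn TW.
    wsl k; first by rewrite /= /upd /= r23 subn1.
    eexists; exists x'.+1, y'.+1; split; [by []| |by []|by []|exact: hsc].
    by do 3!(apply: agree_upd => //).
- exists f1, x, y; split => //; exact: agree_upd.
- by rewrite /=; lia.
Qed.

Lemma wp_CMPF u v t (Q : ast -> Prop) f q o :
  env f -> f 13 = u -> f 14 = v -> 0 < u <= n -> 0 < v <= n -> u != v -> TCMP <= t ->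
  (forall f', agree XC f f' -> f' 15 = cmpf T s lim kk eqb u v -> Q (Ast f' q o)) ->
  wp CMPF t Q (Ast f q o).
Proof.
move=> he h13 h14 hu hv huv ht HQ.
have ht0 : 200 + kk * (kappa * TTEST + 100) + lim * 60 <= t by [].
have [e2 _ e4 e5 _ _ _] := he.
set a := u.-1; set b := v.-1; set nb := blocks T s u v.
have hnb : nb <= n %/ s by exact: blocks_le.
have hnbs : nb * s <= n - maxn a b.
  have -> : n - maxn a b = n - maxn u v + 1 by rewrite /a /b; lia.
  exact: leq_trunc_div.
have hWb := two_blocks.
have nW : n < W by [].
wsv a; first by rewrite /= h13; do ![split => //]; rewrite /a; lia.
wsv b; first by rewrite /= /upd /= h14; do ![split => //]; rewrite /b; lia.
pose f1 := upd (upd (upd f 16 a) 17 b) 23 (n - maxn u v + 1).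
apply: (wp_seq HW (t1 := 20)); last by wtime.
have cont : forall tt st, t - 40 <= tt -> st = Ast f1 q o -> wp (18 ::= K 0 ;; 19 ::= Op OAdd (Op ODiv (V 23) (V 4)) (K 1) ;;
  BSEARCH ;;
  21 ::= Op OAdd (V 16) (Op OMul (V 18) (V 4)) ;;
  22 ::= Op OAdd (V 17) (Op OMul (V 18) (V 4)) ;;
  SCAN) tt Q st.
  move=> tt st htt ->.
  have {htt}ht0 : 160 + kk * (kappa * TTEST + 100) + lim * 60 <= tt by clear -htt ht0; lia.
  wsv 0; first by rewrite /=; do ![split => //]; lia.
  wsv nb.+1.
    rewrite /= /f1 /upd /= e4 addn1 -/(blocks T s u v) -/nb; do ![split => //]; lia.
  set F1 := upd _ 19 _.
  have agF : agree XC f F1 by do 5!(apply: agree_upd => //).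
  apply: (wp_seq HW (t1 := 10 + kk * (kappa * TTEST + 100))); last by wtime.
  apply: (@wp_BSEARCH a b nb) => //; try lia.
    exact: env_agree he agF isT.
  move=> f2 ag2 r18; set r := bs _ _ _ _ _ _ in r18.
  have hr : r < nb.+1 by have := bs_lt T eqb a b kk (isT : 0 < nb.+1); case/andP.
  have hrs : r * s <= nb * s by rewrite leq_mul2r; apply/orP; right; lia.
  have agf2 : agree XC f f2 by apply: agree_trans agF _; exact: agree_sub_all ag2.
  have hlo (x : nat) : x + nb * s <= n -> [/\ x + r * s <= n, x + r * s < W & r * s < W] by clear -hrs nW => ?; split; lia.
  have [xa1 xa2 xa3] : [/\ a + r * s <= n, a + r * s < W & r * s < W] by apply: hlo; lia.
  have [xb1 xb2 _] : [/\ b + r * s <= n, b + r * s < W & r * s < W] by apply: hlo; lia.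
  have v16 : f2 16 = a by rewrite ag2.
  have v17 : f2 17 = b by rewrite ag2.
  have v4 : f2 4 = s by rewrite agf2.
  wsv (a + r * s); first by rewrite /= r18 v16 v4.
  wsv (b + r * s); first by rewrite /= /upd /= r18 v17 v4.
  set F3 := upd _ 22 _.
  have agF3 : agree XC f F3 by do 2!(apply: agree_upd => //).
  apply: (@wp_SCAN (a + r * s) (b + r * s)) => //.
  - exact: env_agree he agF3 isT.
  - by rewrite eqn_add2r; rewrite /a /b; lia.
  - by wtime.
  move=> f4 ag4 r15; apply: HQ => //.
  by apply: agree_trans agF3 _; exact: agree_sub_all ag4.
wif; first by [].
- rewrite /= => h; wsl (n - maxn u v + 1); last by apply: cont => //; wtime.
  rewrite /= /upd /= e2 h14.
  have uv : u < v by move: h; rewrite /upd /= h13 h14; case: ltnP.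
  do ![split => //]; clear -uv hu hv TW W1; lia.
- rewrite /= => h; wsl (n - maxn u v + 1); last by apply: cont => //; wtime.
  rewrite /= /upd /= e2 h13.
  have uv : v <= u by move: h; rewrite /upd /= h13 h14; case: ltnP.
  do ![split => //]; clear -uv hu hv TW W1; lia.
Qed.

Definition TLT := TCMP + 60.
Definition lessP := less T s lim kk eqb.

Lemma wp_LT u v t (Q : ast -> Prop) f q o :
  env f -> f 13 = u -> f 14 = v -> u <= n -> v <= n -> TLT <= t ->
  (forall f', agree XC f f' -> f' 15 = lessP u v -> Q (Ast f' q o)) ->
  wp LT t Q (Ast f q o).
Proof.
move=> he h13 h14 hu hv ht HQ.
have ht0 : TCMP + 60 <= t by [].
have E : lessP u v = if u == v then false else if u == 0 then false else if v == 0 then true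
    else cmpf T s lim kk eqb u v by rewrite /lessP /less hu hv.
have ag15 x : agree XC f (upd f 15 x) by apply: agree_upd.
wif; rewrite /= ?h13 ?h14; first by [].
  move=> h; wsl 0; first by split => //=; lia.
  apply: HQ => //; rewrite E; by case: (u == v) h.
move=> h; have {}h : (u == v) = false by case: (u == v) h.
rewrite h in E.
wif; rewrite /= ?h13; first by [].
  move=> u0; rewrite (negPf u0) in E.
  wif; rewrite /= ?h14; first by [].
    move=> v0; rewrite (negPf v0) in E.
    apply: (@wp_CMPF u v) => //; [lia|lia|by rewrite h|lia|].
    by move=> f' ag r; apply: HQ => //; rewrite E.
  move=> v0; have {}E : lessP u v = true by rewrite E v0.
  wsl 1; first by [].
  by apply: HQ => //; rewrite E.
move=> u0; have {}E : lessP u v = false by rewrite E u0.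
wsl 0; first by split => //=; lia.
by apply: HQ => //; rewrite E.
Qed.

Opaque TLT LT.

(** * Heap operations in memory *)

Hypothesis m0 : 0 < m.
(** Keeps the child index 2 i + 1 within a word. *)
Hypothesis mW : m + m <= W.
Hypothesis Hcell : forall i, i < m -> [/\ hcell (hb + i), hb + i <= MA & hb + i < W].

Definition heapis (h f : nat -> nat) := forall i, i < m -> f (hb + i) = h i.
(** Agreement on registers only: cell 0 and the cells from 160 on may belong to the heap, whose
    content [heapis] describes. *)
Definition agh (X : seq nat) (f f' : nat -> nat) := forall x, x \notin X -> 0 < x < 160 -> f' x = f x.

Lemma agree_agh X f f' : agree X f f' -> agh X f f'.
Proof. by move=> h x hx _; exact: h. Qed.
Lemma agh_trans X f1 f2 f3 : agh X f1 f2 -> agh X f2 f3 -> agh X f1 f3.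
Proof. by move=> h1 h2 x hx hb'; rewrite h2 // h1. Qed.
Lemma agh_sub X Y f f' : all (mem Y) X -> agh X f f' -> agh Y f f'.
Proof. by move=> /allP hs h x hx; apply: h; apply: contra hx => /hs. Qed.

Lemma hcell_ntmp x : hcell x -> ~~ tmp x.
Proof. by rewrite /hcell /tmp; lia. Qed.
Lemma hcell_nscr x : hcell x -> ~~ scr x.
Proof. by rewrite /hcell /scr; lia. Qed.

Lemma heap_agree h X f f' : heapis h f -> agree X f f' -> all scr X -> heapis h f'.
Proof.
move=> hh ag /allP hX i hi; rewrite ag ?hh //.
by have [/hcell_nscr hc _ _] := Hcell hi; apply: contra hc => /hX.
Qed.

Lemma heap_updr h f d v : heapis h f -> scr d -> heapis h (upd f d v).
Proof.
by move=> hh hd; apply: (@heap_agree h [:: d]) hh _ _; [apply: agree_upd; rewrite ?mem_head | rewrite /= hd].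
Qed.

Lemma heap_store h f i v : heapis h f -> heapis (upd h i v) (upd f (hb + i) v).
Proof. by move=> hh j hj; rewrite /upd eqn_add2l; case: eqP => // _; exact: hh. Qed.

Lemma env_store f i v : env f -> i < m -> env (upd f (hb + i) v).
Proof.
move=> he hi; apply: (env_chg he) => x h1 h2; apply: upd_ne; apply: contra h2 => /eqP ->.
by case: (Hcell hi).
Qed.

Lemma agh_store X f f' i v : i < m -> agh X f f' -> agh X f (upd f' (hb + i) v).
Proof.
move=> hi ag x hx hx2; rewrite upd_ne ?ag //; apply/eqP => E.
by have [] := Hcell hi; rewrite -E /hcell; lia.
Qed.

Lemma wp_stov e1 e2 i v t (Q : ast -> Prop) f q o :
  depth e1 <= 30 -> depth e2 <= 29 -> exp_size e1 + exp_size e2 + 1 <= t -> i < m ->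
  ok f e1 /\ ev f e1 = hb + i -> ok f e2 /\ ev f e2 = v ->
  Q (Ast (upd f (hb + i) v) q o) -> wp (Sto e1 e2) t Q (Ast f q o).
Proof.
move=> d1 d2 ht hi [o1 v1] [o2 v2] HQ; have [hc hM _] := Hcell hi.
by apply: (wp_sto _ HW) => //; rewrite v1 ?v2 //; exact: hcell_ntmp.
Qed.

Lemma hp_ok f e i : env f -> ok f e -> ev f e = i -> i < m ->
  ok f (HP e) /\ ev f (HP e) = hb + i.
Proof.
move=> he o1 e1 hi; have [_ _ hW] := Hcell hi; have [_ _ _ _ _ e7 _] := he.
by rewrite /= e1 e7; do ![split => //].
Qed.

Lemma ld_hp h f e i : env f -> heapis h f -> ok f e -> ev f e = i -> i < m ->
  ok f (LD (HP e)) /\ ev f (LD (HP e)) = h i.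
Proof.
move=> he hh o1 e1 hi; have [o2 e2] := hp_ok he o1 e1 hi.
have [hc hM _] := Hcell hi.
split; last by rewrite -hh // -e2.
by split; rewrite ?e2 //; exact: hcell_ntmp.
Qed.

Definition XH := iota 13 37.

Lemma wp_CHILD h i sz t (Q : ast -> Prop) f q o :
  env f -> heapis h f -> f 50 = i -> f 53 = sz -> i < m -> sz <= m -> (forall j, j < m -> h j <= n) ->
  TLT + 100 <= t ->
  (forall f', agree (51 :: XH) f f' ->
    f' 51 = (if i + i + 1 < sz then child lessP sz h i else i + i + 1) -> Q (Ast f' q o)) ->
  wp CHILD t Q (Ast f q o).
Proof.
move=> he hh h50 h53 hi hsz hn ht HQ.
wsv (i + i + 1); first by rewrite /= h50; do ![split => //]; lia.
set f1 := upd f 51 _.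
have ag1 : agree (51 :: XH) f f1 by apply: agree_upd.
have he1 : env f1 by exact: env_upd.
have hh1 : heapis h f1 by exact: heap_updr.
have r51 : f1 51 = i + i + 1 by [].
have r53 : f1 53 = sz by [].
clearbody f1.
wif; first by []; last first.
  rewrite /= r51 r53 => hlt; apply: wp_skip; apply: HQ => //.
  by rewrite r51; case: (i + i + 1 < sz) hlt.
rewrite /= r51 r53 => hlt; have {}hlt : i + i + 1 < sz by case: (i + i + 1 < sz) hlt.
rewrite hlt in HQ.
have E12 : i + i + 1 + 1 = i + i + 2 by lia.
wif; first by rewrite /= r51 ; do ![split => //]; lia.
all: rewrite /= r51 r53 E12 => hlt2.
  have {}hlt2 : i + i + 2 < sz by case: (i + i + 2 < sz) hlt2.
  have hc1 : i + i + 1 < m by lia.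
  have hc2 : i + i + 2 < m by lia.
  wsv (h (i + i + 1)); first by apply: ld_hp.
  wsv (h (i + i + 2)).
    apply: (@ld_hp h); [exact: env_upd|exact: heap_updr| |by rewrite /= /upd /= r51|by []].
    rewrite /= /upd /= r51; do ![split => //]; lia.
  set f2 := upd _ 14 _.
  have ag2 : agree (51 :: XH) f f2 by do 2!(apply: agree_upd => //).
  apply: (wp_seq HW (t1 := TLT)); last by wtime.
  apply: (@wp_LT (h (i + i + 1)) (h (i + i + 2))) => //.
  - by do 2!(apply: env_upd => //).
  - exact: hn.
  - exact: hn.
  move=> f3 ag3 r15.
  have ag3' : agree (51 :: XH) f f3 by apply: agree_trans ag2 _; exact: agree_sub_all ag3.
  have r51' : f3 51 = i + i + 1 by rewrite ag3.
  wif; first by [].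
    rewrite /= r15 => hl; wsl (i + i + 2).
      by rewrite /= r51' E12; do ![split => //]; lia.
    apply: HQ; first exact: agree_upd.
    by rewrite /child hlt2 /=; case: (lessP _ _) hl.
  rewrite /= r15 => hl; apply: wp_skip; apply: HQ => //.
  by rewrite r51' /child hlt2 /=; case: (lessP _ _) hl.
apply: wp_skip; apply: HQ => //.
by rewrite r51 /child; case: (i + i + 2 < sz) hlt2.
Qed.

(** Heap cells stay at most n whatever the comparisons answer, as [wp_LT] requires even on a bad
    tape. *)
Lemma sift_le l sz k h i x b j : (forall j, j < m -> h j <= b) -> x <= b -> sz <= m ->
  j < m -> sift l sz k h i x j <= b.
Proof.
elim: k h i => [|k IH] h i hh hx hsz hj /=; first by rewrite /upd; case: ifP => // _; exact: hh.
case: ifP => [hc|_]; last by rewrite /upd; case: ifP => // _; exact: hh.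
case: ifP => _; last by rewrite /upd; case: ifP => // _; exact: hh.
apply: IH => // j' hj'; rewrite /upd; case: ifP => // _; apply: hh => //.
by rewrite /child; case: ifP => [/andP[h1 _]|_]; lia.
Qed.

Lemma child_lt l sz h i : i + i + 1 < sz -> child l sz h i < sz.
Proof. by rewrite /child; case: ifP => // /andP[]. Qed.

Definition TSIFT k := k.+1 * (2 * TLT + 300) + 100.
Definition XS := [:: 50; 51; 54; 55] ++ XH.

Lemma wp_SIFT h sz x i k t (Q : ast -> Prop) f q o :
  env f -> heapis h f -> f 50 = i -> f 52 = x -> f 53 = sz -> i < m -> sz <= m -> x <= n ->
  (forall j, j < m -> h j <= n) -> sz < i.+1 * 2 ^ k.+1 -> TSIFT k <= t ->
  (forall f', env f' -> agh XS f f' -> heapis (sift lessP sz k h i x) f' -> Q (Ast f' q o)) ->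
  wp SIFT t Q (Ast f q o).
Proof.
move=> he hh h50 h52 h53 hi hsz hx hn hk ht HQ.
have {}ht : k.+1 * (2 * TLT + 300) + 100 <= t by [].
wsv 1; first by [].
set f1 := upd f 54 1.
pose H := sift lessP sz k h i x.
(* The loop is tied to the recursion through the final value [H]: while flag 54 is 1, [sift] from
   the current hole still yields [H]; once it is 0, only the write of x is missing. *)
pose Inv (mu : nat) (st : ast) := exists f2 h2 i2 k2, [/\ st = Ast f2 q o,
  [/\ env f2, heapis h2 f2 & agh XS f f2], [/\ f2 50 = i2, i2 < m & (forall j, j < m -> h2 j <= n)] &
  (f2 54 = 1 /\ [/\ mu = k2.+1, sz < i2.+1 * 2 ^ k2.+1 & sift lessP sz k2 h2 i2 x = H]) \/
  (f2 54 = 0 /\ upd h2 i2 x = H)].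
apply: (wp_seq HW (t1 := k.+1 * (2 * TLT + 300) + 10)); last by wtime.
have [tb htb0 htb] : exists2 tb, tb = 2 * TLT + 280 & 2 * TLT + 280 <= tb.
  by exists (2 * TLT + 280).
apply: (wp_whl HW (Inv := Inv) (k := k.+1) (tb := tb)) => //.
- move=> mu st [f2 [h2 [i2 [k2 [-> [e2 hp2 ag2] [r50 hi2 hn2] hcase]]]]] /=.
  have r52 : f2 52 = x by rewrite ag2.
  have r53 : f2 53 = sz by rewrite ag2.
  split=> //.
  + move=> h0; case: hcase => [[h1 _]|[_ hH]]; first by rewrite h0 in h1.
    apply: (@wp_stov _ _ i2 x) => //; first by wtime.
      by apply: hp_ok.
    apply: HQ; [exact: env_store|exact: agh_store|].
    by rewrite -/H -hH; exact: heap_store.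
  + move=> hne; case: hcase => [[h1 [Emu hk2 hs]]|[h0 _]]; last by rewrite h0 in hne.
    rewrite Emu; split=> //=.
    apply: (wp_seq HW (t1 := TLT + 100)); last by wtime.
    apply: (@wp_CHILD h2 i2 sz) => // f3 ag3 r51.
    have e3 : env f3 by exact: env_agree e2 ag3 isT.
    have hp3 : heapis h2 f3 by exact: heap_agree hp2 ag3 isT.
    have ag3' : agh XS f f3.
      by apply: agh_trans ag2 _; apply: agree_agh; exact: agree_sub_all ag3.
    have r50' : f3 50 = i2 by rewrite ag3.
    have r52' : f3 52 = x by rewrite ag3.
    have r53' : f3 53 = sz by rewrite ag3.
    case: (ltnP (i2 + i2 + 1) sz) r51 => hlt r51; last first.
      wif; first by [].
        by rewrite /= r51 r53' ltnNge hlt.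
      move=> _; wsl 0; first by rewrite /=; split => //; lia.
      exists (upd f3 54 0), h2, i2, k2; split => //.
      * split; [exact: env_upd|exact: heap_updr|].
        by apply: agh_trans ag3' _; apply: agree_agh; exact: agree_upd.
      * right; split => //; rewrite -hs; case: (k2) => //= k3.
        by rewrite ltnNge hlt.
    case: k2 Emu hk2 hs => [|k3] Emu hk2 hs; first by rewrite expn1 in hk2; lia.
    have hcl := child_lt lessP h2 hlt.
    rewrite /= hlt in hs.
    set ci := child lessP sz h2 i2 in r51 hcl.
    have hcm : ci < m by lia.
    wif; first by [].
      move=> _; wsv (h2 ci); first by apply: ld_hp.
      wsv x; first by rewrite /= /upd /= r52'.
      wsv (h2 ci); first by [].
      set f4 := upd _ 14 _.
      have ag4 : agree XS f3 f4 by do 3!(apply: agree_upd => //).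
      have e4 : env f4 by exact: env_agree e3 ag4 isT.
      apply: (wp_seq HW (t1 := TLT)); last by wtime.
      apply: (@wp_LT x (h2 ci)) => //; first exact: hn2.
      move=> f5 ag5 r15.
      have e5 : env f5 by exact: env_agree e4 ag5 isT.
      have ag5' : agree XS f3 f5 by apply: agree_trans ag4 _; exact: agree_sub_all ag5.
      have hp5 : heapis h2 f5 by exact: heap_agree hp3 ag5' isT.
      have agf5 : agh XS f f5 by apply: agh_trans ag3' _; exact: agree_agh.
      have x50 : f5 50 = i2 by rewrite ag5.
      have x51 : f5 51 = ci by rewrite ag5.
      have x54 : f5 54 = f2 54 by rewrite ag5 // /f4 /upd /= ag3.
      have x55 : f5 55 = h2 ci by rewrite ag5.
      wif; first by [].
      * rewrite /= r15 => hl; have {}hl : lessP x (h2 ci) by case: (lessP _ _) hl.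
        apply: (wp_seq HW (t1 := 20)); last by wtime.
        apply: (@wp_stov _ _ i2 (h2 ci)) => //; first by apply: hp_ok.
        wsl ci.
          by rewrite /= upd_ne ?x51 //; apply/eqP => E; have [] := Hcell hi2; rewrite -E.
        exists (upd (upd f5 (hb + i2) (h2 ci)) 50 ci), (upd h2 i2 (h2 ci)), ci, k3; split => //.
        -- split; [apply: env_upd => //; exact: env_store|apply: heap_updr => //; exact: heap_store|].
           apply: agh_trans (_ : agh XS _ (upd f5 (hb + i2) (h2 ci))) _; first exact: agh_store.
           by apply: agree_agh; exact: agree_upd.
        -- split => // j hj; rewrite /upd; case: ifP => _; exact: hn2.
        -- left; split.
             rewrite upd_ne // upd_ne ?x54 ?h1 //.
             by apply/eqP => E; have [] := Hcell hi2; rewrite -E.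
           rewrite -/ci hl in hs; split => //.
           apply: leq_trans hk2 _; rewrite (expnS 2 k3.+1) mulnA leq_mul2r; apply/orP; right.
           by rewrite /ci /child; case: ifP; lia.
      * rewrite /= r15 => hl; have {}hl : lessP x (h2 ci) = false by case: (lessP _ _) hl.
        wsl 0; first by rewrite /=; split => //; lia.
        exists (upd f5 54 0), h2, i2, k3; split => //.
        -- split; [exact: env_upd|exact: heap_updr|].
           by apply: agh_trans agf5 _; apply: agree_agh; exact: agree_upd.
        -- by right; rewrite -/ci hl in hs; split.
    by rewrite /= r51 r53' hcl.
- exists f1, h, i, k; split => //.
  + by split; [exact: env_upd|exact: heap_updr|apply: agree_agh; exact: agree_upd].
  + by left.
- rewrite htb0 /=; clear; move: (TLT) => X; nia.
Qed.

Opaque TSIFT SIFT.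
Variable kh : nat.
Hypothesis Hkh : m < 2 ^ kh.+1.
Hypothesis HI : all (fun i => 0 < i <= n) I.

Lemma agh_upd X f f' d v : d \in X -> agh X f f' -> agh X f (upd f' d v).
Proof. by move=> hd h x hx hb'; rewrite upd_ne ?h //; apply: contra hx => /eqP->. Qed.

Lemma nth_I_le k : nth 0 I k <= n.
Proof.
case: (ltnP k (size I)) => hk; last by rewrite nth_default.
by have /andP[] := allP HI _ (mem_nth 0 hk).
Qed.

Definition XHS := [:: 52; 53; 59] ++ XS.

Lemma wp_HSORT h t (Q : ast -> Prop) f q o :
  env f -> heapis h f -> (forall j, j < m -> h j <= n) -> m * (TSIFT kh + 100) + 40 <= t ->
  (forall f', env f' -> agh XHS f f' -> heapis (hsort lessP kh m h) f' -> Q (Ast f' q o)) ->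
  wp HSORT t Q (Ast f q o).
Proof.
move=> he hh hn ht HQ; have [_ _ _ _ e6 e7 _] := he.
wsv m; first by rewrite /= e6.
set f1 := upd f 53 m.
have [tb htb0 htb] : exists2 tb, tb = TSIFT kh + 80 & TSIFT kh + 80 <= tb by exists (TSIFT kh + 80).
pose Inv (mu : nat) (st : ast) := exists f2 h2, [/\ st = Ast f2 q o,
  [/\ env f2, heapis h2 f2 & agh XHS f f2], [/\ f2 53 = mu, mu <= m & (forall j, j < m -> h2 j <= n)] &
  hsort lessP kh mu h2 = hsort lessP kh m h].
apply: (wp_whl HW (Inv := Inv) (k := m) (tb := tb)) => //.
- move=> mu st [f2 [h2 [-> [e2 hp2 ag2] [r53 hmu hn2] ht2]]] /=.
  rewrite r53; split=> //.
  + by move=> E; rewrite E in ht2; apply: HQ => //; rewrite -ht2.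
  + case: mu r53 hmu ht2 => // s' r53 hmu ht2 _; split=> //.
    wsv s'; first by rewrite /= r53 subn1.
    wsv (h2 s').
      by apply: ld_hp => //; [exact: env_upd | exact: heap_updr].
    wsv (h2 0).
      have [hc hM _] := Hcell m0.
      have e7' : f2 7 = hb by case: e2.
      rewrite addn0 in hc hM.
      apply: (ld_var (A := hb)) => //; first exact: hcell_ntmp.
      rewrite !upd_ne //; try (by apply/eqP => E; move: hc; rewrite E).
      by rewrite -(hp2 0 m0) addn0.
    wsv 0; first by rewrite /=; split => //; lia.
    set f3 := upd _ 50 0.
    have ag3 : agh XHS f f3 by do 4!(apply: agh_upd => //).
    have e3 : env f3 by do 4!(apply: env_upd => //).
    have hp3 : heapis h2 f3 by do 4!(apply: heap_updr => //).
    have hs' : s' < 2 ^ kh.+1 by apply: leq_trans Hkh; exact: leq_trans hmu _.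
    apply: (wp_seq HW (t1 := TSIFT kh)); last by wtime.
    apply: (@wp_SIFT h2 s' (h2 s') 0 kh) => //; [exact: ltnW|exact: hn2|by rewrite mul1n|].
    move=> f4 e4 ag4 hp4.
    have x53 : f4 53 = s' by rewrite ag4.
    have x59 : f4 59 = h2 0 by rewrite ag4.
    apply: (@wp_stov _ _ s' (h2 0)) => //; first by wtime.
      by apply: hp_ok.
    exists (upd f4 (hb + s') (h2 0)), (upd (sift lessP s' kh h2 0 (h2 s')) s' (h2 0)); split => //.
    * split; [exact: env_store|exact: heap_store|].
      by apply: agh_store => //; apply: agh_trans ag3 _; exact: agh_sub ag4.
    * split; [|exact: ltnW|].
        rewrite upd_ne //; apply/eqP => E.
        by have [] := Hcell hmu; rewrite -E.
      move=> j hj; rewrite /upd; case: ifP => _; first exact: hn2.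
      by apply: sift_le => //; [exact: hn2|exact: ltnW].
- exists f1, h; split => //; split => //; [exact: env_upd|exact: heap_updr|].
  by apply: agh_upd.
- by rewrite htb0 /=; move: ht; rewrite /=; move: (TSIFT kh) => X; clear; nia.
Qed.

Definition TSEL := 2 * TLT + TSIFT kh + 100.

Lemma wp_SEL h l x k t (Q : ast -> Prop) f q o :
  env f -> heapis h f -> (forall j, j < m -> h j <= n) -> f 57 = k -> nth 0 I k = x -> x <= n ->
  f 58 = l -> l <= n -> TSEL <= t ->
  (forall f', env f' -> agh XHS f f' -> heapis (sel lessP m kh l h x) f' -> Q (Ast f' q o)) ->
  wp SEL t Q (Ast f q o).
Proof.
move=> he hh hn h57 hk hx h58 hl ht HQ.
have {}ht : 2 * TLT + TSIFT kh + 100 <= t by [].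
wsv x; first by rewrite /= h57.
wsv 1; first by [].
set f1 := upd _ 15 1.
have e1 : env f1 by do 2!(apply: env_upd => //).
have ag1 : agree XHS f f1 by do 2!(apply: agree_upd => //).
have r52 : f1 52 = x by [].
have r15 : f1 15 = 1 by [].
clearbody f1.
apply: (wp_seq HW (t1 := TLT + 40)); last by wtime.
have cont : forall tt f2, TLT + TSIFT kh + 30 <= tt -> agree XHS f f2 -> f2 52 = x ->
    f2 15 = ((l == 0) || lessP l x) ->
    wp (Ife (V 15)
    (13 ::= V 52 ;; 14 ::= LD (V 7) ;; LT ;;
     Ife (V 15) (53 ::= V 6 ;; 50 ::= K 0 ;; SIFT) Skip)
    Skip) tt Q (Ast f2 q o).
  move=> tt f2 htt ag2 s52 s15.
  have e2 : env f2 by exact: env_agree he ag2 isT.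
  have hp2 : heapis h f2 by exact: heap_agree hh ag2 isT.
  wif; first by []; last first.
    rewrite /= s15 => hf; apply: wp_skip; apply: HQ => //; first exact: agree_agh.
    by rewrite /sel; case: (_ || _) hf.
  rewrite /= s15 => hf.
  wsv x; first by [].
  wsv (h 0).
    have [hc hM _] := Hcell m0.
    have e7' : f2 7 = hb by case: e2.
    rewrite addn0 in hc hM.
    apply: (ld_var (A := hb)) => //; first exact: hcell_ntmp.
    rewrite !upd_ne //; try (by apply/eqP => E; move: hc; rewrite E).
    by rewrite -(hp2 0 m0) addn0.
  set f3 := upd _ 14 _.
  have ag3 : agree XHS f f3 by do 2!(apply: agree_upd => //).
  apply: (wp_seq HW (t1 := TLT)); last by wtime.
  apply: (@wp_LT x (h 0)) => //; [exact: env_agree he ag3 isT|exact: hn|].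
  move=> f4 ag4 t15.
  have ag4' : agree XHS f f4 by apply: agree_trans ag3 _; exact: agree_sub_all ag4.
  have e4 : env f4 by exact: env_agree he ag4' isT.
  have hp4 : heapis h f4 by exact: heap_agree hh ag4' isT.
  have [_ _ _ _ e6 _ _] := e4.
  have t52 : f4 52 = x by rewrite ag4.
  have E : sel lessP m kh l h x = if lessP x (h 0) then sift lessP m kh h 0 x else h.
    by rewrite /sel; case: (_ || _) hf.
  wif; first by []; last first.
    rewrite /= t15 => hf2; apply: wp_skip; apply: HQ => //; first exact: agree_agh.
    by rewrite E; case: (lessP _ _) hf2.
  rewrite /= t15 => hf2.
  wsv m; first by [].
  wsv 0; first by rewrite /=; split => //; lia.
  set f5 := upd _ 50 0.
  have ag5 : agree XHS f f5 by do 2!(apply: agree_upd => //).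
  apply: (@wp_SIFT h m x 0 kh) => //.
  - exact: env_agree he ag5 isT.
  - exact: heap_agree hh ag5 isT.
  - by rewrite mul1n.
  - by wtime.
  move=> f6 e6' ag6 hp6; apply: HQ => //.
    by apply: agh_trans (agree_agh ag5) _; exact: agh_sub ag6.
  by rewrite E; case: (lessP _ _) hf2.
wif; first by [].
  rewrite /= (ag1 58) // h58 => l0.
  wsv l; first by rewrite /= ag1.
  wsv x; first by [].
  set f2 := upd _ 14 x.
  have ag2 : agree XHS f f2 by do 2!(apply: agree_upd => //).
  apply: (@wp_LT l x) => //; [exact: env_agree he ag2 isT|by wtime|].
  move=> f3 ag3 s15; apply: cont; first by wtime.
  - by apply: agree_trans ag2 _; exact: agree_sub_all ag3.
  - by rewrite ag3.
  - by rewrite s15 (negPf l0).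
rewrite /= (ag1 58) // h58 => l0; apply: wp_skip; apply: cont => //; first by wtime.
by rewrite l0 r15.
Qed.

Opaque SEL TSEL HSORT.

Lemma wp_CLEAR t (Q : ast -> Prop) f q o :
  env f -> m * 40 + 30 <= t ->
  (forall f', env f' -> agh (57 :: XHS) f f' -> heapis (fun=> 0) f' -> Q (Ast f' q o)) ->
  wp CLEAR t Q (Ast f q o).
Proof.
move=> he ht HQ; have [_ _ _ _ e6 e7 _] := he.
wsv 0; first by rewrite /=; split => //; lia.
set f1 := upd f 57 0.
pose Inv (mu : nat) (st : ast) := exists f2 j, [/\ st = Ast f2 q o, env f2, agh (57 :: XHS) f f2,
  f2 57 = j /\ j + mu = m & forall i, i < j -> f2 (hb + i) = 0].
have [tb htb0 htb] : exists2 tb, tb = 30 & 30 <= tb by exists 30.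
apply: (wp_whl HW (Inv := Inv) (k := m) (tb := tb)) => //.
- move=> mu st [f2 [j [-> e2 ag2 [r57 hj] hz]]] /=.
  have r6 : f2 6 = m by case: e2.
  rewrite r57 r6; split=> //.
  + move=> E; apply: HQ => // i hi; apply: hz.
    by apply: leq_trans hi _; move: E; case: ltnP.
  + move=> E; have {}E : j < m by case: (j < m) E.
    split; first by lia.
    apply: (wp_seq HW (t1 := 15)); last by wtime.
    apply: (@wp_stov _ _ j 0) => //; first by apply: hp_ok.
      by split => //=; lia.
    wsl j.+1.
      rewrite /= upd_ne ?r57 ?addn1; last by apply/eqP => E2; have [] := Hcell E; rewrite -E2.
      by do ![split => //]; lia.
    exists (upd (upd f2 (hb + j) 0) 57 j.+1), j.+1; split => //.
    * by apply: env_upd => //; exact: env_store.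
    * by apply: agh_upd => //; exact: agh_store.
    * by split => //; lia.
    * move=> i hij; have him : i < m by exact: leq_trans hij E.
      move: hij; rewrite ltnS leq_eqVlt upd_ne; last first.
        by apply/eqP => E2; have [] := Hcell him; rewrite E2.
      by rewrite /upd eqn_add2l => /orP[->//|hi]; case: ifP => // _; exact: hz.
- exists f1, 0; split => //; [exact: env_upd|by apply: agh_upd].
- by rewrite htb0 /=; move: ht; clear; lia.
Qed.

Lemma sel_le l h x b : (forall j, j < m -> h j <= b) -> x <= b ->
  forall j, j < m -> sel lessP m kh l h x j <= b.
Proof. by move=> hh hx j hj; rewrite /sel; case: ifP => _; [apply: sift_le | apply: hh]. Qed.

Lemma wp_COLLECT h l t (Q : ast -> Prop) f q o :
  env f -> heapis h f -> (forall j, j < m -> h j <= n) -> f 58 = l -> l <= n ->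
  size I < W -> size I * (TSEL + 40) + 30 <= t ->
  (forall f' h', env f' -> agh (57 :: XHS) f f' -> heapis h' f' -> (forall j, j < m -> h' j <= n) ->
     h' = foldl (sel lessP m kh l) h I -> Q (Ast f' q o)) ->
  wp COLLECT t Q (Ast f q o).
Proof.
move=> he hh hn h58 hl hIW ht HQ; have [_ e3 _ _ _ _ _] := he.
wsv 0; first by rewrite /=; split => //; lia.
set f1 := upd f 57 0.
pose Inv (mu : nat) (st : ast) := exists f2 h2 k, [/\ st = Ast f2 q o, [/\ env f2, agh (57 :: XHS) f f2 & heapis h2 f2],
  f2 57 = k /\ k + mu = size I, (forall j, j < m -> h2 j <= n) &
  foldl (sel lessP m kh l) h2 (drop k I) = foldl (sel lessP m kh l) h I].
have [tb htb0 htb] : exists2 tb, tb = TSEL + 20 & TSEL + 20 <= tb by exists (TSEL + 20).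
apply: (wp_whl HW (Inv := Inv) (k := size I) (tb := tb)) => //.
- move=> mu st [f2 [h2 [k [-> [e2 ag2 hp2] [r57 hk] hn2 hf]]]] /=.
  have r3 : f2 3 = size I by case: e2.
  rewrite r57 r3; split=> //.
  + move=> E; apply: (HQ f2 h2) => //.
    by rewrite -hf drop_oversize //; move: E; case: ltnP.
  + move=> E; have {}E : k < size I by case: (k < size I) E.
    split; first by lia.
    apply: (wp_seq HW (t1 := TSEL)); last by wtime.
    apply: (@wp_SEL h2 l (nth 0 I k) k) => //; [exact: nth_I_le|by rewrite ag2|].
    move=> f3 e3' ag3 hp3.
    wsl k.+1.
      by rewrite /= ag3 // r57 addn1; do ![split => //]; lia.
    exists (upd f3 57 k.+1), (sel lessP m kh l h2 (nth 0 I k)), k.+1; split => //.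
    * split; [exact: env_upd| |exact: heap_updr].
      by apply: agh_upd => //; apply: agh_trans ag2 _; exact: agh_sub ag3.
    * by split => //; lia.
    * by apply: sel_le => //; exact: nth_I_le.
    * by rewrite -hf (drop_nth 0 E).
- exists f1, h, 0; split => //; last by rewrite drop0.
  by split; [exact: env_upd|apply: agh_upd|exact: heap_updr].
- by rewrite htb0 /=; move: ht; clear; move: (TSEL) (size I) => X b; nia.
Qed.

Lemma wp_EMIT h l t (Q : ast -> Prop) f q o :
  env f -> heapis h f -> f 58 = l -> m * 60 + 30 <= t ->
  (forall f', env f' -> agree [:: 55; 57; 58] f f' ->
     f' 58 = last l [seq x <- mkseq h m | x != 0] ->
     Q (Ast f' q (o ++ [seq x <- mkseq h m | x != 0]))) ->
  wp EMIT t Q (Ast f q o).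
Proof.
move=> he hh h58 ht HQ.
wsv 0; first by rewrite /=; split => //; lia.
set f1 := upd f 57 0.
pose Inv (mu : nat) (st : ast) := exists f2 j, [/\ st = Ast f2 q (o ++ [seq x <- mkseq h j | x != 0]),
  env f2, agree [:: 55; 57; 58] f f2,
  f2 57 = j /\ j + mu = m & f2 58 = last l [seq x <- mkseq h j | x != 0]].
have [tb htb0 htb] : exists2 tb, tb = 45 & 45 <= tb by exists 45.
apply: (wp_whl HW (Inv := Inv) (k := m) (tb := tb)) => //.
- move=> mu st [f2 [j [-> e2 ag2 [r57 hj] r58]]] /=.
  have r6 : f2 6 = m by case: e2.
  have hp2 : heapis h f2 by exact: heap_agree hh ag2 isT.
  rewrite r57 r6; split=> //.
  + move=> E; have Ej : j = m by move: E; case: ltnP => //; lia.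
    by rewrite Ej in r58 *; apply: HQ.
  + move=> E; have {}E : j < m by case: (j < m) E.
    split; first by lia.
    wsv (h j); first by apply: ld_hp.
    set f3 := upd _ 55 _.
    have ag3 : agree [:: 55; 57; 58] f f3 by apply: agree_upd.
    have e3 : env f3 by exact: env_upd.
    have s57 : f3 57 = j by [].
    have s58 : f3 58 = f2 58 by [].
    have s55 : f3 55 = h j by [].
    clearbody f3.
    have fin : forall tt o' f4, 15 <= tt -> env f4 -> agree [:: 55; 57; 58] f f4 -> f4 57 = j ->
        o' = o ++ [seq x <- mkseq h j.+1 | x != 0] -> f4 58 = last l [seq x <- mkseq h j.+1 | x != 0] ->
        wp (57 ::= Op OAdd (V 57) (K 1)) tt (Inv mu.-1) (Ast f4 q o').
      move=> tt o' f4 htt e4 ag4 t57 -> t58; wsl j.+1.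
        by rewrite /= t57 addn1; do ![split => //]; lia.
      exists (upd f4 57 j.+1), j.+1; split => //; [exact: env_upd|exact: agree_upd|].
      by split => //; lia.
    apply: (wp_seq HW (t1 := 20)); last by wtime.
    wif; first by [].
      rewrite /= s55 => hne.
      apply: (wp_seq HW (t1 := 8)); last by wtime.
      apply: (wp_prt _ HW) => //=; rewrite s55.
      wsl (h j); first by [].
      apply: fin; [by wtime|exact: env_upd|exact: agree_upd|by []| |].
        by rewrite mkseqS filter_rcons hne rcons_cat.
      by rewrite mkseqS filter_rcons hne last_rcons /upd.
    rewrite /= s55 => h0; apply: wp_skip.
    by apply: fin => //; [by wtime| |]; rewrite mkseqS filter_rcons h0 ?s58.
- exists f1, 0; split => //; [by rewrite cats0|exact: env_upd|exact: agree_upd].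
- by rewrite htb0 /=; move: ht; clear; lia.
Qed.

Opaque CLEAR COLLECT EMIT.

Definition TROUND := m * 40 + 30 + (size I * (TSEL + 40) + 30) + (m * (TSIFT kh + 100) + 40) + (m * 60 + 30).
Definition XR := [:: 57; 58] ++ XHS.

Lemma wp_ROUND l t (Q : ast -> Prop) f q o :
  env f -> f 58 = l -> l <= n -> size I < W -> TROUND <= t ->
  (forall f', env f' -> agh XR f f' -> f' 58 = (round lessP m kh I (l, o)).1 ->
     (round lessP m kh I (l, o)).1 <= n ->
     Q (Ast f' q (round lessP m kh I (l, o)).2)) ->
  wp ROUND t Q (Ast f q o).
Proof.
move=> he h58 hl hIW ht HQ.
apply: (wp_seq HW (t1 := m * 40 + 30)); last by move: ht; rewrite /TROUND; lia.
apply: wp_CLEAR => // f1 e1 ag1 hp1.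
apply: (wp_seq HW (t1 := size I * (TSEL + 40) + 30)); last by move: ht; rewrite /TROUND; lia.
apply: (@wp_COLLECT (fun=> 0) l) => //; first by rewrite ag1.
move=> f2 h2 e2 ag2 hp2 hn2 E2.
apply: (wp_seq HW (t1 := m * (TSIFT kh + 100) + 40)); last by move: ht; rewrite /TROUND; lia.
apply: (@wp_HSORT h2) => // f3 e3 ag3 hp3.
apply: (@wp_EMIT (hsort lessP kh m h2) l) => //.
- by rewrite ag3 // ag2 // ag1.
- by move: ht; rewrite /TROUND; lia.
move=> f4 e4 ag4 r58.
have E : round lessP m kh I (l, o) = (last l [seq x <- mkseq (hsort lessP kh m h2) m | x != 0],
    o ++ [seq x <- mkseq (hsort lessP kh m h2) m | x != 0]) by rewrite /round E2.
rewrite -/(round _ _ _ _ _) in HQ; rewrite E in HQ; apply: HQ => //.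
- apply: agh_trans (_ : agh XR f f1) _; first exact: agh_sub ag1.
  apply: agh_trans (_ : agh XR f1 f2) _; first exact: agh_sub ag2.
  apply: agh_trans (_ : agh XR f2 f3) _; first exact: agh_sub ag3.
  by apply: agree_agh; exact: agree_sub_all ag4.
- have hle : forall sz h, (forall j, j < m -> h j <= n) -> sz <= m ->
      forall j, j < m -> hsort lessP kh sz h j <= n.
    elim=> [|sz IH] h' hh' hsz j hj /=; first exact: hh'.
    apply: IH => //; last exact: ltnW.
    move=> j' hj'; rewrite /upd; case: ifP => _; first exact: hh'.
    by apply: sift_le => //; [exact: hh'|exact: ltnW].
  set s' := [seq x <- _ | _] in r58 *.
  have : all (fun x => x <= n) (l :: s').
    rewrite /= hl; apply/allP => x; rewrite mem_filter => /andP[_ /mapP[j]].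
    by rewrite mem_iota => hj ->; apply: hle.
  by move/allP; apply; exact: mem_last.
Qed.

Opaque ROUND TROUND.
Variable nr : nat.
Hypothesis Hnr : size I <= nr * m.

(** Register 56 drops by m in each round irrespective of what is output, so the loop ends in time
    even if a bad tape makes the rounds return wrong indices. *)
Lemma wp_MAIN t (Q : ast -> Prop) f q :
  env f -> size I < W -> nr * (TROUND + 50) + 40 <= t ->
  (forall f' r, size I <= r * m -> Q (Ast f' q (iter r (round lessP m kh I) (0, [::])).2)) ->
  wp MAIN t Q (Ast f q [::]).
Proof.
move=> he hIW ht HQ; have [_ e3 _ _ e6 _ _] := he.
wsv 0; first by rewrite /=; split => //; lia.
wsv (size I); first by rewrite /= /upd /= e3.
set f1 := upd _ 56 _.
pose Inv (mu : nat) (st : ast) := exists f2 r R, [/\ st = Ast f2 q (iter r (round lessP m kh I) (0, [::])).2,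
  env f2, f2 56 = R /\ f2 58 = (iter r (round lessP m kh I) (0, [::])).1,
  (iter r (round lessP m kh I) (0, [::])).1 <= n & R = size I - r * m /\ R <= mu * m].
have [tb htb0 htb] : exists2 tb, tb = TROUND + 40 & TROUND + 40 <= tb by exists (TROUND + 40).
apply: (wp_whl HW (Inv := Inv) (k := nr) (tb := tb)) => //.
- move=> mu st [f2 [r [R [-> e2 [r56 r58] hl [hR hmu]]]]] /=.
  rewrite r56; split=> //.
  + by move=> E; apply: HQ; rewrite E in hR; lia.
  + move=> R0; split; first by rewrite lt0n; apply/eqP => E; rewrite E mul0n in hmu; lia.
    case: mu hmu => [|mu] hmu; first by rewrite mul0n in hmu; lia.
    apply: (wp_seq HW (t1 := TROUND)); last by wtime.
    apply: (@wp_ROUND (iter r (round lessP m kh I) (0, [::])).1) => // f3 e3' ag3 t58 hl3.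
    rewrite -surjective_pairing -iterS in t58 hl3 *.
    have t56 : f3 56 = R by rewrite ag3.
    have t6 : f3 6 = m by case: e3'.
    rewrite mulSn in hmu.
    wif; first by [].
    * rewrite /= t6 t56 => h; have {}h : m < R by case: (m < R) h.
      wsl (R - m); first by rewrite /= t6 t56; do ![split => //]; exact: ltnW.
      exists (upd f3 56 (R - m)), r.+1, (R - m); split => //; first exact: env_upd.
      by rewrite mulSn; split; lia.
    * rewrite /= t6 t56 => h; have {}h : R <= m by case: leqP h.
      wsl 0; first by rewrite /=; split => //; lia.
      exists (upd f3 56 0), r.+1, 0; split => //; first exact: env_upd.
      by rewrite mulSn; split; lia.
- exists f1, 0, (size I); split => //; first by do 2!(apply: env_upd => //).
  by rewrite mul0n subn0.
- by rewrite htb0 /=; move: ht; clear; move: (TROUND) => X; nia.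
Qed.

(** * Building the samples *)

Section Setup.
Hypothesis s0 : 0 < s.
Let Hb : sampling_ok := Hbig s0.

Definition sval cc x i := nth 0 [:: c0 (PH cc (take x T)); c1 (PH cc (take x T)); c2 (PH cc (take x T));
  c0 (PWc cc x); c1 (PWc cc x); c2 (PWc cc x)] i.

Record envK (f : nat -> nat) : Prop := EnvK {
  kN : f 2 = n; kB : f 3 = size I; kS : f 4 = s; kLim : f 5 = lim; kM : f 6 = m; kHB : f 7 = hb;
  kP : f 8 = p; kC : f 9 = c; kD : f 10 = D; kQ : f 11 = q1; kSB : f 12 = sb;
  kR : forall cc, cc < kappa -> f (RG cc 0) = rr cc;
  kG0 : forall cc, cc < kappa -> f (RG cc 1) = g0 cc;
  kG1 : forall cc, cc < kappa -> f (RG cc 2) = g1 cc;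
  kG2 : forall cc, cc < kappa -> f (RG cc 3) = g2 cc }.

Lemma envK_chg f f' : envK f -> (forall x, ~~ scr x -> x < sb -> f' x = f x) -> envK f'.
Proof.
case=> h1 h2 h3 h4 h5 h6 h7 h8 h9 h10 h11 h12 h13 h14 h15 H.
have hRG cc i : cc < kappa -> i < 4 -> f' (RG cc i) = f (RG cc i).
  by move=> hc hi; apply: H; rewrite /RG /scr; move: hc; rewrite /kappa; lia.
have hs x : x < 160 -> x < sb by move=> h; exact: leq_trans h Hsb.
by split; rewrite ?H ?hs //; move=> cc hc; rewrite hRG //; [apply: h12|apply: h13|apply: h14|apply: h15].
Qed.

Lemma addr_inj cc k i cc' k' i' : k < q1 -> k' < q1 -> i < 6 -> i' < 6 ->
  addr cc k i = addr cc' k' i' -> [/\ cc = cc', k = k' & i = i'].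
Proof.
move=> hk hk' hi hi'; rewrite /addr -!addnA => /addnI /(eq_code hi hi') [E ->].
by have [-> ->] := eq_code hk hk' E.
Qed.

Lemma addr_sb cc k i : sb <= addr cc k i. Proof. by rewrite /addr -addnA leq_addr. Qed.

Lemma addr160 cc k i : 160 <= addr cc k i. Proof. exact: leq_trans Hsb (addr_sb _ _ _). Qed.

Lemma addr_add cc k i : addr cc k i = addr cc k 0 + i. Proof. by rewrite /addr addn0. Qed.

Lemma addr_ok cc k i : cc < kappa -> k < q1 -> i < 6 ->
  [/\ addr cc k i < W, addr cc k i <= MA & ~~ tmp (addr cc k i)].
Proof.
move=> hc hk hi; have h : addr cc k i < sb + kappa * q1 * 6 by first [exact: addr_lt | exact: addr_lt Hb _ _ _].
have [_ _ _ _ _ _ _ _ _ _ hmMA hmW] := Hb.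
split; [exact: ltn_trans h hmW|exact: leq_trans (ltnW h) hmMA|exact: ntmp_sb (addr_sb _ _ _)].
Qed.

Lemma wp_sto_addr cc k i e v t (Q : ast -> Prop) f q o :
  cc < kappa -> k < q1 -> i < 6 -> i < W -> f 47 = addr cc k 0 ->
  depth e <= 29 -> 6 + exp_size e <= t -> ok f e /\ ev f e = v ->
  Q (Ast (upd f (addr cc k i) v) q o) -> wp (Sto (Op OAdd (V 47) (K i)) e) t Q (Ast f q o).
Proof.
move=> hc hk hi hiW h47 hd ht [ok1 ev1] HQ.
have [a1 a2 a3] := addr_ok hc hk hi.
apply: (wp_sto _ HW) => //=; rewrite ?h47 -?addr_add ?ev1 //.
by move: ht; clear; lia.
Qed.

Lemma wp_STOS cc k l t (Q : ast -> Prop) f q o :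
  cc < kappa -> k < q1 -> 6 < W -> all (fun i => i < 6) l -> f 47 = addr cc k 0 ->
  size l * 8 <= t ->
  (forall f', (forall y, (forall i, i < 6 -> y <> addr cc k i) -> f' y = f y) ->
     (forall i, i \in l -> f' (addr cc k i) = f (30 + i)) ->
     (forall i, i < 6 -> i \notin l -> f' (addr cc k i) = f (addr cc k i)) -> Q (Ast f' q o)) ->
  wp (STOS l) t Q (Ast f q o).
Proof.
move=> hc hk w6; elim: l t f Q => [|i l IH] t f Q /=; first by move=> _ h47 ht HQ; apply: wp_skip; apply: HQ.
move=> /andP[hi hl] h47 ht HQ.
have iW : i < W by exact: ltn_trans w6.
have low y : y < 160 -> forall j, y <> addr cc k j.
  by move=> hy j E; have := addr160 cc k j; rewrite -E leqNgt hy.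
apply: (wp_seq HW (t1 := 8)); last by move: ht; clear; lia.
apply: (@wp_sto_addr cc k i _ (f (30 + i))) => //.
  by rewrite /=; split=> //; lia.
apply: IH => //.
- by rewrite upd_ne //; apply/eqP; exact: low.
- by move: ht; clear; lia.
move=> f' h1 h2 h3; apply: HQ.
- by move=> y hy; rewrite h1 // upd_ne //; apply/eqP; exact: hy.
- move=> j; rewrite inE; case: (boolP (j \in l)) => [jl _|jl]; last first.
    by rewrite orbF => /eqP E; rewrite E in jl *; rewrite h3 // /upd !eqxx.
  have hj : j < 6 by move/allP: hl => /(_ j jl).
  rewrite h2 // upd_ne //; apply/eqP; apply: low.
  by move: hj; clear; lia.
- move=> j hj; rewrite inE negb_or => /andP[ji jl]; rewrite h3 // upd_ne //.
  by apply: contra ji => /eqP/(addr_inj hk hk hj hi)[_ _ ->].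
Qed.

Lemma wp_STORE cc x t (Q : ast -> Prop) f q o :
  cc < kappa -> envK f -> f 45 = x -> f 29 = addr cc 0 0 -> x <= n -> 100 <= t ->
  (forall f', (forall y, y != 47 -> (s %| x -> forall i, i < 6 -> y <> addr cc (x %/ s) i) -> f' y = f y) ->
     (s %| x -> forall i, i < 6 -> f' (addr cc (x %/ s) i) = f (30 + i)) -> Q (Ast f' q o)) ->
  wp STORE t Q (Ast f q o).
Proof.
move=> hcc he h45 h29 hx ht HQ.
have hk : x %/ s < q1 by first [exact: div_lt_q1 | exact: div_lt_q1 Hb _ _].
have w6 : 6 < W.
  have [a _ _] := addr_ok hcc hk (isT : 0 < 6).
  by apply: leq_ltn_trans a; apply: leq_trans (addr160 cc (x %/ s) 0).
wif; first by [].
  rewrite /= h45 (kS he) => hne; apply: wp_skip; apply: HQ => //.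
  by rewrite /dvdn => hd; rewrite hd in hne.
rewrite /= h45 (kS he) => /eqP hd; rewrite -/(dvdn s x) in hd.
have A0 : addr cc 0 0 + x %/ s * 6 = addr cc (x %/ s) 0 by rewrite /addr; lia.
wsv (addr cc (x %/ s) 0).
  have [a _ _] := addr_ok hcc hk (isT : 0 < 6).
  rewrite /= h29 h45 (kS he) A0; do ![split => //].
  by apply: leq_ltn_trans a; rewrite -A0 leq_addl.
apply: (@wp_STOS cc (x %/ s) (iota 0 6)) => //; first by wtime.
move=> f' h1 h2 h3; apply: HQ.
- by move=> y hy hne; rewrite h1; [rewrite upd_ne|move=> i hi; exact: hne].
- move=> _ i hi; rewrite h2 ?mem_iota //.
  by rewrite upd_ne //; apply/eqP; move: hi; clear; lia.
Qed.

Opaque STORE.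

Definition buildX := [:: 47; 48; 49; 30; 31; 32; 33; 34; 35; 45].

Lemma wp_BUILD cc t (Q : ast -> Prop) f q o :
  cc < kappa -> envK f -> n * 800 + 300 <= t ->
  (forall f', (forall y, ~~ scr y -> (forall k i, k < q1 -> i < 6 -> y <> addr cc k i) -> f' y = f y) ->
     (forall k i, k * s <= n -> i < 6 -> f' (addr cc k i) = sval cc (k * s) i) -> Q (Ast f' q o)) ->
  wp (BUILD cc) t Q (Ast f q o).
Proof.
move=> hcc he ht HQ.
have h4 : forall i, i < 4 -> RG cc i < 130 by move=> i; exact: RG130.
have [a0 _ _] : [/\ addr cc 0 0 < W, addr cc 0 0 <= MA & ~~ tmp (addr cc 0 0)].
  by apply: addr_ok => //; apply: leq_ltn_trans (bq Hb).
have w160 : 160 < W by apply: leq_ltn_trans a0; exact: addr160.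
have w6 : 6 < W by exact: ltn_trans w160.
wsv (g0 cc); first by split; [exact: h4|exact: (kG0 he)].
wsv (g1 cc); first by split; [exact: h4|rewrite /= upd_RG //; exact: (kG1 he)].
wsv (g2 cc); first by split; [exact: h4|rewrite /= !upd_RG //; exact: (kG2 he)].
wsv (rr cc); first by split; [exact: h4|rewrite /= !upd_RG //; exact: (kR he)].
wsv (addr cc 0 0).
  have q1W : cc * q1 * 6 <= addr cc 0 0 by rewrite /addr; clear; lia.
  have q1W2 : cc * q1 <= addr cc 0 0 by rewrite /addr; clear; lia.
  have hcW : cc < W by apply: ltn_trans (_ : 17 < W) => //; exact: ltn_trans w160.
  rewrite /= /upd /= (kSB he) (kQ he); do ![split => //];
    try exact: leq_ltn_trans q1W a0; try exact: leq_ltn_trans q1W2 a0.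
  - by apply: leq_ltn_trans a0; rewrite /addr; clear; lia.
  - by rewrite /addr; clear; lia.
wsv 0; first by rewrite /=; split=> //; lia.
wsv 0; first by rewrite /=; split=> //; lia.
wsv 0; first by rewrite /=; split=> //; lia.
wsv 1; first by [].
wsv 0; first by rewrite /=; split=> //; lia.
wsv 0; first by rewrite /=; split=> //; lia.
wsv 0; first by rewrite /=; split=> //; lia.
set f1 := upd _ 45 _.
(* A sample is stored at the start of an iteration, so those at multiples of s below x are present;
   the [STORE] after the loop treats x = n. *)
pose Inv (mu : nat) (st : ast) := exists f2 x, [/\ st = Ast f2 q o,
  (forall y, ~~ scr y -> (forall k i, k < q1 -> i < 6 -> y <> addr cc k i) -> f2 y = f y),
  [/\ f2 45 = x, x + mu = n & f2 29 = addr cc 0 0],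
  [/\ f2 25 = g0 cc, f2 26 = g1 cc, f2 27 = g2 cc & f2 28 = rr cc] &
  [/\ (f2 30, f2 31, f2 32) = PH cc (take x T), (f2 33, f2 34, f2 35) = PWc cc x &
   forall k i, k * s < x -> i < 6 -> f2 (addr cc k i) = sval cc (k * s) i]].
have K2 f2 : (forall y, ~~ scr y -> (forall k i, k < q1 -> i < 6 -> y <> addr cc k i) -> f2 y = f y) -> envK f2.
  move=> h; apply: (envK_chg he) => y hy ysb; apply: h => // k i _ _ E.
  by have := addr_sb cc k i; rewrite -E leqNgt ysb.
have low k i y : y < 160 -> addr cc k i != y.
  by move=> hy; apply/eqP => E; have := addr160 cc k i; rewrite E leqNgt hy.
have step tt f2 x (Q2 : ast -> Prop) : 100 <= tt -> x <= n ->
    (forall y, ~~ scr y -> (forall k i, k < q1 -> i < 6 -> y <> addr cc k i) -> f2 y = f y) ->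
    f2 45 = x -> f2 29 = addr cc 0 0 -> (f2 30, f2 31, f2 32) = PH cc (take x T) -> (f2 33, f2 34, f2 35) = PWc cc x ->
    (forall k i, k * s < x -> i < 6 -> f2 (addr cc k i) = sval cc (k * s) i) ->
    (forall f3, (forall y, ~~ scr y -> (forall k i, k < q1 -> i < 6 -> y <> addr cc k i) -> f3 y = f y) ->
       (forall y, y < 160 -> y != 47 -> f3 y = f2 y) ->
       (forall k i, k * s <= x -> i < 6 -> f3 (addr cc k i) = sval cc (k * s) i) -> Q2 (Ast f3 q o)) ->
    wp STORE tt Q2 (Ast f2 q o).
  move=> htt hx hf r45 r29 hph hpw hs HQ2.
  apply: (@wp_STORE cc x) => //; first exact: K2.
  have hk : x %/ s < q1 by first [exact: div_lt_q1 | exact: div_lt_q1 Hb _ _].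
  move=> f3 h1 h2; apply: HQ2.
  - move=> y hy hA; rewrite h1; [exact: hf| |].
      by apply: contra hy => /eqP->.
    by move=> _ i hi; exact: hA.
  - by move=> y hy y47; apply: h1 => // _ i _; apply/eqP; rewrite eq_sym; exact: low.
  - move=> k i; rewrite leq_eqVlt => /orP[/eqP E|hlt] hi.
      have hd : s %| x by rewrite -E dvdn_mull.
      have Ek : x %/ s = k by rewrite -E mulnK.
      rewrite -Ek h2 // Ek E /sval.
      have [p0 p1 p2] : [/\ f2 30 = c0 (PH cc (take x T)), f2 31 = c1 (PH cc (take x T)) & f2 32 = c2 (PH cc (take x T))].
        by rewrite -hph.
      have [p3 p4 p5] : [/\ f2 33 = c0 (PWc cc x), f2 34 = c1 (PWc cc x) & f2 35 = c2 (PWc cc x)].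
        by rewrite -hpw.
      by move: i hi => [|[|[|[|[|[|//]]]]]].
    rewrite h1; [exact: hs|by apply: low|].
    move=> hd i' hi' /addr_inj [] //.
      have hkn : k * s <= n by apply: leq_trans (ltnW hlt) hx.
      have : k * s %/ s < q1 by first [exact: div_lt_q1 | exact: div_lt_q1 Hb _ _].
      by rewrite mulnK.
    by move=> _ Ek _; rewrite Ek divnK // ltnn in hlt.
apply: (wp_seq HW (t1 := n * 790 + 30)); last by wtime.
have [tb htb0 htb] : exists2 tb, tb = 780 & 780 <= tb by exists 780.
apply: (wp_whl HW (Inv := Inv) (k := n) (tb := tb)) => //.
- move=> mu st [f2 [x [-> hf [r45 hx r29] [r25 r26 r27 r28] [hph hpw hs]]]] /=.
  have e2 := K2 _ hf.
  have r2 : f2 2 = n := kN e2.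
  rewrite r45 r2; split=> //.
  + move=> E; have {E} Ex : x = n by move: E; case: ltnP => // *; lia.
    rewrite Ex in r45 hph hpw hs.
    apply: (step _ _ n) => //; first by wtime.
    by move=> f3 h1 _ h3; apply: HQ.
  + move=> E; have {}E : x < n by case: (x < n) E.
    split; first by move: E hx; clear; lia.
    apply: (wp_seq HW (t1 := 100)); last by wtime.
    apply: (step _ _ x) => //; first exact: ltnW.
    move=> f3 h1 h2 h3.
    have e3 := K2 _ h1.
    have r8 := kP e3; have r9 := kC e3.
    have wfp := wf_phi c W D (rr cc) (gg cc) (bpp Hb) (take x T).
    have wfw := wf_pw c (gg cc) (bpp Hb) x.
    apply: (wp_seq HW (t1 := 210)); last by wtime.
    apply: (@wp_MUL Hb 30 25 _ _ _ _ f3 q o isT r8 r9 _ _ wfp (bwf Hb cc)) => //; try (by rewrite !h2 // ?r25 ?r26 ?r27).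
    move=> f4 ag4 hm.
    have r4 z : z \notin [:: 47; 48; 49; 30; 31; 32] -> f4 z = f3 z := ag4 z.
    have [m0' m1 m2] : [/\ f4 30 < p, f4 31 < p & f4 32 < p].
      by have := wf_mul3 c (bpp Hb) (PH cc (take x T)) (gg cc); rewrite -hm => /and3P.
    have hrc : PH cc (take x.+1 T) = stp p c W D (rr cc) (gg cc) (PH cc (take x T)) (nth 0 T x).
      by rewrite (take_nth 0 E) /phi foldl_rcons.
    have t8 : f4 8 = p by rewrite r4.
    apply: (wp_setv HW (v := ad p (f4 30) (hl W D (rr cc) (nth 0 T x)))) => //; first by wtime.
      have [] : okp f4 (adE (V 30) (hlE (RT (V 45)))) (ad p (f4 30) (hl W D (rr cc) (nth 0 T x))).
        apply: okp_ad => //.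
        split; rewrite /= ?r4 // ?h2 // ?r28 ?r45 ?(kD e2) //; exact: (bhl Hb).
      by [].
    set f5 := upd f4 30 _.
    have hph5 : (f5 30, f5 31, f5 32) = PH cc (take x.+1 T).
      by rewrite hrc /stp -hm /f5 /upd.
    have r5 z : z \notin [:: 47; 48; 49; 30; 31; 32] -> f5 z = f3 z.
      by move=> hz; rewrite /f5 upd_ne ?r4 //; apply: contra hz => /eqP->.
    clearbody f5.
    apply: (wp_seq HW (t1 := 210)); last by wtime.
    apply: (@wp_MUL Hb 33 25 _ _ _ _ f5 q o isT _ _ _ _ wfw (bwf Hb cc)) => //;
      try (by rewrite !r5 // !h2 // ?r25 ?r26 ?r27); try by rewrite r5.
    move=> f6 ag6 hm6.
    have r6 z : z \notin [:: 47; 48; 49; 33; 34; 35] -> f6 z = f5 z := ag6 z.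
    wsl x.+1.
      by rewrite /= r6 // r5 // h2 // r45 addn1; do ![split=> //]; exact: leq_ltn_trans E TW.
    have r160 y : y \notin buildX -> upd f6 45 x.+1 y = f3 y.
      move=> hy; rewrite upd_ne ?r6 ?r5 //; apply: contra hy; rewrite !inE;
       by do ?[case/orP => [->|]; rewrite ?orbT //]; move=> ->; rewrite ?orbT.
    exists (upd f6 45 x.+1), x.+1; split => //.
    * move=> y hy hA; rewrite r160 ?h1 //.
      by apply: contra hy; move: y {hA}; apply/allP.
    * by split => //; [lia|rewrite r160 // h2].
    * by split; rewrite r160 // h2.
    * split; [by rewrite -hph5 /upd /= !r6|by rewrite /pw iterS -/(pw _ _ _ _) -hm6|].
      move=> k i hk hi; rewrite r160 ?h3 //.
      have hl y : y \in buildX -> y < 160 by move: y; apply/allP.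
      by apply/negP => /hl; rewrite ltnNge addr160.
- exists f1, 0; split => //.
  + move=> y hy hA; rewrite /f1 !upd_ne //; by apply: contra hy => /eqP->.
  + by rewrite take0.
- by rewrite htb0 /=; clear; lia.
Qed.

Opaque BUILD.

Definition sampled cc f := forall k i, k * s <= n -> i < 6 -> f (addr cc k i) = sval cc (k * s) i.

Lemma wp_BUILDS l t (Q : ast -> Prop) f q o :
  uniq l -> all (fun cc => cc < kappa) l -> envK f -> size l * (n * 800 + 300) <= t ->
  (forall f', envK f' -> (forall cc, cc < kappa -> cc \in l \/ sampled cc f -> sampled cc f') -> Q (Ast f' q o)) ->
  wp (BUILDS l) t Q (Ast f q o).
Proof.
elim: l t f Q => [|cc l IH] t f Q.
  by move=> _ _ he ht HQ; apply: wp_skip; apply: HQ => // cc _ [].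
move=> /= /andP[hn hu] /andP[hc hl] he ht HQ.
apply: (wp_seq HW (t1 := n * 800 + 300)); last by move: ht; rewrite mulSn; clear; lia.
apply: wp_BUILD => // f1 h1 h2.
have e1 : envK f1.
  apply: (envK_chg he) => y hy ysb; apply: h1 => // k i _ _ E.
  by have := addr_sb cc k i; rewrite -E leqNgt ysb.
have ht2 : size l * (n * 800 + 300) <= t - (n * 800 + 300).
  by move: ht; rewrite mulSn => ht; rewrite leq_subRL 1?(leq_trans (leq_addr _ _) ht).
apply: (IH _ _ _ hu hl e1 ht2) => //.
move=> f2 e2 h3; apply: HQ => // cc' hc' hor; apply: h3 => //.
have [->|ne] := eqVneq cc' cc; first by right.
case: hor => [|hs]; first by rewrite inE (negPf ne) /= => ?; left.
right=> k i hk hi; rewrite h1; [exact: hs|by have := addr160 cc' k i; move: (addr cc' k i) => z; rewrite /scr; clear; lia|].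
move=> k' i' hk' hi' /addr_inj [] //.
  have : k * s %/ s < q1 by first [exact: div_lt_q1 | exact: div_lt_q1 Hb _ _].
  by rewrite mulnK.
by move=> E; rewrite E eqxx in ne.
Qed.

Lemma wp_BUILD_all t (Q : ast -> Prop) f q o :
  envK f -> kappa * (n * 800 + 300) <= t ->
  (forall f', env f' -> Q (Ast f' q o)) ->
  wp (BUILDS (iota 0 kappa)) t Q (Ast f q o).
Proof.
move=> he ht HQ; apply: wp_BUILDS => //.
move=> f' [h1 h2 h3 h4 h5 h6 h7 h8 h9 h10 h11 h12 h13 h14 h15] hS.
apply: HQ; split=> // _; split=> // cc k hc hk.
have H : sampled cc f' by apply: hS => //; left; rewrite mem_iota.
by split; split; rewrite H.
Qed.

End Setup.

End Prog.

(** * Setting up the parameters *)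

Definition PRIMEC := SEARCH 8 (Op OEq (Op OMod (V 8) (V 16)) (K 0)) 2.
Definition ROOTC := SEARCH 9
  (Op OEq (mmE (mmE (V 16) (V 16)) (V 16)) (adE (V 16) (V 9))) 0.

Definition GEO :=
  FINDM ;; 8 ::= V 14 ;; PRIMEC ;; 9 ::= K 0 ;; ROOTC ;;
  10 ::= Op OAdd (Op ODiv MaxW (V 14)) (K 1) ;;
  11 ::= Op OAdd (Op ODiv (V 3) (K 816)) (K 2) ;;
  4 ::= Op OAdd (Op ODiv (V 2) (V 11)) (K 1) ;;
  5 ::= V 4 ;;
  6 ::= Op OAdd (Op ODiv (V 3) (K 4)) (K 1) ;;
  7 ::= K 160 ;;
  12 ::= Op OAdd (K 160) (V 6) ;;
  PARAM (iota 0 kappa).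

Section Geo.
Variables (w : nat) (T I : seq nat) (tape : nat -> nat) (MA : nat).
Local Notation W := (2 ^ w).
Hypothesis HW : machine_ok w T I MA.
Let W1 : 1 < W. Proof. by case: HW. Qed.
Let TW : size T < W. Proof. by case: HW. Qed.
Local Notation wp := (wp w T I tape MA).
Local Notation ok := (ok w T I MA).
Local Notation ev := (ev w T I).
Local Notation n := (size T).
Local Notation b := (size I).

Lemma prime_test v : 1 < v -> ~~ has (fun x => v %% x == 0) (iota 2 (v - 2)) = prime v.
Proof.
move=> v1; apply/idP/idP.
- move=> /hasPn h; rewrite -[prime v]negbK; apply/negP => /primePn[|[d hd hdv]]; first by rewrite ltnNge v1.
  by have := h d; rewrite mem_iota -/(dvdn d v) hdv; move/(_ _)/negP; apply => //; lia.
- move=> pv; apply/hasPn => x; rewrite mem_iota => hx; apply/negP => hd.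
  by have := primeP pv => [[_ /(_ x hd)]]; lia.
Qed.

Definition rootfreeb p c := ~~ has (fun x => ((x * x) %% p * x) %% p == (x + c) %% p) (iota 0 (p - 0)).

Lemma rootfreeP p c : rootfreeb p c -> cubic_rootfree p c.
Proof. by move=> /hasPn h x hx; apply: h; rewrite mem_iota subn0. Qed.

Lemma rootfreeP2 p c : cubic_rootfree p c -> rootfreeb p c.
Proof. by move=> h; apply/hasPn => x; rewrite mem_iota subn0 => hx; apply: h. Qed.

(* 816 = 8 * 6 * 17: the samples, six words for each of 17 copies, then occupy
   about b / 8 words, and b / 4 more hold the heap, so that every address is
   below n < 2^w. *)
Definition num_samples := b %/ 816 + 2.
Definition stride := n %/ num_samples + 1.
Definition heap_size := b %/ 4 + 1.

(** Minimality of p and c makes the parameters a function of the length ([params_uniq]), so the set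
    of good tapes is fixed before a tape is drawn. *)
Record params (N j p c : nat) : Prop := Params {
  pjN : 32 ^ j <= N < 32 ^ j.+1;
  p_prime : prime p;
  p_ge : 4 ^ j <= p;
  p_min : forall v, 4 ^ j <= v -> prime v -> p <= v;
  p_sq : p * p <= 32 ^ j;
  c_lt : c < p;
  c_root : cubic_rootfree p c;
  c_min : forall v, cubic_rootfree p v -> c <= v }.

Lemma expn_interval_inj B j k N : 1 < B -> B ^ j <= N < B ^ j.+1 -> B ^ k <= N < B ^ k.+1 -> j = k.
Proof.
move=> B1 /andP[a1 a2] /andP[b1 b2].
have := leq_ltn_trans a1 b2; have := leq_ltn_trans b1 a2.
by rewrite !ltn_exp2l //; clear; lia.
Qed.

Lemma params_ex n0 N : n0 = 32 ^ 169 -> n0 <= N -> exists j p c, 169 <= j /\ params N j p c.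
Proof.
move=> En0 hN; have N0 : 0 < N by apply: leq_trans hN; rewrite En0 expn_gt0.
have hj := trunc_log_bounds (isT : 1 < 32) N0; set j := trunc_log 32 N in hj.
have hj169 : 169 <= j.
  have : n0 < 32 ^ j.+1 by case/andP: hj => _; apply: leq_ltn_trans.
  by rewrite En0 ltn_exp2l.
have [p0 pp0 [hMp0 hp0]] := prime_between (leq_trans (isT : 40 <= 169) hj169).
have ex : exists v, (4 ^ j <= v) && prime v by exists p0; rewrite hMp0.
have [p /andP[hMp pp] pmin] := ex_minnP ex.
have hpp0 : p <= p0 by apply: pmin; rewrite hMp0.
have ex2 : exists c, rootfreeb p c by have [c _ hc] := exists_rootfree pp; exists c; exact: rootfreeP2.
have [c hc cmin] := ex_minnP ex2.
exists j, p, c; split => //; split => //.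
- by move=> v h1 h2; apply: pmin; rewrite h1.
- by apply: leq_trans hp0; exact: leq_mul.
- by have [c' hc' /rootfreeP2/cmin h] := exists_rootfree pp; exact: leq_ltn_trans h hc'.
- exact: rootfreeP.
- by move=> v /rootfreeP2/cmin.
Qed.

Lemma wp_PRIMEC j p c t (Q : ast -> Prop) f q o : params n j p c ->
  f 8 = 4 ^ j -> 1 < 4 ^ j -> n * 130 + 20 <= t ->
  (forall f', agree [:: 15; 16; 8] f f' -> f' 8 = p -> Q (Ast f' q o)) ->
  wp PRIMEC t Q (Ast f q o).
Proof.
case=> hj pp hMp pmin hp _ _ _ h8 M1 ht HQ.
have p1 := prime_gt1 pp.
have hpn : p * p <= n by apply: leq_trans hp _; case/andP: hj.
have pn : p < W by apply: leq_ltn_trans TW; apply: leq_trans hpn; nia.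
apply: (@wp_SEARCH _ _ _ tape _ HW 8 _ 2 (fun v x => v %% x == 0) id (4 ^ j) p p) => //.
- by apply: leq_ltn_trans pn.
- by rewrite prime_test.
- move=> v /andP[h1 h2]; rewrite negbK -[has _ _]negbK prime_test; last exact: leq_trans h1.
  by apply/negP => pv; have := pmin v h1 pv; rewrite leqNgt h2.
- by move=> v /andP[].
- move=> f' v x ag r8 hv r16 hx; rewrite /= r8 r16; split; last by case: (v %% x == 0).
  by split => //; lia.
- by apply: leq_trans ht; nia.
Qed.

Lemma wp_ROOTC j p c t (Q : ast -> Prop) f q o : params n j p c ->
  f 8 = p -> f 9 = 0 -> n * 130 + 20 <= t ->
  (forall f', agree [:: 15; 16; 9] f f' -> f' 9 = c -> Q (Ast f' q o)) ->
  wp ROOTC t Q (Ast f q o).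
Proof.
case=> hj pp _ _ hp cp hc cmin h8 h9 ht HQ.
have {}hp : p * p <= n by apply: leq_trans hp _; case/andP: hj.
have p1 := prime_gt1 pp.
have pn : p + p < W by apply: leq_ltn_trans TW; apply: leq_trans hp; nia.
have pW : p * p < W by exact: leq_ltn_trans TW.
have pW1 : p < W by apply: leq_ltn_trans pn; exact: leq_addr.
apply: (@wp_SEARCH _ _ _ tape _ HW 9 _ 0 (fun v x => ((x * x) %% p * x) %% p == (x + v) %% p) (fun=> p) 0 c p) => //.
- exact: ltn_trans W1.
- exact: ltn_trans cp pW1.
- exact: rootfreeP2.
- move=> v /= h2; rewrite -/(rootfreeb p v).
  by apply/negP => /rootfreeP/cmin; rewrite leqNgt h2.
- move=> f' v x ag r9 hv r16 hx.
  have r8 : f' 8 = p by rewrite ag.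
  have hm : (x * x) %% p < p by rewrite ltn_mod prime_gt0.
  rewrite /= r8 r9 r16; split; last by case: (_ == _ %% p).
  do ![split => //].
  + by apply: leq_ltn_trans pW; apply: leq_mul; lia.
  + by apply: leq_ltn_trans pW; apply: leq_mul; lia.
  + by apply: leq_ltn_trans pn; lia.
- by move=> f' v ag _ _; rewrite ag.
- by apply: leq_trans ht; nia.
Qed.

Variable x : nat -> nat -> nat.
Definition hash_multiplier cc := odd_word w (x cc 0).
Definition eval_point p i cc := x cc i %% p.

Lemma wp_GEO j p c t (Q : ast -> Prop) f q o : params n j p c ->
  169 <= j -> 1000 <= n -> b <= n ->
  f 2 = n -> f 3 = b -> (forall cc i, cc < kappa -> i < 4 -> f (RG cc i) = x cc i) ->
  n * 400 <= t ->
  (forall f', envK T I stride stride heap_size 160 p c (W %/ 4 ^ j) num_samples (160 + heap_size) hash_multiplier (eval_point p 1) (eval_point p 2) (eval_point p 3) f' ->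
     Q (Ast f' q o)) ->
  wp GEO t Q (Ast f q o).
Proof.
move=> hpar hj169 hn1 hb f2 f3 fR ht HQ.
have {ht}[tt htt ht] : exists2 tt, tt = t & n * 300 + 1000 <= tt by exists t => //; move: ht hn1; clear; lia.
rewrite -htt {htt t}.
apply: (wp_seq HW (t1 := n * 40 + 30)); last by wtime.
apply: wp_FINDM => //; first by move: hn1; clear; lia.
have hj := pjN hpar.
move=> f4 j' ag4 r14 /(expn_interval_inj (isT : 1 < 32) hj) Ej.
rewrite -{}Ej {j'} in r14.
have hjn : 32 ^ j <= n by case/andP: hj.
have M1 : 1 < 4 ^ j by rewrite -(expn0 4) ltn_exp2l //; exact: leq_trans hj169.
wsv (4 ^ j); first by split.
apply: (wp_seq HW (t1 := n * 130 + 20)); last by wtime.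
apply: (wp_PRIMEC hpar) => //.
move=> f5 ag5 r8.
wsv 0; first by rewrite /=; split => //; lia.
apply: (wp_seq HW (t1 := n * 130 + 20)); last by wtime.
apply: (wp_ROOTC hpar) => //.
move=> f6 ag6 r9.
have low y : (y < 8) || (16 < y) || (y == 14) -> f6 y = f4 y.
  move=> hy; rewrite ag6; last by rewrite !inE; move: hy; clear; lia.
  rewrite upd_ne; last by move: hy; clear; lia.
  rewrite ag5; last by rewrite !inE; move: hy; clear; lia.
  by rewrite upd_ne //; move: hy; clear; lia.
have low2 y : (y < 8) || (16 < y) -> f6 y = f y.
  by move=> hy; rewrite low ?orbA ?hy // ag4 // !inE; move: hy; clear; lia.
have t14 : f6 14 = 4 ^ j by rewrite low.
have t8 : f6 8 = p by rewrite ag6.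
have t2 : f6 2 = n by rewrite low2.
have t3 : f6 3 = b by rewrite low2.
have tR cc i : cc < kappa -> i < 4 -> f6 (RG cc i) = x cc i.
  by move=> h1 h2; rewrite low2 ?fR //; rewrite /RG; clear; lia.
clear low low2 ag6 ag5 ag4.
have dW : 4 ^ j %| W.
  rewrite (_ : 4 = 2 ^ 2) // -expnM dvdn_exp2l // -(leq_exp2l (m := 2)) // expnM.
  apply: ltnW; apply: leq_ltn_trans TW; apply: leq_trans hjn.
  by rewrite leq_exp2r //; apply: leq_trans hj169.
(* 2^w itself is not a word, so the quotient is obtained from 2^w - 1; adding 1 corrects it because
   4^j divides 2^w. *)
have hD : W.-1 %/ 4 ^ j + 1 = W %/ 4 ^ j.
  have := divnK dW; have : 0 < W %/ 4 ^ j by rewrite divn_gt0 ?(ltnW M1) // dvdn_leq // ltnW.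
  case: (W %/ 4 ^ j) => // k _ <-.
  rewrite mulSn (_ : (4 ^ j + k * 4 ^ j).-1 = k * 4 ^ j + (4 ^ j).-1); last by move: M1; clear; lia.
  by rewrite divnMDl ?(ltnW M1) // divn_small ?addn0 ?addn1 // ltn_predL ltnW.
have DW : W %/ 4 ^ j < W by apply: ltn_Pdiv => //; exact: ltnW.
have hXs : stride <= n.
  rewrite /stride addn1; apply: leq_ltn_trans (leq_div2l n (isT : 0 < 2) (leq_addl _ 2)) _.
  by apply: ltn_Pdiv => //; move: hn1; clear; lia.
have hXq : b %/ 816 + 2 <= n by move: hn1 hb; clear; lia.
have hXm : b %/ 4 + 1 <= n by move: hn1 hb; clear; lia.
have w816 : 816 < W by move: hn1 TW; clear; lia.
have h160 : 160 + heap_size < W by apply: leq_ltn_trans TW; rewrite /heap_size; move: hn1 hb; clear; lia.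
wsv (W %/ 4 ^ j).
  by rewrite /= t14 hD; do ![split => //].
wsv num_samples.
  rewrite /= upd_ne // t3; do ![split => //]; [exact: ltn_trans w816|exact: leq_ltn_trans TW].
wsv stride.
  rewrite /= /upd /= t2; do ![split => //]; exact: leq_ltn_trans TW.
wsv stride; first by [].
wsv heap_size.
  rewrite /= /upd /= t3; do ![split => //]; [exact: ltn_trans w816|exact: leq_ltn_trans TW].
wsv 160; first by rewrite /=; split => //; exact: ltn_trans w816.
wsv (160 + heap_size); first by rewrite /= /upd /=; do ![split => //]; exact: ltn_trans w816.
set f7 := upd _ 12 _.
have s7 y : y \notin [:: 12; 7; 6; 5; 4; 11; 10] -> f7 y = f6 y.
  by move=> hy; rewrite /f7 !upd_ne //; apply: contra hy => /eqP->.
have [s4 s5 s6 s77 s10] : [/\ f7 4 = stride, f7 5 = stride, f7 6 = heap_size, f7 7 = 160 & f7 10 = W %/ 4 ^ j] by [].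
have [s11 s12] : f7 11 = num_samples /\ f7 12 = 160 + heap_size by [].
clearbody f7.
apply: (@wp_PARAM _ _ _ tape _ HW (iota 0 kappa) p) => //; [by rewrite s7|by wtime|].
move=> f8 h1 h2; apply: HQ => //.
have l8 y : y < 60 -> f8 y = f7 y.
  by move=> hy; apply: h1 => cc i _ _; rewrite /RG; move: hy; clear; lia.
have r7 cc i : cc < kappa -> i < 4 -> f7 (RG cc i) = x cc i.
  by move=> a1 a2; rewrite s7 ?tR // !inE /RG; clear; lia.
split; try (by rewrite l8); try (by rewrite l8 // s7); move=> cc hcc;
  (have [|e0 ei] := h2 cc; first by rewrite mem_iota); by rewrite ?e0 ?ei ?r7.
Qed.
End Geo.

Section Order.
Variables (T I : seq nat).

Lemma rounds_sort lt m kh r : (forall u v, lt u v = ~~ sle T v u) -> 0 < m -> m < 2 ^ kh.+1 ->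
  uniq I -> 0 \notin I -> size I <= r * m ->
  (iter r (round lt m kh I) (0, [::])).2 = sort (sle T) I.
Proof.
move=> E m0 hm uI I0 hr.
rewrite (_ : iter r _ _ = iter r (round (fun u v => ~~ sle T v u) m kh I) (0, [::])).
  by rewrite (rounds_spec (sle_total T) (@sle_trans T) (@sle_anti T)) //= take_oversize // size_sort.
by apply: eq_iter => st; apply: eq_round.
Qed.
End Order.

Lemma params_uniq N j p c j' p' c' : params N j p c -> params N j' p' c' -> [/\ j = j', p = p' & c = c'].
Proof.
case=> hj pp hp pm _ _ hc cm [hj' pp' hp' pm' _ _ hc' cm'].
have Ej := expn_interval_inj (isT : 1 < 32) hj hj'; rewrite -{}Ej {j' hj'} in hp' pm' *.
have Ep : p = p' by apply/eqP; rewrite eqn_leq pm // pm'.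
rewrite -{}Ep {p' pp' hp' pm'} in hc' cm' *.
by split=> //; apply/eqP; rewrite eqn_leq cm // cm'.
Qed.

Definition LARGE := GEO ;; BUILDS (iota 0 kappa).
(* With s = 0 the division by s in [CMPF] yields 0 blocks, so that only letters
   are compared; the one-cell heap is register 0, free once n has been copied. *)
Definition SMALL := 4 ::= K 0 ;; 5 ::= V 2 ;; 6 ::= K 1 ;; 7 ::= K 0.
(* n0 is a power of two, hence [n0 %% 2 ^ w] is n0 or 0, and as division by 0
   yields 0 the test below amounts to n0 <= n for every word size. *)
Definition BODY n0 :=
  2 ::= V 0 ;; 3 ::= V 1 ;; DRAW (iota 0 kappa) ;;
  Ife (Op ODiv (V 2) (KM n0)) (LARGE ;; MAIN) (SMALL ;; MAIN).

(** * Long and short texts *)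

Section Body.
Variables (w : nat) (T I : seq nat) (tape : nat -> nat) (MA : nat).
Local Notation W := (2 ^ w).
Hypothesis HW : machine_ok w T I MA.
Let W1 : 1 < W. Proof. by case: HW. Qed.
Let TW : size T < W. Proof. by case: HW. Qed.
Local Notation wp := (wp w T I tape MA).
Local Notation n := (size T).
Local Notation b := (size I).
Hypothesis Tpos : all (ltn 0) T.
Hypothesis HI : all (fun i => 0 < i <= n) I.
Hypothesis uI : uniq I.
Hypothesis bn : b <= n.
Hypothesis b0 : 0 < b.
Hypothesis bMA : b + 1000 <= MA.
Hypothesis tapeW : forall i, tape i < W.

Let x cc i := tape (4 * cc + i).
Let bW : b < W. Proof. exact: leq_ltn_trans TW. Qed.
Let I0 : 0 \notin I. Proof. by apply/negP => /(allP HI). Qed.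

Lemma pow4 j : 4 ^ j = 2 ^ (2 * j). Proof. by rewrite (_ : 4 = 2 ^ 2) // -expnM. Qed.

Section Large.
Variables (j p c : nat).
Hypothesis hpar : params n j p c.
Hypothesis hj169 : 169 <= j.
Hypothesis hn1 : 1000 <= n.
Local Notation D := (W %/ 4 ^ j).
Local Notation q1 := (num_samples I).
Local Notation s := (stride T I).
Local Notation m := (heap_size I).
Local Notation sb := (160 + m).
Local Notation rr := (hash_multiplier w x).
Local Notation g i := (eval_point x p i).

Let jw : 2 * j <= w.
Proof.
rewrite -(leq_exp2l (m := 2)) // -pow4; apply: ltnW; apply: leq_ltn_trans TW.
case/andP: (pjN hpar) => h _; apply: leq_trans h; rewrite leq_exp2r //; exact: leq_trans hj169.
Qed.

Let DE : D = 2 ^ (w - 2 * j). Proof. by rewrite pow4 expnB. Qed.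

Lemma wf_words cc : wf3 p (g 1 cc, g 2 cc, g 3 cc).
Proof. by rewrite /= /eval_point !ltn_mod prime_gt0 //; case: hpar. Qed.

Lemma sampling_ok_large : sampling_ok w T MA s p c D q1 sb rr (g 1) (g 2) (g 3).
Proof.
have [hj pp hp pm hpp cp hc cm] := hpar.
have jn : 32 ^ j <= n by case/andP: hj.
(* The total is at most 365 + b / 4 + b / 8, as 6 * 17 * (b / 816) <= b / 8; with b <= n and n >=
   1000 it is at most n as well. *)
have hb1 : sb + kappa * q1 * 6 <= b + 1000 by rewrite /heap_size /num_samples /kappa; clear; lia.
have hb2 : sb + kappa * q1 * 6 <= n by rewrite /heap_size /num_samples /kappa; move: bn hn1; clear; lia.
split => //.
- exact: leq_trans hpp jn.
- exact: wf_words.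
- by move=> cc; rewrite ltn_mod expn_gt0.
- apply: ltn_Pdiv; last by rewrite expn_gt0.
  by rewrite -(expn0 4) ltn_exp2l //; exact: leq_trans hj169.
- by rewrite DE expn_gt0.
- by move=> r y; rewrite DE; apply: hl_lt => //; rewrite -pow4.
(* The stride exceeds n divided by the number of samples, so every multiple of it up to n has a
   sample. *)
- by rewrite ltn_divLR /stride addn1 // mulnC ltn_ceil // /num_samples addn2.
- exact: leq_trans hb1 bMA.
- exact: leq_ltn_trans hb2 TW.
Qed.

(** One direction is the absence of false positives on a good tape; the converse holds on every
    tape. *)
Lemma good_large : good_tape p c w j T tape -> good T s (eqb w T s p c D rr (g 1) (g 2) (g 3)).
Proof.
have [hj pp hp pm hpp cp hc cm] := hpar.
move=> hg; rewrite /good /= => _ a b' mid ha hb' hab h1 h2; apply/idP/eqP.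
- move=> E; have hl : mid * s < n.+1 by apply: leq_trans h1; exact: leq_addl.
  move/forallP: hg => /(_ (Ordinal ha))/forallP/(_ (Ordinal hb'))/forallP/(_ (Ordinal hl)).
  rewrite /= h1 h2 /= => /implyP h; apply/eqP; apply: h.
  by apply: etrans E; apply: eq_all => cc; rewrite /copyP /teqw /teqc DE /hash_multiplier /eval_point /x /red3 !addn0.
- move=> E; apply/allP => cc _; apply: teq_same => //; exact: wf_words.
Qed.

Definition bisection_depth := (trunc_log 2 q1).+1.
Definition heap_depth := trunc_log 2 m.

Lemma Xkk_ok : n %/ s < 2 ^ bisection_depth.
Proof.
have h : n %/ s < q1 by case: sampling_ok_large.
apply: ltn_trans h _; rewrite /bisection_depth; apply: trunc_log_ltn; by [].
Qed.

Lemma Xkh_ok : m < 2 ^ heap_depth.+1.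
Proof. exact: trunc_log_ltn. Qed.

Lemma wp_LARGE t (Q : ast -> Prop) f q :
  f 2 = n -> f 3 = b -> (forall cc i, cc < kappa -> i < 4 -> f (RG cc i) = x cc i) ->
  n * 400 + kappa * (n * 800 + 300) + (4 * (TROUND I s s m bisection_depth heap_depth + 50) + 40) <= t ->
  (forall f' o, (good_tape p c w j T tape -> o = sort (sle T) I) -> Q (Ast f' q o)) ->
  wp (LARGE ;; MAIN) t Q (Ast f q [::]).
Proof.
move=> f2 f3 fR ht HQ.
have sb160 : 160 <= sb by exact: leq_addr.
have m0 : 0 < m by rewrite /heap_size addn1.
have mW : m + m <= W by move: TW bn hn1; rewrite /heap_size; clear; lia.
have Hnr : b <= 4 * m by rewrite /heap_size; clear; lia.
have s0 : 0 < s by rewrite /stride addn1.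
have hbig := fun _ : 0 < s => sampling_ok_large.
have Hcell i : i < m -> [/\ hcell sb (160 + i), 160 + i <= MA & 160 + i < W].
  move=> hi; split.
  - by rewrite /hcell; move: hi; clear; lia.
  - by move: hi bMA; rewrite /heap_size; clear; lia.
  - by move: hi TW bn hn1; rewrite /heap_size; clear; lia.
apply: (wp_seq HW (t1 := n * 400 + kappa * (n * 800 + 300))); last by apply: leq_trans ht; exact: leq_addr.
apply: (wp_seq HW (t1 := n * 400)); last exact: leq_addr.
apply: (wp_GEO _ HW (x := x) hpar) => // f4 e4.
rewrite addKn.
apply: (wp_BUILD_all _ HW hbig sb160 Xkk_ok Tpos m0 mW Xkh_ok HI Hnr s0 e4) => // f5 e5.
apply: (wp_MAIN _ HW hbig sb160 Xkk_ok Tpos m0 mW Hcell Xkh_ok HI Hnr e5) => //.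
  by move: ht; clear; lia.
move=> f6 r hr; apply: HQ => hg; apply: rounds_sort => //; last exact: Xkh_ok.
apply: less_correct => //; [exact: good_large|exact: Xkk_ok|by right].
Qed.
End Large.

Lemma wp_SMALL t (Q : ast -> Prop) f q :
  f 2 = n -> f 3 = b -> b * (TROUND I 0 n 1 0 0 + 50) + 60 <= t ->
  (forall f', Q (Ast f' q (sort (sle T) I))) ->
  wp (SMALL ;; MAIN) t Q (Ast f q [::]).
Proof.
move=> f2 f3 ht HQ.
apply: (wp_seq HW (t1 := 20)); last by move: ht; clear; lia.
wsv 0; first by rewrite /=; split=> //; exact: ltnW.
wsv (size T); first by [].
wsv 1; first by [].
wsl 0; first by rewrite /=; split=> //; exact: ltnW.
(* With s = 0 the conditions on the samples are vacuous, and the values passed for them are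
   arbitrary. *)
have [hbig s160] : (0 < 0 -> sampling_ok w T MA 0 0 0 0 0 160 id id id id) /\ 160 <= 160 by [].
have h0 : n %/ 0 < 2 ^ 0 by [].
have Hcell i : i < 1 -> [/\ hcell 160 (0 + i), 0 + i <= MA & 0 + i < W].
  by case: i => //= _; split => //; exact: ltnW.
have hnr : b <= b * 1 by rewrite muln1.
set f1 := upd _ 7 0.
have e1 : env w T I 0 n 1 0 0 0 0 0 160 id id id id f1 by [].
apply: (wp_MAIN _ HW hbig s160 h0 Tpos (isT : 0 < 1) W1 Hcell (isT : 1 < 2 ^ 1) HI hnr e1) => //.
  by move: ht; clear; lia.
move=> f' r hr; rewrite (_ : (iter _ _ _).2 = sort (sle T) I) //; apply: rounds_sort => //.
apply: less_correct => //; by left.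
Qed.
Lemma wp_BODY n0 t (Q : ast -> Prop) f :
  n0 = 32 ^ 169 -> 1000 <= n0 -> f 0 = n -> f 1 = b ->
  (n < n0 -> b * (TROUND I 0 n 1 0 0 + 50) + 300 <= t) ->
  (n0 <= n -> n * 400 + kappa * (n * 800 + 300) + 4 * (TROUND I (stride T I) (stride T I) (heap_size I) bisection_depth heap_depth + 50) + 300 <= t) ->
  (forall f' q o, (n < n0 -> o = sort (sle T) I) ->
     (n0 <= n -> forall j p c, params n j p c -> good_tape p c w j T tape -> o = sort (sle T) I) ->
     Q (Ast f' q o)) ->
  wp (BODY n0) t Q (Ast f 0 [::]).
Proof.
move=> En0 hn0 f0 f1 ht1 ht2 HQ.
have ht0 : 300 <= t.
  by case: (ltnP n n0) => h; [apply: leq_trans (ht1 h)|apply: leq_trans (ht2 h)]; exact: leq_addl.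
have W0 : 0 < W by exact: ltnW.
wsv (size T); first by [].
wsv (size I); first by [].
apply: (wp_seq HW (t1 := 68)); last by wtime.
apply: wp_DRAW => // f2 h1 h2.
have l2 y : y < 60 -> f2 y = upd (upd f 2 n) 3 b y by move=> hy; apply: h1; rewrite /RG hy.
have r2 : f2 2 = n by rewrite l2.
have r3 : f2 3 = b by rewrite l2.
have rR cc i : cc < kappa -> i < 4 -> f2 (RG cc i) = x cc i.
  by move=> hc hi; rewrite h2 // subn0 add0n modn_small.
clear h1 h2 l2.
have hn0W : n0 <= n -> n0 %% W = n0 by move=> h; rewrite modn_small //; exact: leq_ltn_trans h TW.
have hcond : (n %/ (n0 %% W) == 0) = (n < n0).
  case: (leqP n0 n) => h.
    by rewrite hn0W // -leqn0 leqNgt divn_gt0 ?h // (leq_trans _ hn0).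
  case: (ltnP n0 W) => hW; first by rewrite modn_small // divn_small.
  have dW : W %| n0.
    rewrite En0 (_ : 32 = 2 ^ 5) // -expnM dvdn_exp2l //.
    by rewrite -(leq_exp2l (m := 2)) // expnM -(_ : 32 = 2 ^ 5) // -En0.
  by move: dW; rewrite /dvdn => /eqP->; rewrite divn0.
apply: (wp_ife HW) => //=; first by move: ht0; clear; lia.
- rewrite r2 hcond -leqNgt => h.
  have [j [p [c [hj hpar]]]] := params_ex En0 h.
  apply: (wp_LARGE hpar) => //; first exact: leq_trans h.
    by move: (ht2 h); clear; lia.
  move=> f' o ho; apply: HQ; first by rewrite ltnNge h.
  by move=> _ j' p' c' /(params_uniq hpar)[<- <- <-].
- rewrite r2 => /eqP; rewrite hcond => h.
  apply: wp_SMALL => //; first by move: (ht1 h); clear; lia.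
  by move=> f'; apply: HQ => //; rewrite leqNgt h.
Qed.
End Body.

(** * Running time and correctness *)

Definition Ktest := 4 * (260 * 2) + 1000.
Definition Kcmp := 200 + 2 * (17 * Ktest + 100) + 60 + 60.
Definition Ksift := 2 * Kcmp + 300 + 100.
Definition Kround := 500 + (2 * Kcmp + Ksift + 100) + Ksift.

Lemma TTEST_le s : 0 < s -> TTEST s <= Ktest * s.
Proof. by rewrite /TTEST /TPHI /Ktest; lia. Qed.

Lemma TLT_le s kk l : 0 < s -> 0 < l -> kk <= 2 * l -> TLT s s kk <= Kcmp * (l * s).
Proof.
move=> s0 l0 hkk; rewrite /TLT /TCMP /Kcmp /kappa; move: (TTEST s) Ktest (TTEST_le s0) => X K h.
have h1 : 17 * X + 100 <= (17 * K + 100) * s by rewrite mulnDl -mulnA leq_add ?leq_mul // leq_pmulr.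
have h2 := leq_mul hkk h1.
have h3 : s <= l * s by rewrite leq_pmull.
have E : 2 * l * ((17 * K + 100) * s) = 2 * (17 * K + 100) * (l * s).
  by rewrite -!mulnA; congr (2 * _); rewrite mulnCA.
rewrite E in h2; move: (17 * K + 100) (17 * X + 100) (l * s) h2 h3 s0 => C Y P; clear.
move: (2 * C) => C2; rewrite !mulnDl; lia.
Qed.

Lemma TSIFT_le s kk l k : 0 < s -> 0 < l -> kk <= 2 * l -> k < l -> TSIFT s s kk k <= Ksift * (l * l * s).
Proof.
move=> s0 l0 hkk hk; rewrite /TSIFT /Ksift; move: (TLT s s kk) Kcmp (TLT_le s0 l0 hkk) => X K h.
have h1 : 0 < l * s by rewrite muln_gt0 l0.
have h2 : 2 * X + 300 <= (2 * K + 300) * (l * s) by rewrite mulnDl -mulnA leq_add ?leq_mul // leq_pmulr.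
have h3 := leq_mul hk h2; have h4 : 0 < l * l * s by rewrite -mulnA muln_gt0 l0.
have E : l * ((2 * K + 300) * (l * s)) = (2 * K + 300) * (l * l * s).
  by rewrite mulnCA -!mulnA.
rewrite E in h3; apply: leq_trans (leq_add h3 (leqnn _)) _.
by rewrite [X in _ <= X]mulnDl leq_add2l leq_pmulr.
Qed.

Lemma TROUND_le I s m kk kh l : 0 < s -> 0 < l -> kk <= 2 * l -> kh < l -> m <= size I -> 0 < size I ->
  TROUND I s s m kk kh + 50 <= Kround * (size I * (l * l * s)).
Proof.
move=> s0 l0 hkk hkh hm b0; rewrite /TROUND /TSEL /Kround.
have hT := TLT_le s0 l0 hkk; have hS := TSIFT_le s0 l0 hkk hkh.
move: (TLT s s kk) (TSIFT s s kk kh) Kcmp Ksift hT hS => X Y K L hT hS.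
have z0 : 0 < l * l * s by rewrite -mulnA !muln_gt0 l0 s0.
have hls : l * s <= l * l * s by rewrite leq_mul2r leq_pmulr ?orbT.
move: (l * l * s) (l * s) z0 hls hT hS => Z P z0 hP hT hS.
have {hT} hT : X <= K * Z by apply: leq_trans hT _; rewrite leq_mul2l hP orbT.
have h1 : 2 * X + Y + 100 + 40 <= (2 * K + L + 140) * Z by move: hT hS z0; clear; nia.
have h2 : Y + 100 <= (L + 100) * Z by move: hS z0; clear; nia.
have h3 := leq_mul (leqnn (size I)) h1; have h4 := leq_mul hm h2.
have h5 : size I <= size I * Z by rewrite leq_pmulr.
rewrite mulnCA [size I * ((L + 100) * Z)]mulnCA in h3 h4.
move: (size I) (size I * Z) (2 * K) h3 h4 h5 hm b0 => b Q K2 h3 h4 h5 hm b0.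
apply: leq_trans (_ : m * 40 + 30 + ((K2 + L + 140) * Q + 30) + ((L + 100) * Q + 40) + (m * 60 + 30) + 50 <= _).
  by move: h3 h4; clear; lia.
rewrite !mulnDl; move: h5 hm b0; clear; lia.
Qed.

(** Since b / 816 + 2 <= 2 b, the bisection depth is at most lg b + 1 <= 2 lg b. *)
Lemma lg_bounds b : 0 < b -> (trunc_log 2 (b %/ 816 + 2)).+1 <= 2 * lg b /\ trunc_log 2 (b %/ 4 + 1) < lg b.
Proof.
move=> b0; split.
  apply: leq_trans (_ : (trunc_log 2 b.*2).+1 <= _).
    by rewrite ltnS leq_trunc_log //; lia.
  by rewrite trunc_log2_double // /lg; lia.
by rewrite /lg ltnS leq_trunc_log //; lia.
Qed.

(** The purpose of the stride: b comparisons at O(s) each amount to O(n), because b <= 816 q and q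
    (n / q) <= n for q samples; the final + 1 contributes b <= n. *)
Lemma size_blocks_le b n : 0 < b -> b <= n -> b * (n %/ (b %/ 816 + 2) + 1) <= 817 * n.
Proof.
move=> b0 bn.
have h1 : b <= 816 * (b %/ 816 + 2) by lia.
have h2 := leq_trunc_div n (b %/ 816 + 2).
move: (b %/ 816 + 2) h1 h2 => x h1 h2.
have := leq_mul h1 (leqnn (n %/ x)); rewrite -mulnA (mulnC x) => h3.
rewrite mulnDr muln1; move: (n %/ x * x) (b * (n %/ x)) h2 h3 => A B; move: bn; clear; lia.
Qed.

Lemma large_time : exists K, forall T I : seq nat, 0 < size I -> size I <= size T ->
  TROUND I (stride T I) (stride T I) (heap_size I) (bisection_depth I) (heap_depth I) + 50 <= K * (size T * lg (size I) ^ 2).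
Proof.
exists (Kround * 817) => T I b0 bn; have [h1 h2] := lg_bounds b0.
have s0 : 0 < stride T I by rewrite /stride addn1.
have m0 : heap_size I <= size I by rewrite /heap_size; move: b0; clear; lia.
have l0 : 0 < lg (size I) by [].
move: Kround (TROUND_le s0 l0 h1 h2 m0 b0) => K h; apply: leq_trans h _.
move: (lg _) => L; rewrite -mulnn -(mulnA K) leq_mul2l; apply/orP; right.
have -> : size I * (L * L * stride T I) = size I * stride T I * (L * L) by rewrite [_ * stride T I]mulnC mulnA.
by rewrite [817 * _]mulnA; apply: leq_mul => //; exact: size_blocks_le.
Qed.

(** The cost is monotone in both sizes, so its value at N bounds all shorter texts. *)
Lemma small_time N : exists K, forall T I : seq nat, size T < N -> size I <= size T ->
  size I * (TROUND I 0 (size T) 1 0 0 + 50) <= K.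
Proof.
exists (N * (TROUND (nseq N 0) 0 N 1 0 0 + 50)) => T I hT hI.
have hTN : size T <= N by exact: ltnW.
have hIN : size I <= N by exact: leq_trans hTN.
apply: leq_mul => //; rewrite leq_add2r /TROUND size_nseq.
have h1 : TLT 0 (size T) 0 <= TLT 0 N 0 by rewrite /TLT /TCMP; lia.
have h2 : TSIFT 0 (size T) 0 0 <= TSIFT 0 N 0 0 by rewrite /TSIFT; lia.
have h3 : TSEL 0 (size T) 0 0 <= TSEL 0 N 0 0 by rewrite /TSEL; lia.
have := leq_mul hIN (leq_add h3 (leqnn 40)); lia.
Qed.

(** The first instruction dismisses the empty index set. Only then can the text be empty and w be 0,
    in which case a word cannot even hold 1; for b > 0, n >= 1 forces w >= 1. *)
Definition prog c := Jz 1 (cmd_size c).+1 :: compile 1 c ++ [:: Halt].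

Lemma iter_halted w P T I tape s k : halted s -> iter k (step w P T I tape) s = s.
Proof.
move=> hs; elim: k => //= k ->; by case: s hs => ? ? ? ? ? [].
Qed.

Lemma run_halted w P T I tape t L s : run w P T I tape t = s -> halted s -> t <= L ->
  run w P T I tape L = s.
Proof. by move=> <- hs hL; rewrite /run -(subnK hL) iterD iter_halted. Qed.

Lemma run_prog w c T I tape MA L (Q : ast -> Prop) : 1 < L -> size T < 2 ^ w -> size I < 2 ^ w -> 0 < MA ->
  (size I = 0 -> Q (Ast (regs (init T I)) 0 [::])) ->
  (0 < size I -> wp w T I tape MA c (L - 2) Q (Ast (regs (init T I)) 0 [::])) ->
  let s := run w (prog c) T I tape L in
  [/\ halted s, maxaddr s <= MA & exists st, Q st /\ outp s = ou st].
Proof.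
move=> L2 nW bW MA0 HQ0 Hwp s.
have hend : nth Halt (prog c) (cmd_size c).+1 = Halt by rewrite /= nth_cat size_comp ltnn subnn.
have first : run w (prog c) T I tape 1 =
  St (if size I == 0 then (cmd_size c).+1 else 1) (regs (init T I)) 0 [::] 1 false by [].
have [b0|b0] := posnP (size I).
  have -> : s = St (cmd_size c).+1 (regs (init T I)) 0 [::] 1 true.
    apply: (run_halted (t := 2)) => //.
    by rewrite /run iterS -/(run _ _ _ _ _ 1) first b0 eqxx /step hend.
  by split => //; exists (Ast (regs (init T I)) 0 [::]); split => //; exact: HQ0.
have fr : frag (prog c) 1 (compile 1 c) by move=> k hk; rewrite add1n /= nth_cat hk.
have hrel : represents w (regs (init T I)) (regs (init T I)).
  by split => // y; rewrite /= /upd; case: ifP => _ //; case: ifP => // _; rewrite expn_gt0.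
have [t' [r' [m' [s' [h1 h2 h3 h4 h5]]]]] := Hwp b0 _ _ _ 1 fr hrel MA0.
have -> : s = St (cmd_size c).+1 r' (rp s') (ou s') m' true.
  apply: (run_halted (t := t'.+2)) => //; last by move: h1 L2; clear; lia.
  by rewrite /run iterS -addn1 iterD -/(run _ _ _ _ _ 1) first gtn_eqF // h2 /mk add1n /step hend.
by split => //; exists s'.
Qed.

Section Run.
Variables (w n0 : nat) (T I : seq nat) (tape : nat -> nat) (MA L : nat).
Local Notation W := (2 ^ w).
Local Notation n := (size T).
Local Notation b := (size I).
Hypothesis nW : n < W.
Hypothesis TletW : all (fun a => a < W) T.
Hypothesis Tpos : all (ltn 0) T.
Hypothesis HI : all (fun i => 0 < i <= n) I.
Hypothesis uI : uniq I.
Hypothesis bMA : b + 1000 <= MA.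
Hypothesis tapeW : forall i, tape i < W.
Hypothesis En0 : n0 = 32 ^ 169.
Hypothesis hn0 : 1000 <= n0.
Hypothesis L2 : 1 < L.
Hypothesis small_ok : n < n0 -> b * (TROUND I 0 n 1 0 0 + 50) + 302 <= L.
Hypothesis large_ok : n0 <= n -> 0 < b ->
  n * 400 + kappa * (n * 800 + 300) + 4 * (TROUND I (stride T I) (stride T I) (heap_size I) (bisection_depth I) (heap_depth I) + 50) + 302 <= L.

Lemma card_indices : b <= n.
Proof.
rewrite -(size_iota 1 n); apply: uniq_leq_size => // i /(allP HI).
by rewrite mem_iota add1n ltnS.
Qed.

Lemma run_body : let s := run w (prog (BODY n0)) T I tape L in
  [/\ halted s, maxaddr s <= MA, n < n0 -> outp s = sort (sle T) I &
   n0 <= n -> forall j p c, params n j p c -> good_tape p c w j T tape -> outp s = sort (sle T) I].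
Proof.
move=> s; have bn := card_indices.
pose Q st := (n < n0 -> ou st = sort (sle T) I) /\
  (n0 <= n -> forall j p c, params n j p c -> good_tape p c w j T tape -> ou st = sort (sle T) I).
have MA0 : 160 <= MA by apply: leq_trans bMA; rewrite addnC.
have [||||h1 h2 [st [[h3 h4] ->]]] := @run_prog w (BODY n0) T I tape MA L Q L2 nW.
- exact: leq_ltn_trans nW.
- exact: leq_trans MA0.
- by move=> b0; rewrite /Q (size0nil b0).
- move=> b0; have n1 : 0 < n by exact: leq_trans bn.
  have HW : machine_ok w T I MA.
    split => //; first exact: leq_trans nW.
    by apply/allP => i /(allP HI)/andP[_ hi]; exact: leq_ltn_trans nW.
  apply: (wp_BODY HW Tpos HI uI bn b0 bMA tapeW En0 hn0) => //.
  + by move=> h; move: (small_ok h); clear; lia.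
  + by move=> h; move: (large_ok h b0); clear; lia.
- by split.
Qed.
End Run.

Lemma tape_of_word (L W : nat) (r : {ffun 'I_L -> 'I_W}) i : 0 < W -> tape_of r i < W.
Proof. by rewrite /tape_of; case: insub => [j|] //=. Qed.

Theorem theorem2 :
  exists (P : seq instr) (p q C : nat), 0 < p /\ 0 < q /\
  forall (w n sigma : nat) (T I : seq nat),
    size T = n -> all (fun a => (1 <= a <= sigma)) T ->
    n < 2 ^ w -> sigma < 2 ^ w ->
    uniq I -> all (fun i => (1 <= i <= n)) I ->
    let b := size I in
    let L := C * n * (lg b) ^ 2 + C in
    (* worst-case time and working-space bounds, for every random tape *)
    (forall r : {ffun 'I_L -> 'I_(2 ^ w)},
        halted (run w P T I (tape_of r) L) /\
        (maxaddr (run w P T I (tape_of r) L)).+1 <= C * b + C) /\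
    (* correct with probability >= 1 - n^(-p/q) *)
    #|[pred r : {ffun 'I_L -> 'I_(2 ^ w)} |
        ~~ is_sparse_suffix_array T I (outp (run w P T I (tape_of r) L))]| ^ q
      * n ^ p
    <= #|{ffun 'I_L -> 'I_(2 ^ w)}| ^ q.
Proof.
(* The threshold is named through an equation, which keeps the unary number 32^169 from being
   evaluated. *)
have [n0 En0] : exists n0, n0 = 32 ^ 169 by eexists.
have hn0 : 1000 <= n0.
  by rewrite En0; apply: leq_trans (_ : 32 ^ 2 <= _) => //; rewrite leq_exp2l.
have [K1 hK1] := large_time; have [K2 hK2] := small_time n0.
(* 1001 serves the address bound, K2 + 302 the short texts, and the last constant the linear-time
   set-up (1100 n covers 800 n + 300 per copy) and the four rounds for long texts. *)
have [C [hC1 hC2 hC3]] : exists C, [/\ 1001 <= C, K2 + 302 <= C & 400 + 17 * 1100 + 4 * K1 <= C].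
  exists (1001 + (K2 + 302) + (400 + 17 * 1100 + 4 * K1)); split.
  - by rewrite -addnA leq_addr.
  - by rewrite -addnA addnCA leq_addr.
  - exact: leq_addl.
exists (prog (BODY n0)), 1, 5, C; do 2!split => //.
move=> w n sigma T I <- {n} hT nW hs uI HI b L.
have W0 : 0 < 2 ^ w by rewrite expn_gt0.
have Tpos : all (ltn 0) T by apply/allP => a /(allP hT)/andP[].
have TletW : all (fun a => a < 2 ^ w) T.
  by apply/allP => a /(allP hT)/andP[_ ha]; exact: leq_ltn_trans hs.
have bn : b <= size T := card_indices HI uI.
have CL : C <= L by exact: leq_addl.
have small_ok : size T < n0 -> b * (TROUND I 0 (size T) 1 0 0 + 50) + 302 <= L.
  by move=> h; apply: leq_trans CL; apply: leq_trans hC2; rewrite leq_add2r hK2.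
have large_ok : n0 <= size T -> 0 < b -> size T * 400 + kappa * (size T * 800 + 300) +
    4 * (TROUND I (stride T I) (stride T I) (heap_size I) (bisection_depth I) (heap_depth I) + 50) + 302 <= L.
  move=> h b0; have := hK1 T I b0 bn; rewrite -/b; move: (TROUND _ _ _ _ _ _ + 50) => R hR.
  have l0 : 0 < lg b ^ 2 by rewrite expn_gt0.
  have n1 : 0 < size T by exact: leq_trans bn.
  have h1 : size T <= size T * lg b ^ 2 by rewrite leq_pmulr.
  have h2 := leq_mul hC3 (leqnn (size T * lg b ^ 2)).
  rewrite /L /kappa -mulnA; move: (size T * lg b ^ 2) hR h1 h2 => X hR h1 h2.
  move: hC2 n1; rewrite mulnDl -mulnA in h2; move: (K1 * X) (C * X) h2 hR => Y Z h2 hR.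
  move: h1 h2 hR; clear; lia.
pose MA := C * b + C - 1.
have MA1 : MA.+1 = C * b + C by rewrite /MA subn1 prednK // addn_gt0 (leq_trans _ hC1) ?orbT.
have bMA : b + 1000 <= MA.
  rewrite -ltnS MA1 -addnS; apply: leq_add => //; rewrite leq_pmull //.
  exact: leq_trans hC1.
have spec (r : {ffun 'I_L -> 'I_(2 ^ w)}) := run_body nW TletW Tpos HI uI bMA
  (fun i => tape_of_word r i W0) En0 hn0 (leq_trans (isT : 1 < 1001) (leq_trans hC1 CL)) small_ok large_ok.
split; first by move=> r; have [h1 h2 _ _] := spec r; rewrite -MA1 ltnS.
case: (ltnP (size T) n0) => hn.
  (* Short texts are sorted without fingerprints, so no tape is bad. *)
  rewrite (_ : #|_| = 0) //; apply: eq_card0 => r; rewrite inE; apply/negbTE; rewrite negbK.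
  have [_ _ h _] := spec r; rewrite (h hn). exact: sort_ssa.
have [j [p [c [hj hpar]]]] := params_ex En0 hn.
have [/andP[j1 j2] pp hp _ hpp _ hc _] := hpar.
have kL : 4 * kappa <= L by apply: leq_trans CL; exact: leq_trans hC1.
rewrite card_ffun !card_ord; apply: leq_trans (bad_tapes_final pp hc nW hp hpp j1 j2 TletW kL hj).
rewrite leq_mul2r; apply/orP; right; rewrite leq_exp2r //.
apply: subset_leq_card; apply/subsetP => r; rewrite !inE; apply: contra => hg.
by have [_ _ _ h] := spec r; rewrite (h hn j p c hpar hg); exact: sort_ssa.
Qed.
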